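(* Let $\alpha>-1$ and let $\phi\in L^{\infty}(\mathbb{D},dA_{\alpha})$ be a nonconstant (complex-valued) harmonic function on $\mathbb{D}$. Then the numerical range of the Toeplitz operator $T_\phi$ on $L^2_a(dA_\alpha)$ satisfies $W(T_{\phi})=\operatorname{Rel\,int}\big(\overline{\phi(\mathbb{D})}^{\wedge}\big)$.
   Context: $\mathbb{D}$ is the open unit disc, $dA$ normalized area measure, $dA_{\alpha}(z)=(\alpha+1)(1-|z|^2)^{\alpha}dA(z)$. $L^{\infty}(\mathbb{D},dA_{\alpha})$ denotes the $A_\alpha$-essentially bounded measurable functions on $\mathbb{D}$. $L^2_a(dA_\alpha)$ is the closed subspace of analytic functions in $L^2(\mathbb{D},dA_\alpha)$, $P_\alpha$ the orthogonal projection onto it, and $T_\phi f=P_\alpha(\phi f)$. For a bounded operator $T$ on a Hilbert space, $W(T)=\{\langle Tf,f\rangle:\|f\|=1\}$. For $X\subseteq\mathbb{C}$, $X^{\wedge}$ is the convex hull, $\overline{X}$ the closure, and $\operatorname{Rel\,int} X$ the relative interior (interior relative to the affine hull of $X$). *)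

(* Defs.v *)
From HB Require Import structures.
From mathcomp Require Import all_boot all_order all_algebra.
From mathcomp Require Import all_classical all_reals all_analysis.
From mathcomp Require Import complex.

Set Implicit Arguments.
Unset Strict Implicit.
Unset Printing Implicit Defensive.

Import Order.TTheory GRing.Theory Num.Theory.
Import numFieldNormedType.Exports.

Local Open Scope classical_set_scope.
Local Open Scope ring_scope.

Section Bergman.
Variable R : realType.

Definition toC (p : R * R) : R[i] := Complex p.1 p.2.
Definition ofC (z : R[i]) : R * R := (complex.Re z, complex.Im z).

Definition cabs (z : R[i]) : R :=
  Num.sqrt (complex.Re z ^+ 2 + complex.Im z ^+ 2).

Definition disc : set (R * R) := [set p | p.1 ^+ 2 + p.2 ^+ 2 < 1].

Definition leb2 := (@lebesgue_measure R \x @lebesgue_measure R)%E.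

(* density of dA_alpha = (alpha+1)(1-|z|^2)^alpha dA with respect to
   Lebesgue measure dx dy, where dA = dx dy / pi is normalized area *)
Definition wA (alpha : R) (p : R * R) : R :=
  (alpha + 1) / pi * powR (1 - (p.1 ^+ 2 + p.2 ^+ 2)) alpha.

Definition intA (alpha : R) (g : R * R -> R) : \bar R :=
  (\int[leb2]_(p in disc) (wA alpha p * g p)%:E)%E.

Definition ipA (alpha : R) (f g : R * R -> R[i]) : R[i] :=
  Complex (fine (intA alpha (fun p => complex.Re (f p * conjc (g p)))))
          (fine (intA alpha (fun p => complex.Im (f p * conjc (g p))))).

Definition L2A (alpha : R) (f : R * R -> R[i]) : Prop :=
  [/\ measurable_fun disc (fun p => complex.Re (f p)),
      measurable_fun disc (fun p => complex.Im (f p)) &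
      (intA alpha (fun p => (cabs (f p) ^+ 2)%R) < +oo)%E].

Definition holomorphic_on (A : set (R * R)) (f : R * R -> R[i]) : Prop :=
  forall p, A p -> exists l : R[i], forall e : R, 0 < e ->
    exists2 d : R, 0 < d & forall h : R * R, h != 0 -> cabs (toC h) < d ->
      cabs ((f (p + h) - f p) / toC h - l) < e.

Definition A2 (alpha : R) (f : R * R -> R[i]) : Prop :=
  L2A alpha f /\ holomorphic_on disc f.

Definition is_projA (alpha : R) (g h : R * R -> R[i]) : Prop :=
  A2 alpha h /\ forall k, A2 alpha k -> ipA alpha (g \- h) k = 0.

Definition Palpha (alpha : R) (g : R * R -> R[i]) : R * R -> R[i] :=
  match pselect (exists h, is_projA alpha g h) with
  | left H => projT1 (cid H)
  | right _ => fun _ => 0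
  end.

Definition toeplitz (alpha : R) (phi f : R * R -> R[i]) : R * R -> R[i] :=
  Palpha alpha (fun p => phi p * f p).

Definition numrange (alpha : R) (phi : R * R -> R[i]) : set R[i] :=
  [set w | exists f, [/\ A2 alpha f, ipA alpha f f = 1 &
                         w = ipA alpha (toeplitz alpha phi f) f]].

(* phi in L^infty(D, dA_alpha): measurable and essentially bounded on D.
   dA_alpha and Lebesgue measure have the same null sets on D. *)
Definition LinfA (phi : R * R -> R[i]) : Prop :=
  [/\ measurable_fun disc (fun p => complex.Re (phi p)),
      measurable_fun disc (fun p => complex.Im (phi p)) &
      exists M : R, {ae leb2, forall p, disc p -> cabs (phi p) <= M}].

Definition e1 : R * R := (1, 0).
Definition e2 : R * R := (0, 1).

Definition harmonicR_on (A : set (R * R)) (u : R * R -> R) : Prop :=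
  forall p, A p ->
  [/\ differentiable u p,
      differentiable ('D_e1 u) p,
      differentiable ('D_e2 u) p,
      [/\ {for p, continuous ('D_e1 ('D_e1 u))},
          {for p, continuous ('D_e2 ('D_e1 u))},
          {for p, continuous ('D_e1 ('D_e2 u))} &
          {for p, continuous ('D_e2 ('D_e2 u))}] &
      'D_e1 ('D_e1 u) p + 'D_e2 ('D_e2 u) p = 0].

Definition harmonic_on (A : set (R * R)) (phi : R * R -> R[i]) : Prop :=
  harmonicR_on A (fun p => complex.Re (phi p)) /\
  harmonicR_on A (fun p => complex.Im (phi p)).

Definition nonconstant_on (A : set (R * R)) (phi : R * R -> R[i]) : Prop :=
  ~ exists c, forall p, A p -> phi p = c.

Definition conv_hull (A : set (R * R)) : set (R * R) :=
  [set x | exists n (l : 'I_n -> R) (y : 'I_n -> R * R),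
     [/\ forall i, 0 <= l i, \sum_(i < n) l i = 1, forall i, A (y i) &
         x = \sum_(i < n) l i *: y i]].

Definition aff_hull (A : set (R * R)) : set (R * R) :=
  [set x | exists n (l : 'I_n -> R) (y : 'I_n -> R * R),
     [/\ \sum_(i < n) l i = 1, forall i, A (y i) &
         x = \sum_(i < n) l i *: y i]].

Definition rel_int (A : set (R * R)) : set (R * R) :=
  [set x | A x /\ exists2 e : R, 0 < e &
             forall y, aff_hull A y -> ball x e y -> A y].

End Bergman.

Arguments disc {R}.
Arguments ofC {R}.
Arguments toC {R}.
Arguments cabs {R}.

(* Main.v *)
Require Import Defs.
From HB Require Import structures.
From mathcomp Require Import all_boot all_order all_algebra.
From mathcomp Require Import all_classical all_reals all_analysis.
From mathcomp Require Import complex measurable_realfun.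
From mathcomp Require Import ring lra.
Set Implicit Arguments.
Unset Strict Implicit.
Unset Printing Implicit Defensive.
Import Order.TTheory GRing.Theory Num.Theory.
Import numFieldNormedType.Exports.
Local Open Scope classical_set_scope.
Local Open Scope ring_scope.

(* For f in the Bergman space, <T_phi f, f> is the integral of phi |f|^2 against
   dA_alpha.  The numerical range W is convex (Toeplitz-Hausdorff), and it contains
   phi(D), because a bounded harmonic function is its own Berezin transform:
   <phi k_z, k_z> = phi(z) |k_z|^2 for the reproducing kernel k_z.  If a point
   <phi f, f> of W were not in the relative interior of the hull K of phi(D), some
   real affine functional L would be nonnegative on K, vanish at that point and not
   vanish identically on K; but then the integral of L(phi) |f|^2 is zero, so that
   L(phi) >= 0 has a zero in D and, being harmonic, vanishes identically.
   Conversely, a point of the relative interior of K outside the convex set W would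
   be separated from W, hence from phi(D) and from K. *)

(** The analysis is reduced to Taylor coefficients. A holomorphic function on the disc is a power
    series there, by Cauchy's formula, and the weight is rotation invariant, so monomials are
    orthogonal on every centred disc: an inner product over the disc of squared radius r is a sum of
    coefficients weighted by the moments [gam alpha r n]. Bessel's inequality then yields the
    projection, and division by the moments yields the kernel. The obstacle in the Berezin identity
    is that a bounded harmonic u is the real part of a power series F for which no bound is at hand.
    So F k_z is paired with k_z on smaller discs only, which gives the sum of c_m z^m gam(r, m) /
    gam(1, m), where c_m are the coefficients of F k_z. As r tends to 1 the limit is taken termwise
    on this side, and by dominated convergence for u alone on the other. W is not known to be
    closed, and the point to separate may belong to the convex set, so strict separation is out of
    reach. Both inclusions rest on proper separation: outside the relative interior there is a
    functional that is minimal at the point and not constant on the set. *)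

(** * Modulus, conjugation, real and imaginary parts *)

Section ComplexModulus.
Context {R : realType}.
Implicit Types (x y z w : R[i]) (r : R).

Lemma cabsE z : cabs z = Normc.normc z.
Proof. by case: z. Qed.

Lemma cabs_ge0 z : 0 <= cabs z.
Proof. exact: sqrtr_ge0. Qed.

Lemma cabs0 : cabs (0 : R[i]) = 0.
Proof. by rewrite cabsE Normc.normc0. Qed.

Lemma cabs1 : cabs (1 : R[i]) = 1.
Proof. by rewrite cabsE Normc.normc1. Qed.

Lemma cabsM x y : cabs (x * y) = cabs x * cabs y.
Proof. by rewrite !cabsE Normc.normcM. Qed.

Lemma cabsV x : cabs x^-1 = (cabs x)^-1.
Proof. by rewrite !cabsE Normc.normcV. Qed.

Lemma cabsD x y : cabs (x + y) <= cabs x + cabs y.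
Proof. by rewrite !cabsE; exact: (@le_normcD R). Qed.

Lemma cabsN x : cabs (- x) = cabs x.
Proof. by rewrite !cabsE; exact: (@normcN R). Qed.

Lemma cabsB x y : cabs (x - y) <= cabs x + cabs y.
Proof. by rewrite -(cabsN y) cabsD. Qed.

Lemma cabsC x y : cabs (x - y) = cabs (y - x).
Proof. by rewrite -cabsN opprB. Qed.

Lemma cabs_tri x y z : cabs (x - z) <= cabs (x - y) + cabs (y - z).
Proof. by rewrite -(subrKA y) cabsD. Qed.

Lemma cabs_eq0 z : cabs z = 0 -> z = 0.
Proof. by rewrite cabsE => /Normc.eq0_normc. Qed.

Lemma cabs_gt0 z : (0 < cabs z) = (z != 0).
Proof.
rewrite lt0r cabs_ge0 andbT; congr negb; apply/eqP/eqP => [/cabs_eq0//|->].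
exact: cabs0.
Qed.

Lemma cabsX z n : cabs (z ^+ n) = cabs z ^+ n.
Proof. by elim: n => [|n IH]; rewrite ?expr0 ?cabs1// !exprS cabsM IH. Qed.

Lemma cabsR r : cabs (r%:C)%C = `|r|.
Proof. by rewrite /cabs /= expr0n addr0 sqrtr_sqr. Qed.

Lemma cabsJ z : cabs (conjc z) = cabs z.
Proof. by case: z => a b; rewrite /cabs /= sqrrN. Qed.

Lemma cabs_sqr z : cabs z ^+ 2 = complex.Re z ^+ 2 + complex.Im z ^+ 2.
Proof. by rewrite /cabs sqr_sqrtr// addr_ge0// sqr_ge0. Qed.

Lemma mulcJ z : z * conjc z = ((cabs z ^+ 2)%:C)%C.
Proof.
by rewrite cabs_sqr; case: z => a b; apply/eqP; rewrite eq_complex /=;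
  apply/andP; split; apply/eqP; ring.
Qed.

Lemma ReD z w : complex.Re (z + w) = complex.Re z + complex.Re w.
Proof. by case: z w => [? ?] [? ?]. Qed.
Lemma ImD z w : complex.Im (z + w) = complex.Im z + complex.Im w.
Proof. by case: z w => [? ?] [? ?]. Qed.
Lemma ReN z : complex.Re (- z) = - complex.Re z.
Proof. by case: z. Qed.
Lemma ImN z : complex.Im (- z) = - complex.Im z.
Proof. by case: z. Qed.
Lemma ReM z w : complex.Re (z * w) =
  complex.Re z * complex.Re w - complex.Im z * complex.Im w.
Proof. by case: z w => [? ?] [? ?]. Qed.
Lemma ImM z w : complex.Im (z * w) =
  complex.Re z * complex.Im w + complex.Im z * complex.Re w.
Proof. by case: z w => [? ?] [? ?]. Qed.
Lemma ReJ z : complex.Re (conjc z) = complex.Re z.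
Proof. by case: z. Qed.
Lemma ImJ z : complex.Im (conjc z) = - complex.Im z.
Proof. by case: z. Qed.

Definition ReImE := (ReD, ImD, ReN, ImN, ReM, ImM, ReJ, ImJ).

Lemma complexP z w :
  complex.Re z = complex.Re w -> complex.Im z = complex.Im w -> z = w.
Proof. by case: z w => [? ?] [? ?] /= -> ->. Qed.

Lemma abs_Re_le z : `|complex.Re z| <= cabs z.
Proof.
by rewrite -[leLHS]sqrtr_sqr; apply: ler_wsqrtr; rewrite lerDl sqr_ge0.
Qed.

Lemma abs_Im_le z : `|complex.Im z| <= cabs z.
Proof.
by rewrite -[leLHS]sqrtr_sqr; apply: ler_wsqrtr; rewrite lerDr sqr_ge0.
Qed.

Lemma cabs_le z : cabs z <= `|complex.Re z| + `|complex.Im z|.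
Proof.
rewrite -(ler_pXn2r (ltn0Sn 1)) ?nnegrE ?cabs_ge0 ?addr_ge0//.
rewrite cabs_sqr sqrrD !real_normK ?num_real//.
by rewrite lerD2r lerDl mulrn_wge0// mulr_ge0.
Qed.

Lemma cabs_sum (I : Type) (s : seq I) (P : pred I) (F : I -> R[i]) :
  cabs (\sum_(i <- s | P i) F i) <= \sum_(i <- s | P i) cabs (F i).
Proof.
elim/big_rec2: _ => [|i y1 y2 _ H]; first by rewrite cabs0.
by apply: le_trans (cabsD _ _) _; rewrite lerD2l.
Qed.

Lemma Re_sum (I : Type) (s : seq I) (P : pred I) (F : I -> R[i]) :
  complex.Re (\sum_(i <- s | P i) F i) = \sum_(i <- s | P i) complex.Re (F i).
Proof. by elim/big_rec2: _ => // i y1 y2 _ <-; rewrite ReD. Qed.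

Lemma Im_sum (I : Type) (s : seq I) (P : pred I) (F : I -> R[i]) :
  complex.Im (\sum_(i <- s | P i) F i) = \sum_(i <- s | P i) complex.Im (F i).
Proof. by elim/big_rec2: _ => // i y1 y2 _ <-; rewrite ImD. Qed.

Lemma conjcD z w : conjc (z + w) = conjc z + conjc w.
Proof. by apply: complexP; rewrite !ReImE// opprD. Qed.
Lemma conjcM z w : conjc (z * w) = conjc z * conjc w.
Proof. by apply: complexP; rewrite !ReImE; ring. Qed.
Lemma conjcN z : conjc (- z) = - conjc z.
Proof. by apply: complexP; rewrite !ReImE. Qed.
Lemma conjcX z n : conjc (z ^+ n) = conjc z ^+ n.
Proof.
elim: n => [|n IH]; first by rewrite !expr0; apply: complexP => //=; rewrite oppr0.
by rewrite !exprS conjcM IH.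
Qed.
Lemma conjc_sum (I : Type) (s : seq I) (P : pred I) (F : I -> R[i]) :
  conjc (\sum_(i <- s | P i) F i) = \sum_(i <- s | P i) conjc (F i).
Proof.
elim/big_rec2: _ => [|i y1 y2 _ <-]; last by rewrite conjcD.
by apply: complexP => //=; rewrite oppr0.
Qed.
Lemma conjc_real r : conjc (r%:C)%C = (r%:C)%C.
Proof. by apply: complexP => //=; rewrite oppr0. Qed.

Lemma ler_inf_eps (a b : R) : (forall e, 0 < e -> a <= b + e) -> a <= b.
Proof. by move=> H; apply/ler_addgt0Pr. Qed.

Lemma cabs_eps0 z : (forall e, 0 < e -> cabs z <= e) -> z = 0.
Proof.
move=> H; apply: cabs_eq0; apply/eqP; rewrite eq_le cabs_ge0 andbT.
by apply: ler_inf_eps => e /H; rewrite add0r.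
Qed.

End ComplexModulus.

(** * Complex sequences, and series with a geometric bound *)

Section ComplexSequences.
Context {R : realType}.
Implicit Types (u v : nat -> R[i]) (l m : R[i]).

(** An explicit epsilon form, because [cabs] takes values in [R] whereas the norm of [R[i]] takes
    values in [R[i]]; [ccvgP] links it to the topology of [R]. *)
Definition ccvg u l := forall e : R, 0 < e ->
  exists N, forall n, (N <= n)%N -> cabs (u n - l) < e.

Lemma ccvg_unique u l m : ccvg u l -> ccvg u m -> l = m.
Proof.
move=> Hl Hm; apply/eqP; rewrite -subr_eq0; apply/eqP.
apply: cabs_eps0 => e e0.
have e2 : 0 < e / 2 by rewrite divr_gt0.
have [N1 H1] := Hl _ e2; have [N2 H2] := Hm _ e2.
apply: le_trans (cabs_tri l (u (maxn N1 N2)) m) _.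
rewrite cabsC; have := H1 _ (leq_maxl N1 N2); have := H2 _ (leq_maxr N1 N2).
by lra.
Qed.

Lemma ccvg_ext u v l : (forall n, u n = v n) -> ccvg u l -> ccvg v l.
Proof. by move=> H Hu e /Hu[N HN]; exists N => n /HN; rewrite H. Qed.

Lemma ccvg_cst l : ccvg (fun=> l) l.
Proof. by move=> e e0; exists 0%N => n _; rewrite subrr cabs0. Qed.

Lemma ccvgD u v l m : ccvg u l -> ccvg v m -> ccvg (fun n => u n + v n) (l + m).
Proof.
move=> Hl Hm e e0; have e2 : 0 < e / 2 by rewrite divr_gt0.
have [N1 H1] := Hl _ e2; have [N2 H2] := Hm _ e2.
exists (maxn N1 N2) => n; rewrite geq_max => /andP[/H1 a1 /H2 a2].
rewrite opprD addrACA; apply: le_lt_trans (cabsD _ _) _; lra.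
Qed.

Lemma ccvgZ u l c : ccvg u l -> ccvg (fun n => c * u n) (c * l).
Proof.
move=> Hl e e0; have c0 : 0 < cabs c + 1 by rewrite ltr_wpDl// cabs_ge0.
have [N H] := Hl _ (divr_gt0 e0 c0); exists N => n /H.
rewrite -mulrBr cabsM ltr_pdivlMr// mulrC => h.
apply: le_lt_trans h; rewrite ler_wpM2r ?cabs_ge0// lerDl; lra.
Qed.

Lemma ccvgB u v l m : ccvg u l -> ccvg v m -> ccvg (fun n => u n - v n) (l - m).
Proof.
move=> Hl Hm; rewrite -mulN1r; apply: (ccvg_ext (u := fun n => u n + (-1) * v n)).
  by move=> n; rewrite mulN1r.
by apply: ccvgD => //; exact: ccvgZ.
Qed.

Lemma ccvg_le u l (b : R) : ccvg u l -> (forall n, cabs (u n) <= b) -> cabs l <= b.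
Proof.
move=> Hl Hb; apply: ler_inf_eps => e e0; have [N /(_ N (leqnn _))] := Hl _ e0.
rewrite cabsC => h; have := cabsD (l - u N) (u N); rewrite subrK.
by have := Hb N; lra.
Qed.

Lemma ccvgP u l :
  ccvg u l <->
  (fun n => complex.Re (u n)) @ \oo --> complex.Re l /\
  (fun n => complex.Im (u n)) @ \oo --> complex.Im l.
Proof.
split=> [H|[Hr Hi] e e0].
  split; apply/cvgrPdist_lt => e /H[N HN]; exists N => // n /= /HN;
    rewrite cabsC; apply: le_lt_trans.
    by rewrite -ReN -ReD; exact: abs_Re_le.
  by rewrite -ImN -ImD; exact: abs_Im_le.
have e2 : 0 < e / 2 by rewrite divr_gt0.
move/cvgrPdist_lt: Hr => /(_ _ e2)[N1 _ H1].
move/cvgrPdist_lt: Hi => /(_ _ e2)[N2 _ H2].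
exists (maxn N1 N2) => n; rewrite geq_max => /andP[/H1 /= a1 /H2 /= a2].
rewrite cabsC; apply: le_lt_trans (cabs_le _) _; rewrite !ReImE; lra.
Qed.

(** The value is meaningless when a series diverges; the geometric bound of [csum_geo] guards every
    use. *)
Definition csum (a : nat -> R[i]) : R[i] :=
  Complex (limn (series (fun n => complex.Re (a n))))
          (limn (series (fun n => complex.Im (a n)))).

Lemma expr_small (q e : R) : 0 <= q < 1 -> 0 < e ->
  exists N, forall n, (N <= n)%N -> q ^+ n < e.
Proof.
move=> /andP[q0 q1] e0.
have /(cvg_geometric 1)/cvgrPdist_lt/(_ _ e0)[N _ HN] : `|q| < 1 by rewrite ger0_norm.
exists N => n /HN /=; rewrite sub0r normrN mul1r ger0_norm//.
exact: exprn_ge0.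
Qed.

Lemma sum_geo_le (q : R) n : 0 <= q < 1 -> \sum_(k < n) q ^+ k <= (1 - q)^-1.
Proof.
move=> /andP[q0 q1]; have q2 : 0 < 1 - q by rewrite subr_gt0.
rewrite -[leRHS]mul1r ler_pdivlMr// mulrC.
have := subrX1 q n; rewrite -[X in X * _]opprB mulNr => E.
have -> : (1 - q) * \sum_(k < n) q ^+ k = 1 - q ^+ n by rewrite -[LHS]opprK -E opprB.
by rewrite gerBl exprn_ge0.
Qed.

Lemma csum_geo a (M q : R) : 0 <= q < 1 -> (forall n, cabs (a n) <= M * q ^+ n) ->
  ccvg (fun N => \sum_(n < N) a n) (csum a) /\
  forall N, cabs (csum a - \sum_(n < N) a n) <= M / (1 - q) * q ^+ N.
Proof.
move=> q01 Ha; have /andP[q0 q1] := q01.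
have M0 : 0 <= M by have := Ha 0%N; rewrite expr0 mulr1; apply: le_trans; exact: cabs_ge0.
have q1' : `|q| < 1 by rewrite ger0_norm.
have C (b : nat -> R) : (forall n, `|b n| <= cabs (a n)) -> cvgn (series b).
  move=> Hb; apply: normed_cvg.
  apply: (@series_le_cvg _ _ (geometric M q)) => //=.
  - by move=> n; rewrite /= mulr_ge0// exprn_ge0.
  - by move=> n; apply: le_trans (Hb n) (Ha n).
  - exact: is_cvg_geometric_series.
have H : ccvg (fun N => \sum_(n < N) a n) (csum a).
  apply/ccvgP; split => /=.
    have /C := fun n => abs_Re_le (a n).
    apply: cvg_trans; apply: near_eq_cvg; near=> n.
    by rewrite /series/= big_mkord Re_sum.
  have /C := fun n => abs_Im_le (a n).
  apply: cvg_trans; apply: near_eq_cvg; near=> n.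
  by rewrite /series/= big_mkord Im_sum.
split => // N; rewrite cabsC.
(* The remainder after N terms is the limit of finite blocks starting at N, each bounded by a
   geometric sum. *)
apply: (ccvg_le (u := fun n => - \sum_(N <= k < N + n) a k)).
  apply: (ccvg_ext (u := fun n => \sum_(k < N) a k - \sum_(k < N + n) a k)).
    move=> n; rewrite -(big_mkord xpredT a) -(big_mkord xpredT a).
    by rewrite (@big_cat_nat _ _ _ N 0 (N + n))//= ?leq_addr// opprD addrA subrr sub0r.
  apply: ccvgB; first exact: ccvg_cst.
  move=> e /H[N' HN']; exists N' => n Hn; apply: HN'; exact: leq_trans Hn (leq_addl _ _).
move=> n; rewrite cabsN; apply: le_trans (cabs_sum _ _ _) _.
apply: (@le_trans _ _ (\sum_(k < n) M * q ^+ N * q ^+ k)).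
  rewrite -{1}(add0n N) big_addn (addnC N n) addnK big_mkord.
  apply: ler_sum => k _; apply: le_trans (Ha _) _.
  by rewrite addnC exprD mulrA.
rewrite -mulr_sumr [leRHS]mulrAC ler_wpM2l ?mulr_ge0 ?exprn_ge0//.
exact: sum_geo_le.
Unshelve. all: by end_near. Qed.

End ComplexSequences.

(** * Power series on the unit disc *)

Section PowerSeries.
Context {R : realType}.
Implicit Types (a b : nat -> R[i]) (z p h : R[i]) (r e : R).

(** Radius of convergence at least 1, in Abel's form: boundedness on each smaller radius is what
    Cauchy estimates and Bessel's inequality deliver. *)
Definition rad1 a := forall r, 0 <= r < 1 ->
  exists M, forall n, cabs (a n) * r ^+ n <= M.

Definition psum a z := csum (fun n => a n * z ^+ n).

(** The bound at the midpoint s of r and 1 leaves the ratio r / s < 1 at r. *)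
Lemma rad1_geo a r : rad1 a -> 0 <= r < 1 ->
  exists M q, [/\ 0 <= q < 1, 0 <= M & forall n, cabs (a n) * r ^+ n <= M * q ^+ n].
Proof.
move=> Ha /andP[r0 r1]; pose s := (1 + r) / 2.
have s0 : 0 < s by rewrite /s; lra.
have s1 : 0 <= s < 1 by rewrite /s; apply/andP; split; lra.
have [M HM] := Ha _ s1.
exists M, (r / s); split.
- by rewrite divr_ge0 ?(ltW s0)//= ltr_pdivrMr// mul1r /s; lra.
- by have := HM 0%N; rewrite expr0 mulr1; apply: le_trans; exact: cabs_ge0.
move=> n; rewrite [r in leLHS](_ : r = s * (r / s)); last by rewrite mulrC divfK// gt_eqF.
by rewrite exprMn mulrA ler_wpM2r// exprn_ge0// divr_ge0// ltW.
Qed.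

Lemma psum_cvg a z : rad1 a -> cabs z < 1 ->
  ccvg (fun N => \sum_(n < N) a n * z ^+ n) (psum a z).
Proof.
move=> Ha z1; have [|M [q [q01 M0 H]]] := rad1_geo Ha (r := cabs z).
  by rewrite cabs_ge0.
by have [] := csum_geo (a := fun n => a n * z ^+ n) q01 (M := M) _ => // n; rewrite cabsM cabsX.
Qed.

Lemma psum_unif a r e : rad1 a -> 0 <= r < 1 -> 0 < e ->
  exists N, forall n, (N <= n)%N -> forall z, cabs z <= r ->
    cabs (psum a z - \sum_(k < n) a k * z ^+ k) < e.
Proof.
move=> Ha r01 e0; have [M [q [q01 M0 H]]] := rad1_geo Ha r01.
have /andP[q0 q1] := q01.
have c0 : 0 < M / (1 - q) + 1 by rewrite ltr_wpDl// divr_ge0// subr_ge0 ltW.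
have [N HN] := expr_small q01 (divr_gt0 e0 c0).
exists N => n /HN; rewrite ltr_pdivlMr// => hn z zr.
have [|_ /(_ n) h] := csum_geo (a := fun n => a n * z ^+ n) q01 (M := M).
  move=> k; rewrite cabsM cabsX; apply: le_trans (H k).
  by rewrite ler_wpM2l ?cabs_ge0// lerXn2r// ?nnegrE ?cabs_ge0//; case/andP: r01.
apply: le_lt_trans h _; apply: le_lt_trans hn.
by rewrite mulrC ler_wpM2l ?exprn_ge0// lerDl.
Qed.

(** Each of the n terms of the geometric sum is at least q^n. *)
Lemma nat_geo_le (q : R) n : 0 <= q < 1 -> n%:R * q ^+ n <= (1 - q)^-1.
Proof.
move=> q01; apply: le_trans (sum_geo_le n q01); have /andP[q0 q1] := q01.
rewrite -[n in n%:R]card_ord mulr_natl -sumr_const; apply: ler_sum => k _.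
by apply: ler_wiXn2l => //; [exact: ltW|exact: ltnW (ltn_ord k)].
Qed.

Lemma rad1_le a b : (forall n, cabs (b n) <= cabs (a n)) -> rad1 a -> rad1 b.
Proof.
move=> H Ha r r01; have [M HM] := Ha r r01; exists M => n.
apply: le_trans (HM n); rewrite ler_wpM2r// exprn_ge0//; by case/andP: r01.
Qed.

Lemma rad1_nat a : rad1 a -> rad1 (fun n => n%:R * a n).
Proof.
move=> Ha r r01; have [M [q [q01 M0 H]]] := rad1_geo Ha r01.
exists (M / (1 - q)) => n.
have -> : cabs (n%:R * a n) = n%:R * cabs (a n).
  rewrite cabsM; congr (_ * _); rewrite -[n%:R in LHS](rmorph_nat (real_complex R)).
  by rewrite cabsR ger0_norm.
rewrite -mulrA; apply: (@le_trans _ _ (n%:R * (M * q ^+ n))).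
  by rewrite ler_wpM2l.
by rewrite mulrCA ler_wpM2l// nat_geo_le.
Qed.

Definition dcoef a n := n.+1%:R * a n.+1.

Lemma rad1_shift a : rad1 a -> rad1 (fun n => a n.+1).
Proof.
move=> Ha r /andP[r0 r1].
have h : 0 <= (1 + r) / 2 < 1 by apply/andP; split; lra.
have [M HM] := Ha _ h; set s := (1 + r) / 2 in h HM.
have s0 : 0 < s by rewrite /s; lra.
exists (M / s) => n; rewrite ler_pdivlMr//; apply: le_trans (HM n.+1).
rewrite exprSr mulrA ler_wpM2r ?(ltW s0)// ler_wpM2l ?cabs_ge0//.
rewrite lerXn2r ?nnegrE// ?(ltW s0)// /s; lra.
Qed.

Lemma rad1_dcoef a : rad1 a -> rad1 (dcoef a).
Proof. by move=> /rad1_nat/rad1_shift. Qed.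

Lemma cabs_nat n : cabs (n%:R : R[i]) = n%:R.
Proof. by rewrite -(rmorph_nat (real_complex R)) cabsR ger0_norm. Qed.

(** The natural bound has r^(n-2); the factor r^2 on the left avoids the truncated exponent. If E_n
    is the remainder, then E_(n+1) = (z + h) E_n + n z^(n-1) h^2, whence the induction. *)
Lemma expr_taylor1 z h (r : R) n : cabs z <= r -> cabs (z + h) <= r ->
  r ^+ 2 * cabs ((z + h) ^+ n - z ^+ n - n%:R * z ^+ n.-1 * h)
    <= n%:R ^+ 2 * r ^+ n * cabs h ^+ 2.
Proof.
move=> zr zhr; have r0 : 0 <= r by apply: le_trans zr; exact: cabs_ge0.
elim: n => [|n IH].
  by rewrite !expr0 subrr mul0r mul0r subr0 cabs0 mulr0 expr0n mul0r mul0r.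
set E := _ - _ - _ in IH.
have -> : (z + h) ^+ n.+1 - z ^+ n.+1 - n.+1%:R * z ^+ n.+1.-1 * h =
    (z + h) * E + n%:R * z ^+ n.-1 * h ^+ 2.
  rewrite /E !exprS; case: n {IH E} => [|n] /=; first by rewrite !expr0; ring.
  by rewrite !exprS; ring.
apply: (@le_trans _ _ (r ^+ 2 * (r * cabs E + n%:R * r ^+ n.-1 * cabs h ^+ 2))).
  rewrite ler_wpM2l ?sqr_ge0//; apply: le_trans (cabsD _ _) _; apply: lerD.
    by rewrite cabsM ler_wpM2r ?cabs_ge0.
  rewrite !cabsM !cabsX cabs_nat ler_wpM2r ?sqr_ge0// ler_wpM2l//.
  by rewrite lerXn2r ?nnegrE ?cabs_ge0.
have -> : r ^+ 2 * (r * cabs E + n%:R * r ^+ n.-1 * cabs h ^+ 2) =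
  r * (r ^+ 2 * cabs E) + n%:R * (r ^+ n.+1) * cabs h ^+ 2.
  case: (n) => [|m]; first by rewrite !mul0r !addr0 mulrCA.
  by rewrite [r ^+ m.+2]exprS [r ^+ m.+1]exprS /=; ring.
apply: (@le_trans _ _ (r * (n%:R ^+ 2 * r ^+ n * cabs h ^+ 2) + n%:R * (r ^+ n.+1) * cabs h ^+ 2)).
  by rewrite lerD2r ler_wpM2l.
have -> : r * (n%:R ^+ 2 * r ^+ n * cabs h ^+ 2) + n%:R * (r ^+ n.+1) * cabs h ^+ 2
  = (n%:R ^+ 2 + n%:R) * (r ^+ n.+1 * cabs h ^+ 2) by rewrite [r ^+ n.+1]exprS; ring.
rewrite -[leRHS]mulrA ler_wpM2r ?mulr_ge0 ?exprn_ge0 ?cabs_ge0//.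
rewrite -natr1; have : 0 <= n%:R :> R by []; nra.
Qed.

Lemma ccvg_shift (u : nat -> R[i]) (l : R[i]) : ccvg u l -> ccvg (fun n => u n.+1) l.
Proof. by move=> H e /H[N HN]; exists N => n Nn; apply: HN; exact: leqW. Qed.

(** The remainders of the monomials are summed; this converges because n^2 a_n inherits [rad1] from
    a_n. *)
Lemma psum_taylor1 a r : rad1 a -> 0 < r < 1 -> exists2 C : R, 0 <= C &
  forall z h, cabs z <= r -> cabs (z + h) <= r ->
  cabs (psum a (z + h) - psum a z - psum (dcoef a) z * h) <= C * cabs h ^+ 2.
Proof.
move=> Ha /andP[r0 r1].
have r01 : 0 <= r < 1 by rewrite ltW.
have [M [q [q01 M0 H]]] := rad1_geo (rad1_nat (rad1_nat Ha)) r01.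
have /andP[q0 q1] := q01.
have C0 : 0 <= M / (1 - q) / r ^+ 2.
  by rewrite !divr_ge0// ?subr_ge0 ?sqr_ge0// ltW.
exists (M / (1 - q) / r ^+ 2) => // z h zr zhr.
have z1 : cabs z < 1 by exact: le_lt_trans r1.
have zh1 : cabs (z + h) < 1 by exact: le_lt_trans r1.
have h2 := ccvgB (ccvgB (psum_cvg Ha zh1) (psum_cvg Ha z1)) (ccvgZ h (psum_cvg (rad1_dcoef Ha) z1)).
(* The shift aligns the indices: the n-th term of the derived series comes from the term of degree n
   + 1, and the constant terms cancel. *)
have h1 := ccvgB (ccvgB (ccvg_shift (psum_cvg Ha zh1)) (ccvg_shift (psum_cvg Ha z1)))
  (ccvgZ h (psum_cvg (rad1_dcoef Ha) z1)).
rewrite [psum (dcoef a) z * h]mulrC; apply: (ccvg_le h1) => N.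
rewrite mulr_sumr !big_ord_recl !expr0 opprD addrACA subrr add0r.
rewrite -sumrB -sumrB; apply: le_trans (cabs_sum _ _ _) _.
rewrite [leRHS]mulrAC ler_pdivlMr ?exprn_gt0// mulrC mulr_sumr.
apply: (@le_trans _ _ (\sum_(n < N) (M * cabs h ^+ 2 * q ^+ n.+1))).
  apply: ler_sum => n _.
  have -> : a (lift ord0 n) * (z + h) ^+ lift ord0 n - a (lift ord0 n) * z ^+ lift ord0 n
    - h * (dcoef a n * z ^+ n) =
    a n.+1 * ((z + h) ^+ n.+1 - z ^+ n.+1 - n.+1%:R * z ^+ n.+1.-1 * h).
    by rewrite /dcoef /=; ring.
  rewrite cabsM mulrCA; apply: (@le_trans _ _ (cabs (a n.+1) * (n.+1%:R ^+ 2 * r ^+ n.+1 * cabs h ^+ 2))).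
    by rewrite ler_wpM2l ?cabs_ge0//; exact: expr_taylor1.
  have := H n.+1; rewrite !cabsM !cabs_nat => HH.
  have -> : cabs (a n.+1) * (n.+1%:R ^+ 2 * r ^+ n.+1 * cabs h ^+ 2) =
    cabs h ^+ 2 * (n.+1%:R * (n.+1%:R * cabs (a n.+1)) * r ^+ n.+1) by ring.
  by rewrite [M * _]mulrC -[leRHS]mulrA ler_wpM2l ?sqr_ge0.
rewrite -mulr_sumr [leRHS]mulrAC -mulrA -[leRHS]mulrA ler_wpM2l//.
rewrite ler_wpM2l ?sqr_ge0//; apply: le_trans (sum_geo_le N q01).
apply: ler_sum => n _; rewrite exprS -[leRHS]mul1r ler_wpM2r ?exprn_ge0// ltW//.
Qed.
End PowerSeries.

(** * Derivatives and primitives of complex functions of a real variable *)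

Section ComplexValuedCalculus.
Context {R : realType}.
Implicit Types (G H u : R -> R[i]) (x t a b e : R) (k z : R[i]).

Definition cder G x k :=
  is_derive x 1 (fun t => complex.Re (G t)) (complex.Re k) /\
  is_derive x 1 (fun t => complex.Im (G t)) (complex.Im k).

Lemma cderD G H x k l : cder G x k -> cder H x l -> cder (fun t => G t + H t) x (k + l).
Proof.
move=> [G1 G2] [H1 H2]; split; rewrite !ReImE.
  rewrite (_ : (fun t => _) = (fun t => complex.Re (G t)) + (fun t => complex.Re (H t))).
    exact: is_deriveD.
  by apply/funext => t; rewrite ReD.
rewrite (_ : (fun t => _) = (fun t => complex.Im (G t)) + (fun t => complex.Im (H t))).
  exact: is_deriveD.
by apply/funext => t; rewrite ImD.
Qed.

Lemma cderZ G x k l : cder G x k -> cder (fun t => l * G t) x (l * k).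
Proof.
move=> [G1 G2]; split; rewrite !ReImE.
  rewrite (_ : (fun t => _) = complex.Re l \*: (fun t => complex.Re (G t)) -
    complex.Im l \*: (fun t => complex.Im (G t))).
    by apply: is_deriveB; apply: is_deriveZ.
  by apply/funext => t; rewrite ReM.
rewrite (_ : (fun t => _) = complex.Re l \*: (fun t => complex.Im (G t)) +
    complex.Im l \*: (fun t => complex.Re (G t))).
  by apply: is_deriveD; apply: is_deriveZ.
by apply/funext => t; rewrite ImM.
Qed.

Lemma cderB G H x k l : cder G x k -> cder H x l -> cder (fun t => G t - H t) x (k - l).
Proof.
move=> HG HH; rewrite -(mulN1r l).
rewrite (_ : (fun t => _) = (fun t => G t + (-1) * H t)).
  by apply: cderD => //; exact: cderZ.
by apply/funext => t; rewrite mulN1r.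
Qed.

Lemma cder_cst x k : cder (fun=> k) x 0.
Proof. by split; apply: is_derive_cst. Qed.

Lemma cder_id x : cder (fun t => (t%:C)%C) x 1.
Proof. by split => /=; [apply: is_derive_id|apply: is_derive_cst]. Qed.

Lemma cder_real (f : R -> R) x (d : R) : is_derive x 1 f d ->
  cder (fun t => ((f t)%:C)%C) x (d%:C)%C.
Proof. by move=> H; split => //=; apply: is_derive_cst. Qed.

(** The mean value theorem applies to the real and the imaginary part at two different points;
    adding the two bounds costs the factor 2. *)
Lemma cder_bound G u a b (B : R) : a <= b ->
  (forall x, a <= x <= b -> cder G x (u x) /\ cabs (u x) <= B) ->
  cabs (G b - G a) <= 2 * B * (b - a).
Proof.
move=> ab H.
have main (g : R[i] -> R) : (forall w, `|g w| <= cabs w) ->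
    (forall x, a <= x <= b -> is_derive x 1 (fun t => g (G t)) (g (u x))) ->
    `|g (G b) - g (G a)| <= B * (b - a).
  move=> gle gd.
  have [||c cab ->] := @MVT_segment _ (fun t => g (G t)) (fun x => g (u x)) a b ab.
  - by move=> x; rewrite in_itv/= => /andP[ax xb]; apply: gd; rewrite !ltW.
  - apply: derivable_within_continuous => x; rewrite in_itv/= => axb.
    by have [] := gd _ axb.
  - rewrite normrM [`|b - a|]ger0_norm ?subr_ge0// ler_wpM2r ?subr_ge0//.
    apply: le_trans (gle _) _; rewrite in_itv/= in cab.
    by have [] := H _ cab.
apply: le_trans (cabs_le _) _; rewrite !ReImE.
have r1 := main (@complex.Re R) (@abs_Re_le R) (fun x hx => (H x hx).1.1).
have r2 := main (@complex.Im R) (@abs_Im_le R) (fun x hx => (H x hx).1.2).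
by move: r1 r2 => /=; lra.
Qed.

(** Increments of primitives play the role of integrals below; this makes them independent of the
    primitive. *)
Lemma cder_eq G H u a b : a <= b ->
  (forall x, a <= x <= b -> cder G x (u x) /\ cder H x (u x)) ->
  G b - G a = H b - H a.
Proof.
move=> ab h; apply/eqP; rewrite -subr_eq0; apply/eqP; apply: cabs_eps0 => e e0.
have -> : G b - G a - (H b - H a) = (G b - H b) - (G a - H a) by ring.
have := @cder_bound (fun t => G t - H t) (fun=> 0) a b 0 ab.
rewrite mulr0 mul0r => /(_ _)/le_trans -> //; last exact: ltW.
move=> x /h[h1 h2]; split; last by rewrite cabs0.
by rewrite -(subrr (u x)); exact: cderB.
Qed.

Definition ccont u := forall x e, 0 < e -> exists2 d, 0 < d &
  forall y, `|y - x| < d -> cabs (u y - u x) < e.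

Lemma ccont_Re u : ccont u -> continuous (fun t => complex.Re (u t)).
Proof.
move=> h x; apply/cvgrPdist_lt => e e0; have [d d0 hd] := h x e e0.
near=> y; rewrite distrC; apply: le_lt_trans (hd y _).
  by rewrite -ReN -ReD; exact: abs_Re_le.
rewrite distrC; near: y; exact: (nbhsx_ballx x d d0).
Unshelve. all: by end_near. Qed.

Lemma ccont_Im u : ccont u -> continuous (fun t => complex.Im (u t)).
Proof.
move=> h x; apply/cvgrPdist_lt => e e0; have [d d0 hd] := h x e e0.
near=> y; rewrite distrC; apply: le_lt_trans (hd y _).
  by rewrite -ImN -ImD; exact: abs_Im_le.
rewrite distrC; near: y; exact: (nbhsx_ballx x d d0).
Unshelve. all: by end_near. Qed.

(** The base point a itself is excluded, since a derivative needs room on both sides; later uses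
    start at -1 to cover the parameters from 0 to 1. *)
Lemma primitive_ex (f : R -> R) a : continuous f ->
  exists F : R -> R, forall x, a < x -> is_derive x 1 F (f x).
Proof.
move=> cf; exists (fun x => \int[lebesgue_measure]_(t in `[a, x]) f t) => x ax.
have xx : x < x + 1 by rewrite ltrDl.
have [] // := @continuous_FTC1 R f (BLeft a) x (x + 1) xx.
- apply: continuous_compact_integrable; first exact: segment_compact.
  by apply: continuous_subspaceT.
- exact: cf.
- by move=> d1 d2; apply: DeriveDef => //; rewrite -derive1E.
Qed.

Lemma cprimitive_ex u a : ccont u ->
  exists F : R -> R[i], forall x, a < x -> cder F x (u x).
Proof.
move=> cu; have [F1 H1] := primitive_ex a (ccont_Re cu).
have [F2 H2] := primitive_ex a (ccont_Im cu).
by exists (fun x => Complex (F1 x) (F2 x)) => x ax; split => /=; auto.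
Qed.

Lemma ccont_bound u a b : a <= b -> ccont u ->
  exists2 M : R, 0 <= M & forall x, a <= x <= b -> cabs (u x) <= M.
Proof.
move=> ab cu.
have main (f : R -> R) : continuous f -> exists M, forall x, a <= x <= b -> `|f x| <= M.
  move=> cf; have [|c _ hc] := @EVT_max _ (fun x => `|f x|) a b ab.
    apply: continuous_subspaceT => x; apply: continuous_comp; first exact: cf.
    exact: norm_continuous.
  by exists `|f c| => x hx; apply: hc; rewrite in_itv.
have [M1 h1] := main _ (ccont_Re cu); have [M2 h2] := main _ (ccont_Im cu).
exists (`|M1| + `|M2|); first by rewrite addr_ge0.
move=> x hx; apply: le_trans (cabs_le _) _; apply: lerD.
  exact: le_trans (h1 _ hx) (ler_norm _).
exact: le_trans (h2 _ hx) (ler_norm _).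
Qed.

End ComplexValuedCalculus.

(** * Goursat's bisection for additive functions of rectangles *)

Section Bisection.
Context {R : realType}.
Variable mu : R -> R -> R -> R -> R.
Hypothesis addx : forall x1 x2 x3 t1 t2, mu x1 x3 t1 t2 = mu x1 x2 t1 t2 + mu x2 x3 t1 t2.
Hypothesis addt : forall x1 x2 t1 t2 t3, mu x1 x2 t1 t3 = mu x1 x2 t1 t2 + mu x1 x2 t2 t3.
Variables (x0 t0 A B : R).
Hypotheses (A0 : 0 < A) (B0 : 0 < B).
Let muS x t h := mu x (x + A * h) t (t + B * h).
Hypothesis loc : forall p q e, x0 <= p <= x0 + A -> t0 <= q <= t0 + B -> 0 < e ->
  exists2 d, 0 < d & forall x t h, 0 < h < d ->
    x0 <= x -> x + A * h <= x0 + A -> t0 <= t -> t + B * h <= t0 + B ->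
    x <= p <= x + A * h -> t <= q <= t + B * h -> `|muS x t h| <= e * h ^+ 2.

(** Selects a quarter that carries at least a quarter of the absolute value. The last one is the
    default: if the other three fail, additivity forces it to succeed. *)
Let half_step h (p : R * R) : R * R :=
  if `|muS p.1 p.2 (2 * h)| <= 4 * `|muS p.1 p.2 h| then p else
  if `|muS p.1 p.2 (2 * h)| <= 4 * `|muS (p.1 + A * h) p.2 h| then (p.1 + A * h, p.2) else
  if `|muS p.1 p.2 (2 * h)| <= 4 * `|muS p.1 (p.2 + B * h) h| then (p.1, p.2 + B * h) else
  (p.1 + A * h, p.2 + B * h).

Let half_stepP h p : `|muS p.1 p.2 (2 * h)| <=
  4 * `|muS (half_step h p).1 (half_step h p).2 h|.
Proof.
rewrite /half_step; case: ifP => // /negbT h1; case: ifP => // /negbT h2.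
case: ifP => //= /negbT h3; rewrite -!ltNge in h1 h2 h3.
have E : muS p.1 p.2 (2 * h) = muS p.1 p.2 h + muS (p.1 + A * h) p.2 h +
    (muS p.1 (p.2 + B * h) h + muS (p.1 + A * h) (p.2 + B * h) h).
  rewrite /muS (_ : p.1 + A * (2 * h) = p.1 + A * h + A * h); last by ring.
  rewrite (_ : p.2 + B * (2 * h) = p.2 + B * h + B * h); last by ring.
  by rewrite (addt _ _ _ (p.2 + B * h)) (addx p.1 (p.1 + A * h)) (addx p.1 (p.1 + A * h) _ (p.2 + B * h)).
have : `|muS p.1 p.2 (2 * h)| <= `|muS p.1 p.2 h| + `|muS (p.1 + A * h) p.2 h| +
    (`|muS p.1 (p.2 + B * h) h| + `|muS (p.1 + A * h) (p.2 + B * h) h|).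
  by rewrite E; apply: le_trans (ler_normD _ _) _; apply: lerD; apply: ler_normD.
lra.
Qed.

Let half_step_in h p : 0 <= h ->
  (p.1 <= (half_step h p).1 <= p.1 + A * h) /\ (p.2 <= (half_step h p).2 <= p.2 + B * h).
Proof.
move=> h0; have ah : 0 <= A * h by rewrite mulr_ge0// ltW.
have bh : 0 <= B * h by rewrite mulr_ge0// ltW.
by rewrite /half_step; repeat (case: ifP => _ /=); split; apply/andP; split; lra.
Qed.

Let hs n : R := 2^-1 ^+ n.

Fixpoint bisect_seq n : R * R :=
  if n is m.+1 then half_step (hs n) (bisect_seq m) else (x0, t0).

Let hsS n : hs n = 2 * hs n.+1.
Proof. by rewrite /hs exprS mulrA divff ?mul1r// pnatr_eq0. Qed.

Let hs_gt0 n : 0 < hs n.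
Proof. by rewrite exprn_gt0// invr_gt0. Qed.

Let bisect_le n : `|muS x0 t0 1| <= 4 ^+ n * `|muS (bisect_seq n).1 (bisect_seq n).2 (hs n)|.
Proof.
elim: n => [|n IH]; first by rewrite /hs !expr0 mul1r.
apply: le_trans IH _; rewrite exprSr -mulrA ler_wpM2l ?exprn_ge0//.
by rewrite [hs n]hsS; exact: half_stepP.
Qed.

Let bisect_nest n m : (n <= m)%N ->
  ((bisect_seq n).1 <= (bisect_seq m).1 <= (bisect_seq n).1 + A * (hs n - hs m)) /\
  ((bisect_seq n).2 <= (bisect_seq m).2 <= (bisect_seq n).2 + B * (hs n - hs m)).
Proof.
move=> /subnK <-; elim: (m - n)%N => [|k [/andP[a1 a2] /andP[b1 b2]]].
  by rewrite add0n subrr !mulr0 !addr0 !lexx.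
rewrite addSn /=.
have [/andP[c1 c2] /andP[d1 d2]] := half_step_in (bisect_seq (k + n)%N) (ltW (hs_gt0 (k + n).+1)).
have E := hsS (k + n)%N.
split; apply/andP; split.
- exact: le_trans c1.
- by apply: le_trans c2 _; move: a2; rewrite E; lra.
- exact: le_trans d1.
- by apply: le_trans d2 _; move: b2; rewrite E; lra.
Qed.

(** The common point of the nested intervals is the supremum of their left ends. *)
Let nested_limit (s : nat -> R) (C : R) : 0 <= C ->
  (forall n m, (n <= m)%N -> s n <= s m <= s n + C * (hs n - hs m)) ->
  exists p, forall n, s n <= p <= s n + C * hs n.
Proof.
move=> C0 H; have h0 n : 0 <= C * hs n by rewrite mulr_ge0// ltW.
have ub n m : s m <= s n + C * hs n.
  have [nm|/ltnW mn] := leqP n m.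
    by have /andP[_ h] := H _ _ nm; apply: le_trans h _; have := h0 m; lra.
  have /andP[h _] := H _ _ mn; apply: le_trans h _; have := h0 n; lra.
exists (sup (range s)) => n; apply/andP; split.
  apply: ub_le_sup; last by exists n.
  by exists (s 0%N + C * hs 0%N) => _ [m _ <-].
apply: ge_sup; first by exists (s 0%N); exists 0%N.
by move=> _ [m _ <-].
Qed.

(** After N halvings the selected rectangle carries at least 4^-N of the total, whereas [loc] at the
    limit point bounds it by e 4^-N. Hence the total is at most e, for every e. *)
Lemma bisection_zero : mu x0 (x0 + A) t0 (t0 + B) = 0.
Proof.
have [p Hp] := nested_limit (ltW A0) (fun n m nm => (bisect_nest nm).1).
have [q Hq] := nested_limit (ltW B0) (fun n m nm => (bisect_nest nm).2).
have p0 : x0 <= p <= x0 + A by have := Hp 0%N; rewrite /hs expr0 mulr1.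
have q0 : t0 <= q <= t0 + B by have := Hq 0%N; rewrite /hs expr0 mulr1.
have -> : mu x0 (x0 + A) t0 (t0 + B) = muS x0 t0 1 by rewrite /muS !mulr1.
apply/eqP; rewrite -normr_eq0 eq_le normr_ge0 andbT; apply: ler_inf_eps => e e0.
rewrite add0r; have [d d0 Hd] := loc p0 q0 e0.
have h2 : 0 <= (2^-1 : R) < 1 by apply/andP; split; lra.
have [N /(_ N (leqnn _)) HN] := expr_small h2 d0.
apply: le_trans (bisect_le N) _.
have [/andP[a1 a2] /andP[b1 b2]] := bisect_nest (leq0n N).
have hs0 : hs 0 = 1 by rewrite /hs expr0.
apply: (@le_trans _ _ (4 ^+ N * (e * hs N ^+ 2))).
  rewrite ler_wpM2l ?exprn_ge0//; apply: Hd => //.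
  - by rewrite hs_gt0.
  - by move: a2; rewrite hs0 /=; lra.
  - by move: b2; rewrite hs0 /=; lra.
rewrite mulrCA /hs -!exprM mulnC exprM -exprMn.
have -> : 4 * 2^-1 ^+ 2 = 1 :> R by field.
by rewrite expr1n mulr1.
Qed.

End Bisection.

(** * The unit circle and continuity along curves *)

Section UnitCircle.
Context {R : realType}.
Implicit Types (t x : R) (u v : R -> R[i]).

(** The exponential e^(2 pi i t), measured in turns, so that closed curves run over the parameters
    from 0 to 1. *)
Definition ce t : R[i] := Complex (cos (2 * pi * t)) (sin (2 * pi * t)).
Definition I2pi : R[i] := Complex 0 (2 * pi).

Lemma ceD s t : ce (s + t) = ce s * ce t.
Proof.
by apply: complexP; rewrite !ReImE /= mulrDr ?cosD ?sinD; ring.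
Qed.

Lemma ce0 : ce 0 = 1.
Proof. by apply: complexP; rewrite /= mulr0 ?cos0 ?sin0. Qed.

Lemma ce1 : ce 1 = 1.
Proof. by apply: complexP; rewrite /= mulr1 mulr_natl ?cos2pi ?sin2pi. Qed.

Lemma cabs_ce t : cabs (ce t) = 1.
Proof. by rewrite /cabs /= cos2Dsin2 sqrtr1. Qed.

Lemma ce_neq0 t : ce t != 0.
Proof. by rewrite -cabs_gt0 cabs_ce. Qed.

Lemma ceX n t : ce t ^+ n = ce (n%:R * t).
Proof.
elim: n => [|n IH]; first by rewrite expr0 mul0r ce0.
by rewrite exprS IH -natr1 mulrDl mul1r addrC ceD mulrC.
Qed.

Lemma ce_nat n : ce n%:R = 1.
Proof. by rewrite -(mulr1 n%:R) -ceX ce1 expr1n. Qed.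

Lemma ceN t : ce (- t) = (ce t)^-1.
Proof.
by apply: (mulfI (ce_neq0 t)); rewrite -ceD subrr ce0 divff// ce_neq0.
Qed.

Lemma cder_ce (k t : R) : cder (fun s => ce (k * s)) t ((k%:C)%C * I2pi * ce (k * t)).
Proof.
have d : is_derive t 1 (fun s : R => 2 * pi * (k * s)) (2 * pi * k).
  rewrite (_ : (fun s => _) = (2 * pi * k) \*: id); last first.
    by apply/funext => s; rewrite /= /GRing.scale /= mulrA.
  rewrite -[X in is_derive _ _ _ X]mulr1; apply: is_deriveZ.
split; rewrite !ReImE /=.
  have := @is_derive1_comp _ cos _ t _ _ (is_derive_cos _) d.
  by rewrite (_ : - sin _ * _ = (k * 0 - 0 * (2 * pi)) * cos (2 * pi * (k * t)) -
   (k * (2 * pi) + 0 * 0) * sin (2 * pi * (k * t))); last by ring.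
have := @is_derive1_comp _ sin _ t _ _ (is_derive_sin _) d.
by rewrite (_ : cos _ * _ = (k * 0 - 0 * (2 * pi)) * sin (2 * pi * (k * t)) +
   (k * (2 * pi) + 0 * 0) * cos (2 * pi * (k * t))); last by ring.
Qed.

Lemma cder_ce1 t : cder ce t (I2pi * ce t).
Proof.
have := cder_ce 1 t; rewrite mul1r (_ : (1%:C)%C = 1 :> R[i])// mul1r.
by rewrite (_ : (fun s => ce (1 * s)) = ce)//; apply/funext => s; rewrite mul1r.
Qed.

Lemma I2pi_neq0 : I2pi != 0.
Proof.
rewrite -cabs_gt0; apply: (lt_le_trans _ (abs_Im_le _)) => /=.
by rewrite normr_gt0 mulf_neq0// gt_eqF// pi_gt0.
Qed.

Lemma cabs_I2pi : cabs I2pi = 2 * pi.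
Proof.
by rewrite /cabs /= expr0n add0r sqrtr_sqr ger0_norm// mulr_ge0// ltW// pi_gt0.
Qed.

Lemma ccontP u : ccont u <->
  continuous (fun t => complex.Re (u t)) /\ continuous (fun t => complex.Im (u t)).
Proof.
split=> [h|[h1 h2] x e e0]; first by split; [exact: ccont_Re|exact: ccont_Im].
have e2 : 0 < e / 2 by rewrite divr_gt0.
have /cvgrPdist_lt/(_ _ e2) := h1 x; have /cvgrPdist_lt/(_ _ e2) := h2 x.
move=> /nbhs_ballP[d1 /= d10 H1] /nbhs_ballP[d2 /= d20 H2].
exists (Num.min d1 d2); first by rewrite lt_min d10.
move=> y; rewrite lt_min distrC => /andP[/H1 a1 /H2 a2].
rewrite cabsC; apply: le_lt_trans (cabs_le _) _; rewrite !ReImE.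
by move: a1 a2 => /=; lra.
Qed.

Lemma ccontM u v : ccont u -> ccont v -> ccont (fun t => u t * v t).
Proof.
move=> /ccontP[u1 u2] /ccontP[v1 v2]; apply/ccontP; split => x.
  under eq_fun do rewrite ReM.
  by apply: cvgB; apply: cvgM; [exact: u1|exact: v1|exact: u2|exact: v2].
under eq_fun do rewrite ImM.
by apply: cvgD; apply: cvgM; [exact: u1|exact: v2|exact: u2|exact: v1].
Qed.

Lemma ccontD u v : ccont u -> ccont v -> ccont (fun t => u t + v t).
Proof.
move=> /ccontP[u1 u2] /ccontP[v1 v2]; apply/ccontP; split => x.
  under eq_fun do rewrite ReD.
  by apply: cvgD; [exact: u1|exact: v1].
under eq_fun do rewrite ImD.
by apply: cvgD; [exact: u2|exact: v2].
Qed.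

Lemma ccont_cst (k : R[i]) : ccont (fun=> k).
Proof. by move=> x e e0; exists 1 => // y _; rewrite subrr cabs0. Qed.

Lemma cder_ccont u : (forall t, exists k, cder u t k) -> ccont u.
Proof.
move=> h; apply/ccontP; split => t; have [k [h1 h2]] := h t.
  by apply: differentiable_continuous; apply/derivable1_diffP; case: h1.
by apply: differentiable_continuous; apply/derivable1_diffP; case: h2.
Qed.

Definition contat (F : R[i] -> R[i]) (w : R[i]) := forall e, 0 < e ->
  exists2 d, 0 < d & forall h, cabs h < d -> cabs (F (w + h) - F w) < e.

Lemma ccont_comp F u : (forall t, contat F (u t)) -> ccont u -> ccont (fun t => F (u t)).
Proof.
move=> hF hu t e e0; have [d d0 hd] := hF t e e0; have [d' d'0 hd'] := hu t d d0.
exists d' => // y /hd'/hd.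
by rewrite [u t + _]addrC subrK.
Qed.

Lemma contatV w : w != 0 -> contat GRing.inv w.
Proof.
rewrite -cabs_gt0 => w0 e e0.
(* The first bound keeps the modulus of w + h above half that of w; the second then makes the
   difference of the inverses smaller than e. *)
pose d := Num.min (cabs w / 2) (e * cabs w ^+ 2 / 2).
exists d; first by rewrite /d lt_min !divr_gt0// mulr_gt0// exprn_gt0.
move=> h; rewrite lt_min => /andP[h1 h2].
have wh : cabs w / 2 < cabs (w + h).
  have := cabsB (w + h) h; rewrite addrK; lra.
have wh0 : w + h != 0 by rewrite -cabs_gt0; apply: lt_trans wh; rewrite divr_gt0.
have w0' : w != 0 by rewrite -cabs_gt0.
have -> : (w + h)^-1 - w^-1 = - h / ((w + h) * w) by field; apply/andP; split.
rewrite cabsM cabsN cabsV cabsM ltr_pdivrMr; last first.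
  by rewrite mulr_gt0//; apply: lt_trans wh; rewrite divr_gt0.
apply: lt_le_trans h2 _.
rewrite -mulrA ler_pM2l// expr2 mulrAC; apply: ler_wpM2r; exact: ltW.
Qed.

End UnitCircle.

(** * Cauchy's formula on a circle *)

Section Cauchy.
Context {R : realType}.
Implicit Types (F : R[i] -> R[i]) (w l : R[i]).

(** Free of division, so that h = 0 is no exception, contrary to [holomorphic_on]. *)
Definition cdiff F w l := forall e : R, 0 < e -> exists2 d, 0 < d &
  forall h, cabs h < d -> cabs (F (w + h) - F w - l * h) <= e * cabs h.

Lemma cdiff_contat F w l : cdiff F w l -> contat F w.
Proof.
move=> H e e0; have [d d0 hd] := H 1 ltr01.
have c0 : 0 < 1 + cabs l by rewrite ltr_wpDr// cabs_ge0.
exists (Num.min d (e / (1 + cabs l))); first by rewrite lt_min d0 divr_gt0.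
move=> h; rewrite lt_min ltr_pdivlMr// => /andP[/hd h1 h2].
have := cabsD (F (w + h) - F w - l * h) (l * h); rewrite subrK cabsM; nra.
Qed.

Variables (F : R[i] -> R[i]) (z : R[i]) (r : R) (zeta : R -> R[i]).
Hypotheses (zr : cabs z < r) (r1 : r < 1).
Hypothesis cabs_zeta : forall t, cabs (zeta t) = r.
Hypothesis cder_zeta : forall t, cder zeta t (I2pi * zeta t).
Hypothesis zeta01 : zeta 1 = zeta 0.
Hypothesis dF : forall w, cabs w < 1 -> exists l, cdiff F w l.

Let r0 : 0 < r. Proof. by apply: le_lt_trans zr; exact: cabs_ge0. Qed.
(* In the coordinates [g x t = z + e^x (zeta t - z)] of the disc punctured at [z]
   the form F(w) dw / (w - z) is F(g x t) (dx + c t dt).  It is closed: its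
   integral over the boundary of a small rectangle is o(area) since [F] is affine
   up to o(1), so that bisection applies. *)
Let g x t : R[i] := z + ((expR x)%:C)%C * (zeta t - z).
Definition ckern (t : R) : R[i] := I2pi * zeta t / (zeta t - z).
Let c := ckern.

Let zetaz_ge t : r - cabs z <= cabs (zeta t - z).
Proof. by have := cabsD (zeta t - z) z; rewrite subrK cabs_zeta; lra. Qed.

Let zetaz_neq0 t : zeta t - z != 0.
Proof. by rewrite -cabs_gt0; apply: lt_le_trans (zetaz_ge t); rewrite subr_gt0. Qed.

Let zetaz_le t : cabs (zeta t - z) <= 2.
Proof. by apply: le_trans (cabsB _ _) _; rewrite cabs_zeta; move: zr r1; lra. Qed.

Let expR01 (x : R) : x <= 0 -> 0 <= expR x <= 1.
Proof. by move=> x0; rewrite expR_ge0 -expR0 ler_expR. Qed.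

Let g_lt1 x t : x <= 0 -> cabs (g x t) < 1.
Proof.
move=> /expR01/andP[s0 s1].
have -> : g x t = ((1 - expR x)%:C)%C * z + ((expR x)%:C)%C * zeta t.
  by rewrite /g (_ : ((1 - expR x)%:C)%C = 1 - ((expR x)%:C)%C) ?rmorphB//; ring.
apply: le_lt_trans (cabsD _ _) _; rewrite !cabsM !cabsR cabs_zeta.
rewrite !ger0_norm ?subr_ge0//; move: zr r1; nra.
Qed.

Let cder_exp (x : R) : cder (fun x => ((expR x)%:C)%C) x ((expR x)%:C)%C.
Proof. exact: cder_real. Qed.

Let zeta_lip s t : cabs (zeta s - zeta t) <= 4 * pi * `|s - t|.
Proof.
wlog st : s t / s <= t.
  move=> H; have [st|/ltW ts] := leP s t; first exact: H.
  by rewrite cabsC distrC; exact: H.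
rewrite cabsC ler0_norm ?subr_le0//.
apply: le_trans (@cder_bound _ zeta (fun t => I2pi * zeta t) s t (2 * pi) st _) _.
  move=> x _; split; first exact: cder_zeta.
  rewrite cabsM cabs_I2pi cabs_zeta; have := pi_gt0 R; move: r1; nra.
rewrite opprB; lra.
Qed.

Let exp_lip (x y : R) : x <= 0 -> y <= 0 -> `|expR x - expR y| <= 2 * `|x - y|.
Proof.
wlog xy : x y / x <= y.
  move=> H; have [xy|/ltW yx] := leP x y; first exact: H.
  by move=> ? ?; rewrite distrC [`|x - y|]distrC; exact: H.
move=> x0 y0; rewrite distrC [`|x - y|]distrC [`|y - x|]ger0_norm ?subr_ge0//.
have := @cder_bound _ (fun x => ((expR x)%:C)%C) (fun x => ((expR x)%:C)%C) x y 1 xy.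
rewrite -rmorphB cabsR mulr1; apply => w /andP[_ wy]; split; first exact: cder_exp.
by have /andP[e0 e1] := expR01 (le_trans wy y0); rewrite cabsR ger0_norm.
Qed.

Let g_lip x y s t : x <= 0 -> y <= 0 ->
  cabs (g x s - g y t) <= 4 * `|x - y| + 4 * pi * `|s - t|.
Proof.
move=> x0 y0.
have -> : g x s - g y t = ((expR x - expR y)%:C)%C * (zeta s - z)
    + ((expR y)%:C)%C * (zeta s - zeta t).
  by rewrite /g rmorphB; ring.
apply: le_trans (cabsD _ _) _; rewrite !cabsM !cabsR.
have /andP[e0 e1] := expR01 y0; rewrite [`|expR y|]ger0_norm//.
apply: lerD.
  have := exp_lip x0 y0; have := zetaz_le s; have := normr_ge0 (expR x - expR y).
  have := cabs_ge0 (zeta s - z); nra.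
have := zeta_lip s t; have := cabs_ge0 (zeta s - zeta t); nra.
Qed.

Let ccont_zeta : ccont zeta.
Proof. by apply: cder_ccont => t; exists (I2pi * zeta t); exact: cder_zeta. Qed.

Let ccont_zetaz : ccont (fun t => zeta t - z).
Proof. by apply: ccontD => //; exact: ccont_cst. Qed.

Let ccont_c : ccont c.
Proof.
apply: ccontM; first by apply: ccontM => //; exact: ccont_cst.
by apply: (ccont_comp (F := GRing.inv)) => // t; exact: contatV.
Qed.

Let contF w : cabs w < 1 -> contat F w.
Proof. by move=> /dF[l /cdiff_contat]. Qed.

Let ccont_gt x : x <= 0 -> ccont (fun t => F (g x t)).
Proof.
move=> x0; apply: ccont_comp => [t|]; first by apply: contF; exact: g_lt1.
by apply: ccontD; [exact: ccont_cst|apply: ccontM => //; exact: ccont_cst].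
Qed.

(** For x > 0 the point g x t may leave the disc where F is controlled. Truncating x at 0 gives a
    function continuous on the whole line, as [cprimitive_ex] demands. *)
Let ccont_gx t : ccont (fun x => F (g (Num.min x 0) t)).
Proof.
apply: ccont_comp => [x|]; first by apply: contF; apply: g_lt1; rewrite ge_min lexx orbT.
move=> x e e0; exists (e / 4); first by rewrite divr_gt0.
move=> y xy; apply: le_lt_trans (g_lip _ _ _ _) _; rewrite ?ge_min ?lexx ?orbT//.
rewrite subrr normr0 mulr0 addr0.
have : `|Num.min y 0 - Num.min x 0| <= `|y - x|.
  have h1 := ler_norm (y - x); have h2 := ler_norm (x - y); rewrite distrC in h2.
  by rewrite !minEle; case: (leP y 0) => ?; case: (leP x 0) => ?;
    rewrite ler_norml; apply/andP; split; lra.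
lra.
Qed.

Let cm := 2 * pi / (r - cabs z).

Let c_le t : cabs (c t) <= cm.
Proof.
rewrite /c /ckern !cabsM cabsV cabs_I2pi cabs_zeta.
have h0 : 0 < r - cabs z by rewrite subr_gt0.
apply: ler_pM; rewrite ?invr_ge0 ?cabs_ge0//.
- by rewrite !mulr_ge0// ?pi_ge0// ltW.
- by have := pi_gt0 R; move: r1; nra.
- by rewrite lef_pV2 ?posrE//; exact: lt_le_trans (zetaz_ge t).
Qed.

Let gzc x t : (g x t - z) * c t = ((expR x)%:C)%C * (I2pi * zeta t).
Proof. by rewrite /g /c /ckern; field; exact: zetaz_neq0. Qed.

(** G is a primitive of E + e and H one of E, so the difference of their increments only sees the
    error e. *)
Let loc_err (x1 x2 : R) (G E e : R -> R[i]) (M : R) : x1 <= x2 ->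
  (forall x, x1 <= x <= x2 -> cder G x (E x + e x) /\ cabs (e x) <= M) ->
  forall H, (forall x, x1 <= x <= x2 -> cder H x (E x)) ->
  cabs ((G x2 - G x1) - (H x2 - H x1)) <= 2 * M * (x2 - x1).
Proof.
move=> x12 hG H hH.
have -> : (G x2 - G x1) - (H x2 - H x1) = (G x2 - H x2) - (G x1 - H x1) by ring.
apply: (@cder_bound _ (fun x => G x - H x) e) => // x hx; have [h1 h2] := hG _ hx.
by split => //; rewrite -(addrC (e x)) in h1; rewrite -(addrK (E x) (e x)); apply: cderB => //; exact: hH.
Qed.

(** The integral of the closed form over the boundary of the rectangle between X and 0, for t
    between 0 and 1, is zero. Its sides t = 0 and t = 1 cancel because the curve is closed, which
    leaves the two circles. *)
Lemma annulus_const (X : R) V0 VX : X < 0 ->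
  (forall t, -1 < t -> cder V0 t (F (zeta t) * c t)) ->
  (forall t, -1 < t -> cder VX t (F (g X t) * c t)) ->
  V0 1 - V0 0 = VX 1 - VX 0.
Proof.
move=> X0 hV0 hVX.
have g0 t : g 0 t = zeta t by rewrite /g expR0 mul1r addrC subrK.
have [U hU] : exists U : R -> R -> R[i], forall t x, X - 1 < x ->
    cder (U t) x (F (g (Num.min x 0) t)).
  exists (fun t => projT1 (cid (cprimitive_ex (X - 1) (ccont_gx t)))) => t.
  exact: (projT2 (cid (cprimitive_ex (X - 1) (ccont_gx t)))).
have min0 x : Num.min x 0 <= 0 :> R by rewrite ge_min lexx orbT.
have [V hV] : exists V : R -> R -> R[i], forall x t, -1 < t ->
    cder (V x) t (F (g (Num.min x 0) t) * c t).
  have cc x : ccont (fun t => F (g (Num.min x 0) t) * c t).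
    by apply: ccontM => //; exact: ccont_gt.
  exists (fun x => projT1 (cid (cprimitive_ex (-1) (cc x)))) => x.
  exact: (projT2 (cid (cprimitive_ex (-1) (cc x)))).
have [Cc hCc] := cprimitive_ex (-1) ccont_c.
have m1 : -1 < 0 :> R by rewrite ltrN10.
have -> : V0 1 - V0 0 = V 0 1 - V 0 0.
  apply: (@cder_eq _ V0 (V 0) (fun t => F (zeta t) * c t)) => // t /andP[t0 t1]; split.
    by apply: hV0; exact: lt_le_trans t0.
  have := hV 0 t; rewrite minxx g0; apply; exact: lt_le_trans t0.
have -> : VX 1 - VX 0 = V X 1 - V X 0.
  apply: (@cder_eq _ VX (V X) (fun t => F (g X t) * c t)) => // t /andP[t0 t1]; split.
    by apply: hVX; exact: lt_le_trans t0.
  have := hV X t; rewrite (min_idPl (ltW X0)); apply; exact: lt_le_trans t0.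
have UU : U 1 0 - U 1 X = U 0 0 - U 0 X.
  apply: (@cder_eq _ (U 1) (U 0) (fun x => F (g (Num.min x 0) 1)) X 0); first exact: ltW.
  move=> x /andP[Xx _]; have Xx1 : X - 1 < x by lra.
  split; first exact: hU.
  have -> : g (Num.min x 0) 1 = g (Num.min x 0) 0 by rewrite /g zeta01.
  exact: hU.
(* The boundary integral of a rectangle: U t is a primitive along the side of height t, V x along
   the side of abscissa x. *)
pose mu x1 x2 t1 t2 := (U t1 x2 - U t1 x1) + (V x2 t2 - V x2 t1)
   - (U t2 x2 - U t2 x1) - (V x1 t2 - V x1 t1).
suff : mu X 0 0 1 = 0.
  rewrite /mu -UU => h; apply/eqP; rewrite -subr_eq0 -h; apply/eqP; ring.
have locmu p q e : X <= p <= X + - X -> 0 <= q <= 0 + 1 -> 0 < e ->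
  exists2 d, 0 < d & forall x t h, 0 < h < d ->
    X <= x -> x + - X * h <= X + - X -> 0 <= t -> t + 1 * h <= 0 + 1 ->
    x <= p <= x + - X * h -> t <= q <= t + 1 * h ->
    cabs (mu x (x + - X * h) t (t + 1 * h)) <= e * h ^+ 2.
  rewrite subrr add0r => /andP[Xp p0] /andP[q0 q1] e0.
  have [l hl] := dF (g_lt1 q p0).
  have cm0 : 0 < cm by rewrite /cm divr_gt0 ?subr_gt0// mulr_gt0// pi_gt0.
  (* [L * h] bounds the variation of g over a rectangle of scale h. Q collects the errors of the
     four sides, which at precision e / Q add up to exactly e h^2. *)
  pose L := 4 * (- X) + 4 * pi; have pi0 := pi_gt0 R.
  have L0 : 0 < L by rewrite /L; nra.
  pose Q := 4 * L * (- X + cm); have Q0 : 0 < Q by rewrite /Q !mulr_gt0//; lra.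
  have [d d0 hd] := hl _ (divr_gt0 e0 Q0).
  exists (d / L); first by rewrite divr_gt0.
  move=> x t h /andP[h0]; rewrite ltr_pdivlMr// !mul1r => hL Xx xX t0 t1
    /andP[xp px] /andP[tq qt].
  (* F is affine near g p q up to E. Expanding around z rather than g p q makes the product with [c]
     explicitly integrable, by [gzc]. *)
  pose k := F (g p q) - l * (g p q - z).
  pose E y s := F (g y s) - F (g p q) - l * (g y s - g p q).
  have FE y s : F (g y s) = k + l * (g y s - z) + E y s by rewrite /E /k; ring.
  have Eb y s : x <= y <= x + - X * h -> t <= s <= t + h -> cabs (E y s) <= e / Q * (L * h).
    move=> /andP[y1 y2] /andP[s1 s2].
    have y0 : y <= 0 by apply: le_trans y2 _.
    have gL : cabs (g y s - g p q) <= L * h.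
      apply: le_trans (g_lip _ _ y0 p0) _.
      have a1 : `|y - p| <= - X * h by rewrite ler_norml; apply/andP; split; lra.
      have a2 : `|s - q| <= h by rewrite ler_norml; apply/andP; split; lra.
      have := ler_wpM2l (ltW pi0) a2; rewrite /L; lra.
    have := hd (g y s - g p q); rewrite [g p q + _]addrC subrK => /(_ _)/le_trans.
    apply; first by apply: le_lt_trans gL _; rewrite mulrC.
    by rewrite ler_wpM2l// ltW// divr_gt0.
  have hXh : 0 <= - X * h by nra.
  have x1p : X - 1 < x by lra.
  have xx : x <= x + - X * h by lra.
  have tt : t <= t + h by lra.
  (* Explicit primitives of the affine part along the two kinds of sides; their contributions to the
     boundary cancel identically, so only the errors remain. *)
  pose EU s y := k * (y%:C)%C + l * (((expR y)%:C)%C * (zeta s - z)).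
  pose EV y s := k * Cc s + l * (((expR y)%:C)%C * zeta s).
  have sideU s : t <= s <= t + h ->
    cabs (U s (x + - X * h) - U s x - (EU s (x + - X * h) - EU s x))
      <= 2 * (e / Q * (L * h)) * (- X * h).
    move=> hs; have := @loc_err x (x + - X * h) (U s)
      (fun y => k + l * (g y s - z)) (fun y => E y s) (e / Q * (L * h)) xx.
    rewrite [x + _ - x]addrC addKr; apply.
      move=> y hy; split; last exact: Eb.
      rewrite -FE; have /andP[y1 y2] := hy.
      have /hU : X - 1 < y by lra.
      by move=> /(_ s); rewrite (min_idPl (le_trans y2 xX)).
    move=> y hy; rewrite /EU; apply: cderD.
      by rewrite -[X in cder _ _ X]mulr1; apply: cderZ; exact: cder_id.
    apply: cderZ; rewrite /g [z + _]addrC addrK.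
    rewrite [in X in cder _ _ X]mulrC (_ : (fun t => _) = (fun y => (zeta s - z) * ((expR y)%:C)%C)).
      by apply: cderZ; exact: cder_exp.
    by apply/funext => ?; rewrite mulrC.
  have sideV y : x <= y <= x + - X * h ->
    cabs (V y (t + h) - V y t - (EV y (t + h) - EV y t))
      <= 2 * (e / Q * (L * h) * cm) * h.
    move=> hy; have := @loc_err t (t + h) (V y)
      (fun s => (k + l * (g y s - z)) * c s) (fun s => E y s * c s) (e / Q * (L * h) * cm) tt.
    rewrite [t + _ - t]addrC addKr; apply.
      move=> s hs; split; last first.
        by rewrite cabsM ler_pM ?cabs_ge0//; exact: Eb.
      rewrite -mulrDl -FE; have /andP[s1 s2] := hs; have /andP[y1 y2] := hy.
      have /hV : -1 < s by lra.
      by move=> /(_ y); rewrite (min_idPl (le_trans y2 xX)).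
    move=> s /andP[s1 s2]; rewrite /EV mulrDl -mulrA gzc; apply: cderD.
      by apply: cderZ; apply: hCc; lra.
    by do 2 apply: cderZ.
  have tin : t <= t <= t + h by rewrite lexx.
  have thin : t <= t + h <= t + h by rewrite lexx andbT.
  have xin : x <= x <= x + - X * h by rewrite lexx.
  have xhin : x <= x + - X * h <= x + - X * h by rewrite lexx andbT.
  have H1 := sideU _ tin; have H2 := sideU _ thin.
  have H3 := sideV _ xin; have H4 := sideV _ xhin.
  set x2 := x + - X * h in H1 H2 H3 H4 *; set t2 := t + h in H1 H2 H3 H4 *.
  have -> : mu x x2 t t2 =
    (U t x2 - U t x - (EU t x2 - EU t x)) + (V x2 t2 - V x2 t - (EV x2 t2 - EV x2 t))
    - (U t2 x2 - U t2 x - (EU t2 x2 - EU t2 x)) - (V x t2 - V x t - (EV x t2 - EV x t)).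
    by rewrite /mu /EU /EV; ring.
  apply: le_trans (cabsB _ _) _; apply: le_trans (lerD (cabsB _ _) (lexx _)) _.
  apply: le_trans (lerD (lerD (cabsD _ _) (lexx _)) (lexx _)) _.
  apply: le_trans (lerD (lerD (lerD H1 H4) H2) H3) _.
  rewrite le_eqVlt; apply/orP; left; apply/eqP; rewrite /Q; field.
  by rewrite !gt_eqF//; lra.
have X0' : 0 < - X by rewrite oppr_gt0.
(* Bisection concerns real-valued functions, hence it is run on the real and the imaginary part. *)
have reduce (f : R[i] -> R) : (forall w, `|f w| <= cabs w) -> {morph f : x y / x + y} ->
    f (mu X 0 0 1) = 0.
  move=> fle fD.
  have := @bisection_zero R (fun x1 x2 t1 t2 => f (mu x1 x2 t1 t2)) _ _ X 0 (- X) 1 X0' ltr01.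
  rewrite subrr add0r; apply.
  - by move=> *; rewrite -fD; congr f; rewrite /mu; ring.
  - by move=> *; rewrite -fD; congr f; rewrite /mu; ring.
  move=> p q e hp hq e0.
  have hp' : X <= p <= X + - X by rewrite subrr.
  have hq' : 0 <= q <= 0 + 1 by rewrite add0r.
  have [d d0 hd] := locmu p q e hp' hq' e0.
  exists d => // x t h h0 x1 x2 t1 t2 x3 t3; apply: le_trans (fle _) _.
  by apply: hd => //; rewrite ?subrr ?add0r.
by apply: complexP; apply: reduce => [w|w1 w2];
  rewrite ?abs_Re_le ?abs_Im_le ?ReD ?ImD.
Qed.

(** The circle is shrunk to z, where F is nearly constant. The winding factor C 1 - C 0 is left
    unevaluated; [taylor_disc_aux] obtains it from the constant function 1. *)
Lemma cauchy_formula V0 : (forall t, -1 < t -> cder V0 t (F (zeta t) * c t)) ->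
  forall C, (forall t, -1 < t -> cder C t (c t)) ->
  V0 1 - V0 0 = F z * (C 1 - C 0).
Proof.
move=> hV0 C hC; apply/eqP; rewrite -subr_eq0; apply/eqP; apply: cabs_eps0 => e e0.
have cm0 : 0 < cm by rewrite /cm divr_gt0 ?subr_gt0// mulr_gt0// pi_gt0.
have [d d0 hd] := contF (lt_trans zr r1) (divr_gt0 e0 (mulr_gt0 (ltr0Sn R 1) cm0)).
(* Since [zeta t - z] has modulus at most 2, s <= d / 3 puts the small circle within d of z; s <= 1
   / 2 makes X negative. *)
pose s := Num.min (d / 3) (1 / 2).
have s0 : 0 < s by rewrite /s lt_min !divr_gt0.
have s1 : s < 1 by rewrite /s gt_min; apply/orP; right; lra.
pose X := ln s; have X0 : X < 0 by rewrite /X ln_lt0// s0.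
have [VX hVX] := cprimitive_ex (-1) (ccontM (ccont_gt (ltW X0)) ccont_c).
rewrite (annulus_const X0 hV0 hVX).
have -> : VX 1 - VX 0 - F z * (C 1 - C 0) = (VX 1 - F z * C 1) - (VX 0 - F z * C 0) by ring.
apply: le_trans (@cder_bound _ (fun t => VX t - F z * C t)
  (fun t => F (g X t) * c t - F z * c t) 0 1 (e / 2) ler01 _) _; last first.
  by rewrite subr0 mulr1 mulrC divfK.
move=> t /andP[t0 t1]; have t0' : -1 < t by apply: lt_le_trans t0; rewrite ltrN10.
split; first by apply: cderB; [exact: hVX|apply: cderZ; exact: hC].
rewrite -mulrBl cabsM.
have -> : e / 2 = e / (2 * cm) * cm by field; rewrite gt_eqF.
apply: ler_pM; rewrite ?cabs_ge0//; apply: ltW; apply: hd.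
rewrite cabsM cabsR ger0_norm ?expR_ge0// /X lnK ?posrE//.
have : s <= d / 3 by rewrite /s ge_min lexx.
have := zetaz_le t; have := cabs_ge0 (zeta t - z); nra.
Qed.

End Cauchy.

(** * Taylor expansion on the disc and uniqueness of coefficients *)

Section Taylor.
Context {R : realType}.
Implicit Types (F : R[i] -> R[i]) (w l : R[i]).

Lemma ccontX (u : R -> R[i]) n : ccont u -> ccont (fun t => u t ^+ n).
Proof.
move=> hu; elim: n => [|n IH]; first by under eq_fun do rewrite expr0; exact: ccont_cst.
by under eq_fun do rewrite exprS; exact: ccontM.
Qed.

Lemma cder_sum (G : nat -> R -> R[i]) x (k : nat -> R[i]) N :
  (forall n, cder (G n) x (k n)) -> cder (fun t => \sum_(n < N) G n t) x (\sum_(n < N) k n).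
Proof.
move=> H; elim: N => [|N IH].
  rewrite big_ord0; under eq_fun do rewrite big_ord0; exact: cder_cst.
by rewrite big_ord_recr; under eq_fun do rewrite big_ord_recr; exact: cderD.
Qed.

(** The geometric series of z / zt with its exact remainder, so that the expansion under the
    integral stays finite. *)
Lemma kernel_sum (zt z : R[i]) N : zt != 0 -> zt - z != 0 ->
  zt / (zt - z) = \sum_(n < N) z ^+ n * (zt^-1 ^+ n) + (z / zt) ^+ N * (zt / (zt - z)).
Proof.
move=> z0 zz; elim: N => [|N IH]; first by rewrite big_ord0 expr0 add0r mul1r.
rewrite [LHS]IH big_ord_recr /= -addrA; congr (_ + _).
by rewrite exprSr expr_div_n exprVn; field; rewrite zz z0 expf_neq0.
Qed.

(* The n-th coefficient is the mean of F(zeta) zeta^-n over the circle of radius r. *)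
Lemma taylor_disc_aux F (r : R) : 0 < r < 1 ->
  (forall w, cabs w < 1 -> exists l, cdiff F w l) ->
  exists a M, (forall n, cabs (a n) * r ^+ n <= M) /\
    forall z, cabs z < r -> ccvg (fun N => \sum_(n < N) a n * z ^+ n) (F z).
Proof.
move=> /andP[r0 r1] dF.
pose zeta t : R[i] := (r%:C)%C * ce t.
have zE t : cabs (zeta t) = r by rewrite /zeta cabsM cabs_ce mulr1 cabsR gtr0_norm.
have zd t : cder zeta t (I2pi * zeta t).
  by rewrite /zeta mulrCA; apply: cderZ; exact: cder_ce1.
have z01 : zeta 1 = zeta 0 by rewrite /zeta ce0 ce1.
have zn0 t : zeta t != 0 by rewrite -cabs_gt0 zE.
have czeta : ccont zeta by apply: cder_ccont => t; exists (I2pi * zeta t).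
have czV : ccont (fun t => (zeta t)^-1).
  by apply: (ccont_comp (F := GRing.inv)) => // t; exact: contatV.
have cFz : ccont (fun t => F (zeta t)).
  by apply: ccont_comp => // t; have [|l /cdiff_contat] := dF (zeta t); rewrite ?zE.
have m1 : -1 < 0 :> R by rewrite ltrN10.
have cA n : ccont (fun t => F (zeta t) * (zeta t)^-1 ^+ n).
  by apply: ccontM => //; exact: ccontX.
pose A n := projT1 (cid (cprimitive_ex (-1) (cA n))).
have hA n t : -1 < t -> cder (A n) t (F (zeta t) * (zeta t)^-1 ^+ n).
  exact: (projT2 (cid (cprimitive_ex (-1) (cA n)))).
(* An explicit primitive of zeta^-n. For n > 0 it is 1-periodic, so only n = 0 has a nonzero
   mean. *)
pose D n : R -> R[i] := if n is m.+1 then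
    fun t => (- (m.+1%:R)^-1 * I2pi^-1) * (r%:C)%C^-1 ^+ m.+1 * ce (- (m.+1%:R) * t)
  else fun t => (t%:C)%C.
have hD n t : cder (D n) t ((zeta t)^-1 ^+ n).
  case: n => [|m]; first by rewrite expr0; exact: cder_id.
  have := cderZ ((- (m.+1%:R)^-1 * I2pi^-1) * (r%:C)%C^-1 ^+ m.+1) (cder_ce (- (m.+1%:R)) t).
  suff <- : - (m.+1%:R)^-1 * I2pi^-1 * (r%:C)%C^-1 ^+ m.+1 *
     (((- m.+1%:R)%:C)%C * I2pi * ce (- m.+1%:R * t)) = (zeta t)^-1 ^+ m.+1 by [].
  rewrite mulNr ceN -ceX /zeta invfM exprMn exprVn rmorphN rmorph_nat [in RHS]exprVn.
  field; rewrite !expf_neq0 ?ce_neq0 ?I2pi_neq0 ?pnatr_eq0 ?andbT//.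
    by rewrite addrC natr1 pnatr_eq0.
  by rewrite -cabs_gt0 cabsR normr_gt0 gt_eqF.
have D01 n : D n 1 - D n 0 = (n == 0%N)%:R.
  case: n => [|m] /=; first by rewrite subr0.
  by rewrite mulr1 mulr0 ceN ce0 ce_nat invr1 subrr.
have [M M0 hM] := ccont_bound ler01 cFz.
exists (fun n => A n 1 - A n 0), (2 * M); split.
  move=> n; rewrite -ler_pdivlMr ?exprn_gt0//.
  apply: le_trans (@cder_bound _ (A n) (fun t => F (zeta t) * (zeta t)^-1 ^+ n) 0 1
    (M / r ^+ n) ler01 _) _; last by rewrite subr0 mulr1 mulrA.
  move=> t t01; split; first by apply: hA; apply: lt_le_trans m1 _; case/andP: t01.
  by rewrite cabsM cabsX cabsV zE exprVn ler_wpM2r ?invr_ge0 ?exprn_ge0 ?(ltW r0)//; exact: hM.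
move=> z zr.
have zz0 t : zeta t - z != 0.
  rewrite -cabs_gt0; have := cabsD (zeta t - z) z; rewrite subrK zE; lra.
have czz : ccont (fun t => (zeta t - z)^-1).
  apply: (ccont_comp (F := GRing.inv)) => [t|]; first exact: contatV.
  by apply: ccontD => //; exact: ccont_cst.
have cc : ccont (ckern z zeta).
  by apply: ccontM => //; apply: ccontM => //; exact: ccont_cst.
have [C hC] := cprimitive_ex (-1) cc.
have [V hV] := cprimitive_ex (-1) (ccontM cFz cc).
have CF := cauchy_formula zr r1 zE zd z01 dF hV hC.
pose q := cabs z / r.
have q01 : 0 <= q < 1 by rewrite /q divr_ge0 ?cabs_ge0 ?(ltW r0)//= ltr_pdivrMr// mul1r.
(* Used twice: with F along the circle, and with the constant 1, whose known coefficients evaluate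
   the winding factor. *)
have general (G : R -> R[i]) (B : nat -> R -> R[i]) (W : R -> R[i]) (M' : R) : 0 <= M' ->
  (forall t, 0 <= t <= 1 -> cabs (G t) <= M') ->
  (forall n t, -1 < t -> cder (B n) t (G t * (zeta t)^-1 ^+ n)) ->
  (forall t, -1 < t -> cder W t (G t * ckern z zeta t)) ->
  ccvg (fun N => \sum_(n < N) (B n 1 - B n 0) * z ^+ n) (I2pi^-1 * (W 1 - W 0)).
  move=> M'0 hG hB hW e e0.
  pose K := 2 * (M' * (r / (r - cabs z))) + 1.
  have K0 : 0 < K by rewrite /K ltr_wpDl// !mulr_ge0// ?(ltW r0)// invr_ge0 subr_ge0 ltW.
  have [N HN] := expr_small q01 (divr_gt0 e0 K0).
  exists N => n /HN; rewrite ltr_pdivlMr// => hq.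
  rewrite cabsC.
  have -> : I2pi^-1 * (W 1 - W 0) - \sum_(i < n) (B i 1 - B i 0) * z ^+ i =
    (I2pi^-1 * W 1 - \sum_(i < n) z ^+ i * B i 1) -
    (I2pi^-1 * W 0 - \sum_(i < n) z ^+ i * B i 0).
    have -> : \sum_(i < n) (B i 1 - B i 0) * z ^+ i =
      \sum_(i < n) z ^+ i * B i 1 - \sum_(i < n) z ^+ i * B i 0.
      by rewrite -sumrB; apply: eq_bigr => i _; ring.
    ring.
  apply: le_lt_trans (@cder_bound _ (fun t => I2pi^-1 * W t - \sum_(i < n) z ^+ i * B i t)
    (fun t => G t * ((z / zeta t) ^+ n * (zeta t / (zeta t - z)))) 0 1
    (M' * (q ^+ n * (r / (r - cabs z)))) ler01 _) _; last first.
    rewrite subr0 mulr1; apply: le_lt_trans hq.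
    rewrite /K mulrDr mulr1 -[leLHS]addr0 lerD ?exprn_ge0//; last by case/andP: q01.
    by rewrite le_eqVlt; apply/orP; left; apply/eqP; ring.
  move=> t /andP[t0 t1]; have t0' : -1 < t by apply: lt_le_trans t0.
  split.
    have -> : G t * ((z / zeta t) ^+ n * (zeta t / (zeta t - z))) =
      I2pi^-1 * (G t * ckern z zeta t) - \sum_(i < n) z ^+ i * (G t * (zeta t)^-1 ^+ i).
      have -> : \sum_(i < n) z ^+ i * (G t * (zeta t)^-1 ^+ i) =
        G t * \sum_(i < n) z ^+ i * (zeta t)^-1 ^+ i.
        by rewrite mulr_sumr; apply: eq_bigr => i _; ring.
      rewrite /ckern (_ : I2pi^-1 * _ = G t * (zeta t / (zeta t - z))); last first.
        by field; rewrite zz0 I2pi_neq0.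
      by rewrite {2}(kernel_sum n (zn0 t) (zz0 t)); ring.
    apply: cderB; first by apply: cderZ; exact: hW.
    apply: (@cder_sum (fun i t => z ^+ i * B i t) t
      (fun i => z ^+ i * (G t * (zeta t)^-1 ^+ i)) n) => i.
    by apply: cderZ; exact: hB.
  rewrite !cabsM cabsX cabsM !cabsV zE cabs_ce mulr1 cabsR (gtr0_norm r0).
  apply: ler_pM; rewrite ?cabs_ge0//.
  - by rewrite !mulr_ge0 ?exprn_ge0 ?divr_ge0 ?invr_ge0 ?cabs_ge0// ltW.
  - by apply: hG; rewrite t0.
  - rewrite ler_wpM2l ?exprn_ge0 ?divr_ge0 ?cabs_ge0 ?(ltW r0)// ler_wpM2l ?(ltW r0)//.
    rewrite lef_pV2 ?posrE ?cabs_gt0 ?subr_gt0//.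
    by have := cabsD (zeta t - z) z; rewrite subrK zE; lra.
have L1 := general _ _ _ _ M0 hM hA hV.
have C1 : I2pi^-1 * (C 1 - C 0) = 1.
  have : ccvg (fun N => \sum_(n < N) (D n 1 - D n 0) * z ^+ n) (I2pi^-1 * (C 1 - C 0)).
    apply: (general (fun=> 1) D C 1) => //; first by move=> t _; rewrite cabs1.
      by move=> n t _; rewrite mul1r.
    by move=> t /hC; rewrite mul1r.
  move=> /ccvg_shift h; apply: (ccvg_unique h).
  apply: (ccvg_ext _ (ccvg_cst 1)) => n.
  rewrite big_ord_recl D01 /= mul1r expr0 big1 ?addr0// => i _.
  by have /= -> := D01 (bump 0 i); rewrite mul0r.
by rewrite CF mulrCA C1 mulr1 in L1.
Qed.

(** If the coefficients below m vanish, then at a small point s the term c_m s^m equals minus the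
    remainder, which is of order s^(m+1). *)
Lemma psum0_coef0 (c : nat -> R[i]) (r M : R) : 0 < r ->
  (forall n, cabs (c n) * r ^+ n <= M) ->
  (forall z, cabs z < r -> ccvg (fun N => \sum_(n < N) c n * z ^+ n) 0) ->
  forall n, c n = 0.
Proof.
move=> r0 hM h0 n; elim/ltn_ind: n => m IH.
have M0 : 0 <= M by apply: le_trans (hM 0%N); rewrite mulr_ge0 ?cabs_ge0// exprn_ge0// ltW.
apply: cabs_eps0 => e e0.
(* s <= r / 2 bounds the inverse of 1 - s / r by 2; the second bound brings 2 M s / r^(m+1) below
   e. *)
pose s := Num.min (r / 2) (e * r ^+ m.+1 / (2 * M + 1)).
have M1 : 0 < 2 * M + 1 by rewrite ltr_wpDl// mulr_ge0.
have s0 : 0 < s by rewrite /s lt_min !divr_gt0// mulr_gt0// exprn_gt0.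
have sr : s <= r / 2 by rewrite /s ge_min lexx.
have se : s <= e * r ^+ m.+1 / (2 * M + 1) by rewrite /s ge_min lexx orbT.
have q01 : 0 <= s / r < 1.
  by rewrite divr_ge0 ?(ltW s0) ?(ltW r0)//= ltr_pdivrMr// mul1r; lra.
have zs : cabs ((s%:C)%C : R[i]) = s by rewrite cabsR gtr0_norm.
have [|cv /(_ m.+1)] := csum_geo (a := fun n => c n * (s%:C)%C ^+ n) (M := M) q01.
  move=> n; rewrite cabsM cabsX zs expr_div_n mulrA ler_pdivlMr ?exprn_gt0//.
  by rewrite mulrAC ler_wpM2r ?exprn_ge0 ?(ltW s0).
have -> : csum (fun n => c n * (s%:C)%C ^+ n) = 0.
  by apply: (ccvg_unique cv); apply: h0; rewrite zs; lra.
rewrite sub0r cabsN big_ord_recr /= big1 ?add0r; last first.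
  by move=> i _; rewrite IH ?mul0r.
rewrite cabsM cabsX zs => h1.
have h2 : cabs (c m) * s ^+ m <= (2 * M) * (s / r ^+ m.+1) * s ^+ m.
  apply: le_trans h1 _; rewrite expr_div_n.
  have -> : M / (1 - s / r) * (s ^+ m.+1 / r ^+ m.+1) = (1 - s / r)^-1 * (M * (s / r ^+ m.+1) * s ^+ m).
    by rewrite [s ^+ m.+1]exprS; ring.
  have -> : 2 * M * (s / r ^+ m.+1) * s ^+ m = 2 * (M * (s / r ^+ m.+1) * s ^+ m) by ring.
  rewrite ler_wpM2r//.
    by rewrite !mulr_ge0 ?invr_ge0 ?exprn_ge0 ?(ltW s0) ?(ltW r0).
  have h : 1 / 2 <= 1 - s / r by rewrite lerBrDr -lerBrDl ler_pdivrMr//; lra.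
  by rewrite -[2]invrK lef_pV2 ?posrE ?invr_gt0//; lra.
have h3 : cabs (c m) <= 2 * M * (s / r ^+ m.+1).
  by move: h2; rewrite ler_pM2r// exprn_gt0.
apply: le_trans h3 _; rewrite mulrA ler_pdivrMr ?exprn_gt0//.
move: se; rewrite ler_pdivlMr//; nra.
Qed.

(** Expansions obtained for two radii agree near 0 and so share their coefficients by [psum0_coef0];
    those for the radius 1/2 therefore serve every radius. *)
Lemma taylor_disc F : (forall w, cabs w < 1 -> exists l, cdiff F w l) ->
  exists2 a, rad1 a & forall z, cabs z < 1 -> F z = psum a z.
Proof.
move=> dF.
have h2 : 0 < (2^-1 : R) < 1 by rewrite invr_gt0 ltr0n/= invf_lt1// ltr1n.
have [a [M [hM ha]]] := taylor_disc_aux h2 dF.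
have same (r : R) b (M' : R) : 0 < r -> (forall n, cabs (b n) * r ^+ n <= M') ->
    (forall z, cabs z < r -> ccvg (fun N => \sum_(n < N) b n * z ^+ n) (F z)) ->
    forall n, a n = b n.
  move=> r0 hM' hb n; apply/eqP; rewrite -subr_eq0; apply/eqP; move: n.
  pose s := Num.min 2^-1 r.
  have s0 : 0 < s by rewrite lt_min r0 invr_gt0 ltr0n.
  apply: (@psum0_coef0 (fun n => a n - b n) s (M + M') s0).
    move=> n; apply: (@le_trans _ _ (cabs (a n) * s ^+ n + cabs (b n) * s ^+ n)).
      by rewrite -mulrDl ler_wpM2r ?exprn_ge0 ?cabsB// ltW.
    apply: lerD; [apply: le_trans (hM n)|apply: le_trans (hM' n)].
      by rewrite ler_wpM2l ?cabs_ge0// lerXn2r ?nnegrE ?invr_ge0 ?(ltW s0)// ge_min lexx.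
    by rewrite ler_wpM2l ?cabs_ge0// lerXn2r ?nnegrE ?(ltW r0) ?(ltW s0)// ge_min lexx orbT.
  move=> z; rewrite lt_min => /andP[z1 z2].
  have := ccvgB (ha _ z1) (hb _ z2); rewrite subrr; apply: ccvg_ext => N.
  by rewrite -sumrB; apply: eq_bigr => i _; rewrite mulrBl.
have all r : 0 < r < 1 -> (exists M, forall n, cabs (a n) * r ^+ n <= M) /\
   forall z, cabs z < r -> ccvg (fun N => \sum_(n < N) a n * z ^+ n) (F z).
  move=> r01; have [b [M' [hM' hb]]] := taylor_disc_aux r01 dF.
  have /andP[r0 _] := r01; have E := same r b M' r0 hM' hb; split.
    by exists M' => n; rewrite E.
  by move=> z /hb; apply: ccvg_ext => N; apply: eq_bigr => i _; rewrite E.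
have ra : rad1 a.
  move=> r /andP[r0 r1]; have h : 0 < (1 + r) / 2 < 1 by apply/andP; split; lra.
  have [[M' hM'] _] := all _ h; exists M' => n; apply: le_trans (hM' n).
  by rewrite ler_wpM2l ?cabs_ge0// lerXn2r ?nnegrE//; lra.
exists a => // z z1; have h : 0 < (1 + cabs z) / 2 < 1.
  by have := cabs_ge0 z; move=> ?; apply/andP; split; lra.
have [_ /(_ z) hz] := all _ h.
by apply: (ccvg_unique (hz _) (psum_cvg ra z1)); lra.
Qed.

End Taylor.

(* [leb2] lives on the product of the sigma-algebras generated by half-open
   intervals, not on the canonical one of [R * R]; the two are convertible. *)
Notation plane R := (measurableTypeR R * measurableTypeR R)%type.

(** * Lebesgue measure under affine maps of the line *)

Section AffineLebesgue.
Context {R : realType}.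
Local Notation mu := (@lebesgue_measure R).
Local Notation T := (measurableTypeR R).
Local Open Scope ereal_scope.

Lemma measurable_affine (a c : R) : measurable_fun setT ((fun x : T => (a * x + c)%R) : T -> T).
Proof. by apply: measurable_funD => //; apply: measurable_funM. Qed.

(** The rescaled image measure agrees with Lebesgue measure on half-open intervals, which determine
    it. *)
Lemma lebesgue_measure_affine (a c : R) (A : set T) : (0 < a)%R -> measurable A ->
  a%:E * mu ((fun x : T => (a * x + c)%R : T) @^-1` A) = mu A.
Proof.
move=> a0 mA.
pose m := mscale (NngNum (ltW a0)) (measure_function_pushforward__canonical__measure_function_Measure
   mu (measurable_affine a c)).
suff -> : mu A = m A by [].
apply: (@lebesgue_measure_unique R m) => // X /ocitvP[->|[[x y] /= xy ->]]; first by rewrite !measure0.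
rewrite /m /mscale /= /pushforward.
rewrite (_ : (fun _ => _) @^-1` _ = [set` `]((x - c) / a)%R, ((y - c) / a)%R]%R]); last first.
  apply/seteqP; split => t /=; rewrite !in_itv/= ltr_pdivrMr// ler_pdivlMr//.
    by move=> /andP[? ?]; apply/andP; split; lra.
  by move=> /andP[? ?]; apply/andP; split; lra.
rewrite !lebesgue_measure_itv /= !lte_fin xy ltr_pM2r ?invr_gt0// ltrD2r xy.
by rewrite -!EFinB -EFinM; congr (_%:E); field; rewrite gt_eqF.
Qed.

End AffineLebesgue.

(** * Area-preserving maps of the plane and scaling *)

Section PlaneMaps.
Context {R : realType}.
Local Notation mu := (@lebesgue_measure R).
Local Notation L2 := (@leb2 R).
Local Notation T := (measurableTypeR R).
Local Open Scope ereal_scope.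
Implicit Types (A : set (plane R)) (f : plane R -> plane R).

Definition mpres f := measurable_fun setT f /\
  forall A, measurable A -> L2 (f @^-1` A) = L2 A.

Lemma mpres_comp f g : mpres f -> mpres g -> mpres (f \o g).
Proof.
move=> [mf hf] [mg hg]; split; first exact: measurableT_comp.
move=> A mA; rewrite comp_preimage hg ?hf//.
by rewrite -[X in measurable X]setTI; exact: mf.
Qed.

Lemma measurable_swap : measurable_fun setT ((fun p => (p.2, p.1)) : plane R -> plane R).
Proof. by apply: measurable_fun_pair; [exact: measurable_snd|exact: measurable_fst]. Qed.

Lemma mpres_swap : mpres (fun p => (p.2, p.1)).
Proof.
split; first exact: measurable_swap.
move=> A mA; apply/esym.
pose m := measure_function_pushforward__canonical__measure_function_Measure
  L2 measurable_swap.
apply: (@product_measure_unique _ _ _ _ _ mu mu m) => // B C mB mC.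
rewrite /m /= /pushforward.
rewrite (_ : (fun _ => _) @^-1` (B `*` C) = C `*` B); last first.
  by apply/seteqP; split => -[x y] /= [].
by rewrite /leb2 product_measure1E// muleC.
Qed.

Lemma measurable_shear (a : R) :
  measurable_fun setT ((fun p => (p.1, (p.2 + a * p.1)%R)) : plane R -> plane R).
Proof.
apply: measurable_fun_pair; first exact: measurable_fst.
apply: (@measurable_funD _ (plane R) R); first exact: measurable_snd.
by apply: measurable_funM => //; exact: measurable_fst.
Qed.

(** Cavalieri: every vertical section is merely translated. *)
Lemma mpres_shear (a : R) : mpres (fun p => (p.1, (p.2 + a * p.1)%R)).
Proof.
split; first exact: measurable_shear.
move=> A mA; rewrite /leb2 /product_measure1; apply: eq_integral => x _ /=.
rewrite (_ : xsection _ x =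
  (fun y : T => (1 * y + a * x)%R : T) @^-1` (xsection A x)); last first.
  by apply/seteqP; split => y; rewrite /xsection /= !inE /= mul1r.
rewrite -[LHS]mul1e lebesgue_measure_affine//; exact: measurable_xsection.
Qed.

Lemma mpres_shear' (a : R) : mpres (fun p => ((p.1 + a * p.2)%R, p.2)).
Proof. exact: (mpres_comp mpres_swap (mpres_comp (mpres_shear a) mpres_swap)). Qed.

(* A rotation by an angle other than pi is a product of three shears. *)
Lemma mpres_rot (c s : R) : (c ^+ 2 + s ^+ 2 = 1)%R -> (0 < 1 + c)%R ->
  mpres (fun p => ((c * p.1 - s * p.2)%R, (s * p.1 + c * p.2)%R)).
Proof.
move=> cs c0; pose t := (- (s / (1 + c)))%R.
have := mpres_comp (mpres_shear' t) (mpres_comp (mpres_shear s) (mpres_shear' t)).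
congr mpres; apply/funext => -[x y] /=.
have E : (s * t = c - 1)%R.
  rewrite /t mulrN mulrA -expr2 (_ : s ^+ 2 = (1 - c) * (1 + c))%R; last by move: cs; lra.
  by rewrite mulfK ?gt_eqF// opprB.
have E2 : (t + t * (s * t + 1) = - s)%R.
  rewrite E subrK /t mulNr -opprD; congr (- _)%R.
  by field; rewrite gt_eqF.
have -> : (x + t * y + t * (y + s * (x + t * y)) = (1 + s * t) * x + (t + t * (s * t + 1)) * y)%R by ring.
have -> : (y + s * (x + t * y) = s * x + (1 + s * t) * y)%R by ring.
rewrite E2 E; congr (_, _); ring.
Qed.

Lemma leb2_scale (a : R) A : (0 < a)%R -> measurable A ->
  (a ^+ 2)%:E * L2 ((fun p => ((a * p.1)%R, (a * p.2)%R)) @^-1` A) = L2 A.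
Proof.
move=> a0 mA.
have mf : measurable_fun setT ((fun p => ((a * p.1)%R, (a * p.2)%R)) : plane R -> plane R).
  apply: measurable_fun_pair; apply: (@measurable_funM _ (plane R) R) => //.
have a20 : (0 <= a ^+ 2)%R by rewrite sqr_ge0.
pose m := mscale (NngNum a20)
  (measure_function_pushforward__canonical__measure_function_Measure L2 mf).
apply/esym; apply: (@product_measure_unique _ _ _ _ _ mu mu m) => // B C mB mC.
rewrite /m /= /mscale /= /pushforward.
rewrite (_ : (fun _ => _) @^-1` (B `*` C) =
   ((fun x : T => (a * x + 0)%R : T) @^-1` B) `*` ((fun x : T => (a * x + 0)%R : T) @^-1` C)); last first.
  by apply/seteqP; split => -[x y] /=; rewrite !addr0.
rewrite /leb2 product_measure1E; last 2 first.
- by rewrite -[X in measurable X]setTI; exact: measurable_affine.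
- by rewrite -[X in measurable X]setTI; exact: measurable_affine.
rewrite -[in RHS](lebesgue_measure_affine 0 a0 mB) -[in RHS](lebesgue_measure_affine 0 a0 mC).
by rewrite expr2 EFinM muleACA.
Qed.

Lemma mpres_integral f (D : set (plane R)) (g : plane R -> \bar R) :
  mpres f -> measurable D -> f @^-1` D = D -> measurable_fun D g ->
  \int[L2]_(p in D) g (f p) = \int[L2]_(p in D) g p.
Proof.
move=> [mf hf] mD fD mg.
have ge0case (k : plane R -> \bar R) : measurable_fun D k -> (forall p, 0 <= k p) ->
  \int[L2]_(p in D) k (f p) = \int[L2]_(p in D) k p.
  move=> mk k0; rewrite -[in LHS]fD.
  transitivity (\int[pushforward L2 f]_(p in D) k p).
    by rewrite (ge0_integral_pushforward mf).
  by apply: eq_measure_integral => A mA _; exact: hf.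
have hp := ge0case (g^\+) (measurable_funepos mg) (funepos_ge0 g).
have hn := ge0case (g^\-) (measurable_funeneg mg) (funeneg_ge0 g).
rewrite integralE [RHS]integralE; congr (_ - _).
  by rewrite -[RHS]hp; apply: eq_integral => p _; rewrite !funeposE.
by rewrite -[RHS]hn; apply: eq_integral => p _; rewrite !funenegE.
Qed.

End PlaneMaps.

(** * Areas of discs and finiteness of the weight *)

Section DiscMass.
Context {R : realType}.
Local Notation mu := (@lebesgue_measure R).
Local Notation L2 := (@leb2 R).
Implicit Types (p : plane R) (r : R).

Definition nsq (p : plane R) : R := p.1 ^+ 2 + p.2 ^+ 2.

(* [r] is the square of the radius. *)
Definition discr r : set (plane R) := [set p | nsq p < r].

Lemma nsq_ge0 p : 0 <= nsq p.
Proof. by rewrite addr_ge0// sqr_ge0. Qed.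

Lemma measurable_fstR (D : set (plane R)) : measurable_fun D (fun p => p.1 : R).
Proof. by apply: measurable_funTS; exact: measurable_fst. Qed.

Lemma measurable_sndR (D : set (plane R)) : measurable_fun D (fun p => p.2 : R).
Proof. by apply: measurable_funTS; exact: measurable_snd. Qed.

Lemma measurable_nsq (D : set (plane R)) : measurable_fun D nsq.
Proof.
by apply: measurable_funD; apply: measurable_funX; [exact: measurable_fstR|exact: measurable_sndR].
Qed.

Lemma measurable_discr r : measurable (discr r).
Proof.
rewrite [X in measurable X](_ : _ = setT `&` nsq @^-1` `]-oo, r[%classic).
  by apply: measurable_nsq => //; exact: measurable_itv.
by apply/seteqP; split => p /=; rewrite in_itv/=; [split|case].
Qed.

Lemma leb2_disc_lt : (L2 (discr 1) < +oo)%E.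
Proof.
pose I : set (measurableTypeR R) := `[-1, 1]%classic.
have mI : measurable I by exact: measurable_itv.
have IE : mu I = 2%:E.
  rewrite lebesgue_measure_itv /= lte_fin (_ : -1 < 1)// -EFinB; congr (_%:E); ring.
apply: (@le_lt_trans _ _ (L2 (I `*` I))).
  apply: le_measure; rewrite ?inE; [exact: measurable_discr|exact: measurableX|].
  move=> [x y]; rewrite /discr /nsq /I /= !in_itv/= => h.
  have hx := sqr_ge0 x; have hy := sqr_ge0 y.
  by split; rewrite -ler_norml -(ler_pXn2r (ltn0Sn 1)) ?nnegrE// expr1n real_normK ?num_real//; lra.
have -> : L2 (I `*` I) = (mu I * mu I)%E := product_measure1E mu mu mI mI.
by rewrite IE -EFinM ltry.
Qed.

(** Kept symbolic: scaling expresses the areas of all centred discs and annuli through it. *)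
Definition darea : R := fine (L2 (discr 1)).

Lemma leb2_disc : L2 (discr 1) = darea%:E.
Proof. by rewrite /darea fineK// ge0_fin_numE// leb2_disc_lt. Qed.

Lemma darea_ge0 : 0 <= darea.
Proof. exact: fine_ge0. Qed.

Lemma leb2_discr r : 0 < r -> L2 (discr r) = (r * darea)%:E.
Proof.
move=> r0; pose t := Num.sqrt r; have s0 : 0 < t by rewrite sqrtr_gt0.
have s2 : t ^+ 2 = r by rewrite sqr_sqrtr// ltW.
rewrite -(leb2_scale s0 (measurable_discr r)) s2 EFinM -leb2_disc.
congr (_ * L2 _)%E; apply/seteqP; split => p; rewrite /discr /nsq /= !exprMn -mulrDr s2.
  by rewrite gtr_pMr.
by rewrite gtr_pMr.
Qed.

Lemma leb2_annulus r : 0 < r <= 1 -> L2 (discr 1 `\` discr (1 - r)) = (r * darea)%:E.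
Proof.
move=> /andP[r0 r1]; have [r1'|r1'] := eqVneq r 1.
  rewrite r1' subrr mul1r -leb2_disc; congr L2; apply/seteqP; split => p /=; first by case.
  by move=> h; split => //; apply/negP; rewrite -leNgt nsq_ge0.
have r2 : 0 < 1 - r by rewrite subr_gt0 lt_neqAle r1' r1.
have := @measureD _ _ _ [the {measure set (plane R) -> \bar R} of L2] _ _ (measurable_discr 1) (measurable_discr (1 - r)) leb2_disc_lt.
have -> : discr 1 `&` discr (1 - r) = discr (1 - r).
  apply/seteqP; split => p /=; rewrite /discr /=; first by case.
  by move=> h; split => //; lra.
move=> /= E; rewrite [LHS]E {E} [X in (X - _)%E]leb2_disc [X in (_ - X)%E]leb2_discr//.
by rewrite -EFinB; congr (_%:E); ring.
Qed.

Variable alpha : R.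
Hypothesis alpha_gt : -1 < alpha.

Definition wt (p : plane R) : R := wA alpha p.

Lemma wt_ge0 p : 0 <= wt p.
Proof. by rewrite /wt /wA mulr_ge0 ?powR_ge0// divr_ge0 ?pi_ge0//; move: alpha_gt; lra. Qed.

Lemma wt_gt0 p : discr 1 p -> 0 < wt p.
Proof.
rewrite /discr /nsq /= => h; rewrite /wt /wA mulr_gt0//.
  by rewrite divr_gt0 ?pi_gt0//; move: alpha_gt; lra.
by rewrite powR_gt0// subr_gt0.
Qed.

Lemma measurable_wt D : measurable_fun D wt.
Proof.
apply: measurable_funM => //; apply: (measurableT_comp (measurable_powR _)).
by apply: measurable_funB => //; exact: measurable_nsq.
Qed.

Let c0 := (alpha + 1) / pi.

Let c0_ge0 : 0 <= c0.
Proof. by rewrite divr_ge0 ?pi_ge0//; move: alpha_gt; lra. Qed.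

Let wt_int_pos : 0 <= alpha -> (\int[L2]_(p in discr 1) (wt p)%:E < +oo)%E.
Proof.
move=> a0; apply: (@le_lt_trans _ _ (\int[L2]_(p in discr 1) (c0%:E))%E).
  apply: ge0_le_integral => //.
  - exact: measurable_discr.
  - by move=> p _; rewrite lee_fin wt_ge0.
  - by apply/measurable_EFinP; exact: measurable_wt.
  move=> p; rewrite /discr /= => h; rewrite lee_fin /wt /wA ler_piMr//.
  have h0 := nsq_ge0 p.
  rewrite [leRHS](_ : 1 = powR 1 alpha); last by rewrite powR1.
  apply: ge0_ler_powR => //; rewrite ?nnegrE ?subr_ge0.
    by apply: ltW.
  by rewrite ler01.
  by rewrite gerBl.
rewrite integral_cst; last exact: measurable_discr.
by rewrite [X in (_ * X)%E]leb2_disc -EFinM ltry.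
Qed.

(** Dyadic layers towards the circle, where a negative alpha makes the weight unbounded. *)
Let layer n : set (plane R) :=
  [set p | 2^-1 ^+ n.+1 < 1 - nsq p <= 2^-1 ^+ n].

Let h2 : 0 < (2^-1 : R) < 1.
Proof. by rewrite invr_gt0 ltr0n/= invf_lt1// ltr1n. Qed.

Let measurable_layer n : measurable (layer n).
Proof.
rewrite [X in measurable X](_ : _ = setT `&` (fun p => 1 - nsq p) @^-1` `]2^-1 ^+ n.+1, 2^-1 ^+ n]%classic).
  have : measurable_fun setT (fun p => 1 - nsq p).
    by apply: measurable_funB => //; exact: measurable_nsq.
  by apply => //; exact: measurable_itv.
by apply/seteqP; split => p /=; rewrite in_itv/=; [split|case].
Qed.

Let bigcup_layer : \bigcup_k layer k = discr 1.
Proof.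
apply/seteqP; split => p.
  move=> [k _ /andP[h _]]; rewrite /discr /= -subr_gt0; apply: lt_trans h.
  by rewrite exprn_gt0//; case/andP: h2.
rewrite /discr /= -subr_gt0 => h.
have : exists n, 2^-1 ^+ n < 1 - nsq p.
  have [|N /(_ N (leqnn _)) HN] := expr_small (q := 2^-1) _ h; last by exists N.
  by case/andP: h2 => /ltW -> ->.
move=> ex; case: (ex_minnP ex) => -[|m] h1 hm.
  by have := nsq_ge0 p; move: h1; rewrite expr0; lra.
exists m => //; rewrite /layer /= h1 leNgt /=; apply/negP => /hm.
by rewrite ltnn.
Qed.

Let trivIset_layer : trivIset setT layer.
Proof.
have main i j p : layer i p -> layer j p -> (j <= i)%N.
  move=> /andP[h1 h2'] /andP[h3 h4]; rewrite leqNgt; apply/negP => ij.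
  have : 2^-1 ^+ j <= 2^-1 ^+ i.+1 :> R.
    by apply: ler_wiXn2l => //; case/andP: h2 => *; apply: ltW.
  by move: h1 h4; lra.
move=> i j _ _ [p [hi hj]]; apply/eqP; rewrite eqn_leq; apply/andP.
by split; [exact: main hj hi|exact: main hi hj].
Qed.

Let wt_int_neg : alpha < 0 -> (\int[L2]_(p in discr 1) (wt p)%:E < +oo)%E.
Proof.
move=> a0; rewrite -bigcup_layer ge0_integral_bigcup//; last 2 first.
- by apply/measurable_EFinP; exact: measurable_wt.
- by move=> p _; rewrite lee_fin wt_ge0.
have /andP[h20 h21] := h2.
(* On layer i the weight is at most a constant times 2^(-(i+1) alpha) and the area at most a
   constant times 2^-i. The product decays with ratio q, and q < 1 since alpha > -1. *)
pose q := powR 2^-1 (1 + alpha).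
have q01 : 0 <= q < 1.
  rewrite /q powR_ge0/= [ltRHS](_ : 1 = powR 1 (1 + alpha)); last by rewrite powR1.
  by apply: gt0_ltr_powR; rewrite ?nnegrE ?(ltW h20)//; move: alpha_gt; lra.
pose M := c0 * powR 2^-1 alpha * darea.
have M0 : 0 <= M by apply: mulr_ge0 darea_ge0; apply: mulr_ge0 => //; exact: powR_ge0.
have layer_le i : (\int[L2]_(p in layer i) (wt p)%:E <= (M * q ^+ i)%:E)%E.
  have v0 : 0 < 2^-1 ^+ i.+1 :> R by rewrite exprn_gt0.
  apply: (@le_trans _ _ (\int[L2]_(p in layer i) (c0 * powR (2^-1 ^+ i.+1) alpha)%:E)%E).
    apply: ge0_le_integral => //.
    - by move=> p _; rewrite lee_fin wt_ge0.
    - by apply/measurable_EFinP; exact: measurable_wt.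
    move=> p /andP[p1 p2]; rewrite lee_fin /wt /wA ler_wpM2l//.
    rewrite -[alpha]opprK ![_ `^ - - alpha]powRN lef_pV2 ?posrE ?powR_gt0//; last first.
      by apply: lt_trans p1.
    by apply: ge0_ler_powR; rewrite ?nnegrE ?oppr_ge0 ?(ltW a0) ?(ltW v0) ?(ltW (lt_trans v0 p1)) ?(ltW p1).
  rewrite integral_cst//.
  apply: (@le_trans _ _ ((c0 * powR (2^-1 ^+ i.+1) alpha)%:E * (2^-1 ^+ i * darea)%:E)%E).
    have cp : 0 <= c0 * powR (2^-1 ^+ i.+1) alpha by apply: mulr_ge0 => //; exact: powR_ge0.
    rewrite lee_wpmul2l ?lee_fin//.
    rewrite -leb2_annulus; last by rewrite exprn_gt0// exprn_ile1// ltW.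
    apply: le_measure; rewrite ?inE//.
      by apply: measurableD; exact: measurable_discr.
    move=> p /andP[p1 p2]; rewrite /discr /=; split; first by lra.
    by apply/negP; rewrite -leNgt; lra.
  rewrite -EFinM lee_fin le_eqVlt; apply/orP; left; apply/eqP.
  rewrite /M /q.
  have -> : powR (2^-1 ^+ i.+1) alpha = powR 2^-1 alpha * powR 2^-1 alpha ^+ i.
    rewrite -exprS; elim: (i.+1) => [|n IH]; first by rewrite !expr0 powR1.
    by rewrite !exprS powRM ?exprn_ge0 ?(ltW h20)// IH.
  rewrite powRD; last by apply/implyP => _; rewrite gt_eqF.
  by rewrite powRr1 ?ltW// exprMn; ring.
apply: (@le_lt_trans _ _ (M / (1 - q))%:E); last exact: ltry.
apply: lime_le.
  by apply: is_cvg_nneseries => n _ _; apply: integral_ge0 => p _; rewrite lee_fin wt_ge0.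
near=> n.
apply: (@le_trans _ _ (\sum_(0 <= i < n) (M * q ^+ i)%:E)%E).
  by apply: lee_sum => i _; exact: layer_le.
rewrite sumEFin lee_fin big_mkord -mulr_sumr ler_wpM2l//.
exact: sum_geo_le.
Unshelve. all: by end_near. Qed.

Lemma wt_int_fin : (\int[L2]_(p in discr 1) (wt p)%:E < +oo)%E.
Proof. by have [/wt_int_neg|/wt_int_pos] := ltP alpha 0. Qed.

End DiscMass.

(** * Integration of complex functions *)

Section ComplexIntegral.
Context d (T : measurableType d) (R : realType) (mu : {measure set T -> \bar R}).
Variable D : set T.
Hypothesis mD : measurable D.
Implicit Types (G H : T -> R[i]) (g : T -> R).

Definition cint G := mu.-integrable D (EFin \o (fun p => complex.Re (G p))) /\
  mu.-integrable D (EFin \o (fun p => complex.Im (G p))).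

Definition CI G : R[i] :=
  Complex (\int[mu]_(p in D) complex.Re (G p)) (\int[mu]_(p in D) complex.Im (G p)).

Definition cmeas G := measurable_fun D (fun p => complex.Re (G p)) /\
  measurable_fun D (fun p => complex.Im (G p)).

Lemma eq_integrableR (f g : T -> R) : {in D, f =1 g} ->
  mu.-integrable D (EFin \o f) -> mu.-integrable D (EFin \o g).
Proof. by move=> fg; apply: eq_integrable => // p pD /=; rewrite fg. Qed.

Lemma integrableDR (f g : T -> R) : mu.-integrable D (EFin \o f) ->
  mu.-integrable D (EFin \o g) -> mu.-integrable D (EFin \o (fun p => f p + g p)).
Proof.
move=> hf hg; by have := integrableD mD hf hg; apply: eq_integrable.
Qed.

Lemma integrableZR (k : R) (f : T -> R) : mu.-integrable D (EFin \o f) ->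
  mu.-integrable D (EFin \o (fun p => k * f p)).
Proof.
move=> hf; by have := integrableZl mD k hf; apply: eq_integrable.
Qed.

Lemma RintegralDR (f g : T -> R) : mu.-integrable D (EFin \o f) ->
  mu.-integrable D (EFin \o g) ->
  \int[mu]_(p in D) (f p + g p) = \int[mu]_(p in D) f p + \int[mu]_(p in D) g p.
Proof. by move=> hf hg; rewrite RintegralD. Qed.

Lemma eq_CI G H : {in D, G =1 H} -> CI G = CI H.
Proof. by move=> GH; congr Complex; apply: eq_Rintegral => p pD; rewrite GH. Qed.

Lemma eq_cint G H : {in D, G =1 H} -> cint G -> cint H.
Proof.
by move=> GH [h1 h2]; split; [move: h1|move: h2]; apply: eq_integrableR => p pD; rewrite GH.
Qed.

Lemma cintD G H : cint G -> cint H -> cint (fun p => G p + H p).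
Proof.
move=> [g1 g2] [h1 h2]; split.
  by apply: eq_integrableR (integrableDR g1 h1) => p _; rewrite ReD.
by apply: eq_integrableR (integrableDR g2 h2) => p _; rewrite ImD.
Qed.

Lemma CID G H : cint G -> cint H -> CI (fun p => G p + H p) = CI G + CI H.
Proof.
move=> [g1 g2] [h1 h2]; apply: complexP; rewrite ?ReD ?ImD /=.
  by rewrite -RintegralDR//; apply: eq_Rintegral => p _; rewrite ReD.
by rewrite -RintegralDR//; apply: eq_Rintegral => p _; rewrite ImD.
Qed.

Lemma cintZ k G : cint G -> cint (fun p => k * G p).
Proof.
move=> [g1 g2]; split.
  apply: eq_integrableR (integrableDR (integrableZR (complex.Re k) g1)
    (integrableZR (- complex.Im k) g2)) => p _; by rewrite ReM mulNr.
apply: eq_integrableR (integrableDR (integrableZR (complex.Re k) g2)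
    (integrableZR (complex.Im k) g1)) => p _; by rewrite ImM.
Qed.

Lemma CIZ k G : cint G -> CI (fun p => k * G p) = k * CI G.
Proof.
move=> [g1 g2]; apply: complexP; rewrite ?ReM ?ImM /=.
  rewrite -[- (complex.Im k * _)]mulNr -!RintegralZl//.
  rewrite -RintegralDR; [|exact: integrableZR|exact: integrableZR].
  by apply: eq_Rintegral => p _; rewrite ReM mulNr.
rewrite -!RintegralZl// -RintegralDR; [|exact: integrableZR|exact: integrableZR].
by apply: eq_Rintegral => p _; rewrite ImM.
Qed.

Lemma CIB G H : cint G -> cint H -> CI (fun p => G p - H p) = CI G - CI H.
Proof.
move=> hG hH; rewrite -[- CI H]mulN1r -CIZ// -CID//; last exact: cintZ.
by apply: eq_CI => p _; rewrite mulN1r.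
Qed.

Lemma cint0 : cint (fun=> 0).
Proof. by split; exact: integrable0. Qed.

Lemma CI0 : CI (fun=> 0) = 0.
Proof. by rewrite /CI /= Rintegral_cst// !mul0r. Qed.

Lemma cint_sum N (G : nat -> T -> R[i]) : (forall n, cint (G n)) ->
  cint (fun p => \sum_(n < N) G n p).
Proof.
move=> hG; elim: N => [|N IH].
  by apply: eq_cint cint0 => p _; rewrite big_ord0.
by apply: eq_cint (cintD IH (hG N)) => p _; rewrite big_ord_recr.
Qed.

Lemma CI_sum N (G : nat -> T -> R[i]) : (forall n, cint (G n)) ->
  CI (fun p => \sum_(n < N) G n p) = \sum_(n < N) CI (G n).
Proof.
move=> hG; elim: N => [|N IH].
  by rewrite big_ord0 -[RHS]CI0; apply: eq_CI => p _; rewrite big_ord0.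
rewrite big_ord_recr /= -IH -CID//; last exact: cint_sum.
by apply: eq_CI => p _; rewrite big_ord_recr.
Qed.

Lemma CIJ G : cint G -> CI (fun p => conjc (G p)) = conjc (CI G).
Proof.
move=> [h1 h2]; apply: complexP; rewrite ?ReJ ?ImJ /=.
  by apply: eq_Rintegral => p _; rewrite ReJ.
by rewrite -mulN1r -RintegralZl//; apply: eq_Rintegral => p _; rewrite ImJ mulN1r.
Qed.

Lemma integrable_dom (f g : T -> R) : measurable_fun D f ->
  mu.-integrable D (EFin \o g) -> (forall p, D p -> `|f p| <= g p) ->
  mu.-integrable D (EFin \o f).
Proof.
move=> mf ig fg; apply: (le_integrable mD _ _ ig); first exact/measurable_EFinP.
move=> p Dp; rewrite /= lee_fin; apply: le_trans (fg p Dp) _; exact: ler_norm.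
Qed.

Lemma cint_dom G g : cmeas G -> mu.-integrable D (EFin \o g) ->
  (forall p, D p -> cabs (G p) <= g p) -> cint G.
Proof.
move=> [m1 m2] ig Gg; split; apply: integrable_dom ig _ => // p Dp.
  exact: le_trans (abs_Re_le _) (Gg p Dp).
exact: le_trans (abs_Im_le _) (Gg p Dp).
Qed.

(** Both parts are bounded by the integral of g separately, hence the factor 2. *)
Lemma CI_le G g : cint G -> mu.-integrable D (EFin \o g) ->
  (forall p, D p -> cabs (G p) <= g p) -> cabs (CI G) <= 2 * \int[mu]_(p in D) g p.
Proof.
move=> [h1 h2] ig Gg; apply: le_trans (cabs_le _) _; rewrite mulrDl mul1r /=.
have main (f : T -> R) : mu.-integrable D (EFin \o f) -> (forall p, D p -> `|f p| <= g p) ->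
    `|\int[mu]_(p in D) f p| <= \int[mu]_(p in D) g p.
  move=> hf fg; apply: le_trans (le_normr_Rintegral mD hf) _.
  apply: le_Rintegral => //.
  exact: integrable_norm.
apply: lerD; apply: main => // p Dp.
  exact: le_trans (abs_Re_le _) (Gg p Dp).
exact: le_trans (abs_Im_le _) (Gg p Dp).
Qed.

Lemma cmeasD G H : cmeas G -> cmeas H -> cmeas (fun p => G p + H p).
Proof.
move=> [g1 g2] [h1 h2]; split.
  under eq_fun do rewrite ReD; exact: measurable_funD.
under eq_fun do rewrite ImD; exact: measurable_funD.
Qed.

Lemma cmeasM G H : cmeas G -> cmeas H -> cmeas (fun p => G p * H p).
Proof.
move=> [g1 g2] [h1 h2]; split.
  by under eq_fun do rewrite ReM; apply: measurable_funB; exact: measurable_funM.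
by under eq_fun do rewrite ImM; apply: measurable_funD; exact: measurable_funM.
Qed.

Lemma cmeas_cst k : cmeas (fun=> k).
Proof. by split. Qed.

Lemma cmeas_real g : measurable_fun D g -> cmeas (fun p => ((g p)%:C)%C).
Proof. by move=> mg; split => //=. Qed.

Lemma cmeasJ G : cmeas G -> cmeas (fun p => conjc (G p)).
Proof.
move=> [g1 g2]; split; first by under eq_fun do rewrite ReJ.
by under eq_fun do rewrite ImJ; exact: measurable_funN.
Qed.

Lemma cmeasB G H : cmeas G -> cmeas H -> cmeas (fun p => G p - H p).
Proof.
move=> hG hH; under eq_fun do rewrite -mulN1r.
by apply: cmeasD => //; apply: cmeasM => //; exact: cmeas_cst.
Qed.

Lemma cmeasX G n : cmeas G -> cmeas (fun p => G p ^+ n).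
Proof.
move=> hG; elim: n => [|n IH].
  by under eq_fun do rewrite expr0; exact: cmeas_cst.
by under eq_fun do rewrite exprS; exact: cmeasM.
Qed.

Lemma cmeas_sum N (G : nat -> T -> R[i]) : (forall n, cmeas (G n)) ->
  cmeas (fun p => \sum_(n < N) G n p).
Proof.
move=> hG; elim: N => [|N IH].
  by under eq_fun do rewrite big_ord0; exact: cmeas_cst.
by under eq_fun do rewrite big_ord_recr; exact: cmeasD.
Qed.

Lemma cmeas_cvg (G : nat -> T -> R[i]) H : (forall n, cmeas (G n)) ->
  (forall p, D p -> ccvg (G^~ p) (H p)) -> cmeas H.
Proof.
move=> mG GH; split.
  apply: (measurable_fun_cvg (h := fun n p => complex.Re (G n p))) => [n|p Dp].
    by case: (mG n).
  by have /ccvgP[] := GH p Dp.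
apply: (measurable_fun_cvg (h := fun n p => complex.Im (G n p))) => [n|p Dp].
  by case: (mG n).
by have /ccvgP[] := GH p Dp.
Qed.

Lemma cmeas_abs2 G : cmeas G -> measurable_fun D (fun p => cabs (G p) ^+ 2).
Proof.
move=> [g1 g2]; under eq_fun do rewrite cabs_sqr.
by apply: measurable_funD; exact: measurable_funX.
Qed.

Lemma eq_cmeas G H : {in D, G =1 H} -> cmeas G -> cmeas H.
Proof.
move=> GH [g1 g2]; split; [move: g1|move: g2]; apply: eq_measurable_fun => p pD;
  by rewrite GH.
Qed.

End ComplexIntegral.

(** * Integrals as limits over an exhaustion *)

Section Exhaustion.
Context d (T : measurableType d) (R : realType) (mu : {measure set T -> \bar R}).
Variables (D : set T) (E : nat -> set T).
Hypothesis mD : measurable D.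
Hypothesis mE : forall n, measurable (E n).
Hypothesis ED : forall n, E n `<=` D.
Hypothesis EE : forall p, D p -> exists N, forall n, (N <= n)%N -> E n p.

(** Dominated convergence for f cut off to E n, with the absolute value of f as the dominating
    function. *)
Lemma Rintegral_exhaust (f : T -> R) : mu.-integrable D (EFin \o f) ->
  (fun n => \int[mu]_(p in E n) f p) @ \oo --> \int[mu]_(p in D) f p.
Proof.
move=> intf; have mf : measurable_fun D f.
  by apply/measurable_EFinP; exact: measurable_int intf.
pose fn n p := ((f \_ (E n)) p)%:E.
have fnE n p : D p -> fn n p = ((EFin \o f) \_ (E n)) p.
  by move=> _; rewrite /fn /patch; case: ifP.
have mfn n : measurable_fun D (fn n).
  apply: (eq_measurable_fun (((EFin \o f) \_ (E n)))).
    by move=> p /set_mem Dp; rewrite fnE.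
  apply: measurable_funTS; apply/(measurable_restrictT _ _).1 => //.
  by apply: measurable_funS (measurable_int _ intf) => //; exact: ED.
have H1 : {ae mu, forall x, D x -> fn ^~ x @ \oo --> (EFin \o f) x}.
  apply: aeW => p Dp; have [N HN] := EE Dp.
  apply: cvg_near_cst; exists N => // n /= /HN En.
  by rewrite /fn /patch mem_set.
have H2 : {ae mu, forall x n, D x -> (`|fn n x| <= (abse \o (EFin \o f)) x)%E}.
  apply: aeW => p n Dp; rewrite /fn /patch /=; case: ifP => //.
  by rewrite normr0 lee_fin.
have [_ _ h] := @dominated_convergence _ _ _ mu D mD fn (EFin \o f) (abse \o (EFin \o f)) mfn
  (measurable_int _ intf) H1 (integrable_abse intf) H2.
have eqn n : (\int[mu]_(p in E n) f p)%:E = (\int[mu]_(p in D) fn n p)%E.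
  rewrite /Rintegral fineK; last first.
    apply: integrable_fin_num => //; apply: (integrableS mD) => //; exact: ED.
  rewrite -{1}(setIidr (@ED n)) integral_mkcondr; apply: eq_integral => p _.
  by rewrite /fn /patch; case: ifP.
have : (fun n => (\int[mu]_(p in E n) f p)%:E) @ \oo --> (\int[mu]_(p in D) f p)%:E.
  rewrite (_ : (\int[mu]_(p in D) f p)%:E = (\int[mu]_(p in D) (EFin \o f) p)%E); last first.
    by rewrite /Rintegral fineK//; exact: integrable_fin_num.
  by under eq_fun do rewrite eqn.
by move/fine_cvgP => [_]; apply: cvg_trans; apply: near_eq_cvg; near=> n.
Unshelve. all: by end_near. Qed.

Lemma CI_exhaust G : cint mu D G -> ccvg (fun n => CI mu (E n) G) (CI mu D G).
Proof.
by move=> [h1 h2]; apply/ccvgP; split; exact: Rintegral_exhaust.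
Qed.

End Exhaustion.

(** * Weighted pairings of monomials and power series *)

Section WeightedPairing.
Context {R : realType}.
Variable alpha : R.
Hypothesis alpha_gt : -1 < alpha.
Local Notation L2 := (@leb2 R).
Local Notation w := (wt alpha).
Local Notation wC p := ((w p)%:C)%C.
Implicit Types (r : R) (G H : plane R -> R[i]) (p : plane R) (a b : nat -> R[i]).

Lemma ReZ (k : R) (z : R[i]) : complex.Re ((k%:C)%C * z) = k * complex.Re z.
Proof. by rewrite ReM /= mul0r subr0. Qed.

Lemma ImZ (k : R) (z : R[i]) : complex.Im ((k%:C)%C * z) = k * complex.Im z.
Proof. by rewrite ImM /= mul0r addr0. Qed.

Lemma cabs_toC p : cabs (toC p) ^+ 2 = nsq p.
Proof. by rewrite cabs_sqr. Qed.

Lemma discr_sub r : r <= 1 -> discr r `<=` discr 1.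
Proof. by move=> r1 p; rewrite /discr /= => /lt_le_trans; apply. Qed.

Lemma integrable_w r : r <= 1 -> L2.-integrable (discr r) (EFin \o w).
Proof.
move=> r1; apply: (integrableS (measurable_discr 1) (measurable_discr r) (discr_sub r1)).
apply/integrableP; split; first by apply/measurable_EFinP; exact: measurable_wt.
apply: le_lt_trans (wt_int_fin alpha_gt); apply: ge0_le_integral => //.
- exact: measurable_discr.
- apply: measurableT_comp => //; apply/measurable_EFinP; exact: measurable_wt.
- by apply/measurable_EFinP; exact: measurable_wt.
by move=> p _ /=; rewrite lee_fin ger0_norm ?wt_ge0.
Qed.

Definition wmass : R := \int[L2]_(p in discr 1) w p.

Lemma wmass_ge r : r <= 1 -> \int[L2]_(p in discr r) w p <= wmass.
Proof.
move=> r1; rewrite /wmass /Rintegral fine_le//.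
- by apply: integrable_fin_num; [exact: measurable_discr|exact: integrable_w].
- by apply: integrable_fin_num; [exact: measurable_discr|exact: integrable_w].
apply: ge0_subset_integral => //; [exact: measurable_discr|exact: measurable_discr| | |].
- by apply/measurable_EFinP; exact: measurable_wt.
- by move=> p _; rewrite lee_fin wt_ge0.
- exact: discr_sub.
Qed.

Lemma wmass_ge0 : 0 <= wmass.
Proof. by apply: Rintegral_ge0 => p _; exact: wt_ge0. Qed.

Lemma cmeas_w (D : set (plane R)) : cmeas D (fun p => wC p).
Proof. by apply: cmeas_real; exact: measurable_wt. Qed.

Lemma cmeas_toC (D : set (plane R)) : cmeas D (fun p => toC p).
Proof. by split; [exact: measurable_fstR|exact: measurable_sndR]. Qed.

Lemma cabs_w p : cabs (wC p) = w p.
Proof. by rewrite cabsR ger0_norm// wt_ge0. Qed.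

Lemma cint_bdd r G (M : R) : r <= 1 -> cmeas (discr r) G ->
  (forall p, discr r p -> cabs (G p) <= M) -> cint L2 (discr r) (fun p => wC p * G p).
Proof.
move=> r1 mG GM; apply: (@cint_dom _ _ _ _ _ (measurable_discr r) _ (fun p => M * w p)).
- by apply: cmeasM => //; exact: cmeas_w.
- exact: integrableZR (measurable_discr r) _ _ (integrable_w r1).
- by move=> p Dp; rewrite cabsM cabs_w mulrC ler_wpM2r ?wt_ge0 ?GM.
Qed.

Lemma CI_w_le r G (M : R) : r <= 1 -> cmeas (discr r) G -> 0 <= M ->
  (forall p, discr r p -> cabs (G p) <= M) ->
  cabs (CI L2 (discr r) (fun p => wC p * G p)) <= 2 * (M * wmass).
Proof.
move=> r1 mG M0 GM.
apply: le_trans (CI_le (measurable_discr r) (cint_bdd r1 mG GM) (g := fun p => M * w p) _ _) _.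
- exact: integrableZR (measurable_discr r) _ _ (integrable_w r1).
- by move=> p Dp; rewrite cabsM cabs_w mulrC ler_wpM2r ?wt_ge0 ?GM.
rewrite RintegralZl; [|exact: measurable_discr|exact: integrable_w].
by rewrite ler_wpM2l// ler_wpM2l// wmass_ge.
Qed.

Lemma CI_w_unif r (G : nat -> plane R -> R[i]) H : r <= 1 ->
  (forall n, cmeas (discr r) (G n)) -> cmeas (discr r) H ->
  (forall n, exists M, forall p, discr r p -> cabs (G n p) <= M) ->
  (exists M, forall p, discr r p -> cabs (H p) <= M) ->
  (forall e, 0 < e -> exists N, forall n, (N <= n)%N -> forall p, discr r p ->
    cabs (G n p - H p) <= e) ->
  ccvg (fun n => CI L2 (discr r) (fun p => wC p * G n p))
       (CI L2 (discr r) (fun p => wC p * H p)).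
Proof.
move=> r1 mG mH bG [MH bH] GH e e0.
have K0 : 0 < 2 * wmass + 1 by rewrite ltr_wpDl// mulr_ge0// wmass_ge0.
have [N HN] := GH _ (divr_gt0 e0 K0).
exists N => n /HN h; have [M bM] := bG n.
rewrite -CIB; [|exact: measurable_discr|exact: cint_bdd bM|exact: cint_bdd bH].
rewrite (@eq_CI _ _ _ _ _ _ (fun p => wC p * (G n p - H p))); last first.
  by move=> p _; rewrite mulrBr.
apply: le_lt_trans (CI_w_le r1 _ _ h) _.
- exact: cmeasB.
- by rewrite divr_ge0// ltW.
rewrite mulrCA mulrAC ltr_pdivrMr// ltr_pM2l// ltrDl//.
Qed.

Definition rot (t : R) (p : plane R) : plane R :=
  (cos (2 * pi * t) * p.1 - sin (2 * pi * t) * p.2,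
   sin (2 * pi * t) * p.1 + cos (2 * pi * t) * p.2).

Lemma toC_rot t p : toC (rot t p) = ce t * toC p.
Proof. by apply: complexP; rewrite !ReImE /=; ring. Qed.

Lemma nsq_rot t p : nsq (rot t p) = nsq p.
Proof. by rewrite -!cabs_toC toC_rot cabsM cabs_ce mul1r. Qed.

Lemma CI_rot r t G : 0 < 1 + cos (2 * pi * t) ->
  cmeas (discr r) G -> CI L2 (discr r) (fun p => G (rot t p)) = CI L2 (discr r) G.
Proof.
move=> ct [m1 m2].
have mp : mpres (rot t) by apply: mpres_rot ct; exact: cos2Dsin2.
have pD : rot t @^-1` discr r = discr r.
  by apply/seteqP; split => p; rewrite /discr /= nsq_rot.
congr Complex; rewrite /Rintegral; congr fine.
  rewrite -(mpres_integral mp (measurable_discr r) pD (g := fun p => (complex.Re (G p))%:E))//.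
  exact/measurable_EFinP.
rewrite -(mpres_integral mp (measurable_discr r) pD (g := fun p => (complex.Im (G p))%:E))//.
exact/measurable_EFinP.
Qed.

Lemma cabs_toC_le1 r p : r <= 1 -> discr r p -> cabs (toC p) <= 1.
Proof.
move=> r1 /(discr_sub r1); rewrite /discr /= => h.
by rewrite -(ler_pXn2r (ltn0Sn 1)) ?nnegrE ?cabs_ge0// expr1n cabs_toC ltW.
Qed.

Lemma cmeas_mono (D : set (plane R)) n m :
  cmeas D (fun p => toC p ^+ n * conjc (toC p) ^+ m).
Proof. by apply: cmeasM; apply: cmeasX; [|apply: cmeasJ]; exact: cmeas_toC. Qed.

Lemma mono_le1 r n m p : r <= 1 -> discr r p ->
  cabs (toC p ^+ n * conjc (toC p) ^+ m) <= 1.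
Proof.
move=> r1 Dp; rewrite cabsM !cabsX cabsJ -exprD exprn_ile1 ?cabs_ge0//.
exact: cabs_toC_le1 r1 Dp.
Qed.

(* Rotating by [t] with [4 (k + 1) t = 1] multiplies the integrand by the imaginary unit. *)
Lemma mono_orth_lt r m k : r <= 1 ->
  CI L2 (discr r) (fun p => wC p * (toC p ^+ (m + k.+1) * conjc (toC p) ^+ m)) = 0.
Proof.
move=> r1; set I := CI _ _ _.
pose t : R := (4 * k.+1%:R)^-1.
have k0 : 0 < 4 * k.+1%:R :> R by rewrite mulr_gt0// ltr0n.
have t0 : 0 < t by rewrite invr_gt0.
have kt : k.+1%:R * t = 4^-1.
  by rewrite /t invfM mulrCA divff ?mulr1// pnatr_eq0.
have pi0 := pi_gt0 R.
have t4 : t <= 4^-1.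
  by rewrite -kt ler_peMl ?(ltW t0)// ler1n.
have ct : 0 < 1 + cos (2 * pi * t).
  rewrite ltr_wpDr//; apply: cos_ge0_pihalf; apply/andP; split; nra.
have E : I = Complex 0 1 * I.
  rewrite -[LHS](CI_rot ct); last first.
    by apply: cmeasM; [exact: cmeas_w|exact: cmeas_mono].
  rewrite -CIZ; [|exact: measurable_discr|].
    apply: eq_CI => p _; rewrite toC_rot conjcM.
    have -> : w (rot t p) = w p by rewrite /wt /wA -/(nsq _) nsq_rot.
    have -> : (ce t * toC p) ^+ (m + k.+1) * (conjc (ce t) * conjc (toC p)) ^+ m =
      ((ce t * conjc (ce t)) ^+ m * ce t ^+ k.+1) * (toC p ^+ (m + k.+1) * conjc (toC p) ^+ m).
      by rewrite !exprMn !exprD; ring.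
    rewrite mulcJ cabs_ce expr1n expr1n mul1r ceX kt.
    have -> : ce 4^-1 = Complex 0 1 :> R[i].
      rewrite /ce (_ : 2 * pi * 4^-1 = pi / 2); last by field.
      by rewrite cos_pihalf sin_pihalf.
    ring.
  apply: (cint_bdd r1 (M := 1)); first exact: cmeas_mono.
  by move=> p; exact: mono_le1.
apply/eqP; have : (1 - Complex 0 1) * I == 0 by rewrite mulrBl mul1r -E subrr.
rewrite mulf_eq0 => /orP[/eqP/(congr1 (@complex.Re R))|//] /= /eqP.
by rewrite subr0 oner_eq0.
Qed.

(** The squared norm of the monomial of degree n over [discr r]; these moments turn pairings of
    power series into sums of coefficients. *)
Definition gam r n : R := \int[L2]_(p in discr r) (w p * nsq p ^+ n).

Lemma mono_pair r n m : r <= 1 ->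
  CI L2 (discr r) (fun p => wC p * (toC p ^+ n * conjc (toC p) ^+ m)) =
  if n == m then ((gam r n)%:C)%C else 0.
Proof.
move=> r1; have [->|] := eqVneq n m.
  apply: complexP => /=.
    apply: eq_Rintegral => p _; rewrite ReZ -exprMn mulcJ cabs_toC.
    by rewrite -(rmorphXn (real_complex R)).
  rewrite (@eq_Rintegral _ _ _ _ _ (fun=> 0)); last first.
    move=> p _; rewrite ImZ -exprMn mulcJ cabs_toC.
    by rewrite -(rmorphXn (real_complex R)) /= mulr0.
  by rewrite Rintegral_cst ?mul0r//; exact: measurable_discr.
rewrite neq_ltn => /orP[nm|mn].
  rewrite (_ : m = n + (m - n).-1.+1)%N; last by rewrite prednK ?subn_gt0// subnKC// ltnW.
  have := mono_orth_lt n (m - n).-1 r1.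
  move=> /(congr1 conjc); rewrite (_ : conjc 0 = 0); last by apply: complexP; rewrite //= oppr0.
  rewrite -CIJ => [h|//|]; last first.
  - apply: (cint_bdd r1 (M := 1)); first exact: cmeas_mono.
    by move=> p; exact: mono_le1.
  - exact: measurable_discr.
  rewrite -h; apply: eq_CI => p _; rewrite !conjcM conjc_real !conjcX.
  rewrite (_ : conjc (conjc (toC p)) = toC p) 1?[_ ^+ n * _]mulrC//.
  by apply: complexP; rewrite /= ?opprK.
rewrite (_ : n = m + (n - m).-1.+1)%N; last by rewrite prednK ?subn_gt0// subnKC// ltnW.
exact: mono_orth_lt.
Qed.

Lemma integrable_gam n r : r <= 1 -> L2.-integrable (discr r) (EFin \o (fun p => w p * nsq p ^+ n)).
Proof.
move=> r1; apply: (integrable_dom (measurable_discr r) _ (integrable_w r1)).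
  by apply: measurable_funM; [exact: measurable_wt|apply: measurable_funX; exact: measurable_nsq].
move=> p Dp; have n0 := nsq_ge0 p.
have h : 0 <= w p * nsq p ^+ n by rewrite mulr_ge0 ?wt_ge0// exprn_ge0.
rewrite ger0_norm// ler_piMr ?wt_ge0// exprn_ile1//.
by have := discr_sub r1 Dp; rewrite /discr /=; exact: ltW.
Qed.

Lemma gam_ge0 r n : 0 <= gam r n.
Proof. by apply: Rintegral_ge0 => p _; rewrite mulr_ge0 ?wt_ge0 ?exprn_ge0 ?nsq_ge0. Qed.

Lemma Rintegral_subset r s (f : plane R -> R) : r <= s -> (forall p, 0 <= f p) ->
  L2.-integrable (discr s) (EFin \o f) ->
  \int[L2]_(p in discr r) f p <= \int[L2]_(p in discr s) f p.
Proof.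
move=> rs f0 intf; have sub : discr r `<=` discr s.
  by move=> p; rewrite /discr /= => /lt_le_trans; apply.
have intf' := integrableS (measurable_discr s) (measurable_discr r) sub intf.
rewrite /Rintegral fine_le//.
- by apply: integrable_fin_num => //; exact: measurable_discr.
- by apply: integrable_fin_num => //; exact: measurable_discr.
apply: ge0_subset_integral => //; [exact: measurable_discr|exact: measurable_discr| |].
  exact: (measurable_int _ intf).
by move=> p _; rewrite lee_fin.
Qed.

Lemma gam_le r n : r <= 1 -> gam r n <= gam 1 n.
Proof.
move=> r1; apply: Rintegral_subset => //; last exact: integrable_gam.
by move=> p; rewrite mulr_ge0 ?wt_ge0 ?exprn_ge0 ?nsq_ge0.
Qed.

(** Squared radii increasing to 1. On each of these discs power series converge uniformly, which may
    fail up to the unit circle. *)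
Definition rad (n : nat) : R := 1 - n.+1%:R^-1.

Lemma rad_lt1 n : rad n < 1.
Proof. by rewrite /rad gtrBl invr_gt0 ltr0n. Qed.

Lemma rad_exhaust p : discr 1 p -> exists N, forall n, (N <= n)%N -> discr (rad n) p.
Proof.
rewrite /discr /= -subr_gt0 => h.
exists (Num.truncn (1 - nsq p)^-1) => n Nn; rewrite /rad ltrBrDl -ltrBrDr.
rewrite -[ltRHS]invrK ltf_pV2 ?posrE ?invr_gt0//.
have := truncnS_gt (1 - nsq p)^-1; move=> /lt_le_trans; apply.
by rewrite ler_nat ltnS.
Qed.

Lemma Rint_rad (f : plane R -> R) : L2.-integrable (discr 1) (EFin \o f) ->
  (fun n => \int[L2]_(p in discr (rad n)) f p) @ \oo --> \int[L2]_(p in discr 1) f p.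
Proof.
move=> intf; apply: Rintegral_exhaust => //.
- exact: measurable_discr.
- by move=> n; exact: measurable_discr.
- by move=> n; apply: discr_sub; apply: ltW; exact: rad_lt1.
- exact: rad_exhaust.
Qed.

Lemma CI_rad G : cint L2 (discr 1) G ->
  ccvg (fun n => CI L2 (discr (rad n)) G) (CI L2 (discr 1) G).
Proof.
move=> hG; apply: CI_exhaust => //.
- exact: measurable_discr.
- by move=> n; exact: measurable_discr.
- by move=> n; apply: discr_sub; apply: ltW; exact: rad_lt1.
- exact: rad_exhaust.
Qed.

Definition ps a p : R[i] := psum a (toC p).

Lemma toC_lt1 p : discr 1 p -> cabs (toC p) < 1.
Proof.
rewrite /discr /= => h.
by rewrite -(ltr_pXn2r (ltn0Sn 1)) ?nnegrE ?cabs_ge0// expr1n cabs_toC.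
Qed.

Lemma cmeas_ps a r : rad1 a -> r <= 1 -> cmeas (discr r) (ps a).
Proof.
move=> ra r1.
apply: (@cmeas_cvg _ _ _ _ (fun N p => \sum_(n < N) a n * toC p ^+ n)).
  move=> N; apply: (@cmeas_sum _ _ _ _ _ (fun n p => a n * toC p ^+ n)) => n.
  by apply: cmeasM; [exact: cmeas_cst|apply: cmeasX; exact: cmeas_toC].
by move=> p /(discr_sub r1)/toC_lt1 h; exact: psum_cvg.
Qed.

Lemma ps_unif a r e : rad1 a -> r < 1 -> 0 < e -> exists N, forall n, (N <= n)%N ->
  forall p, discr r p -> cabs (ps a p - \sum_(k < n) a k * toC p ^+ k) <= e.
Proof.
move=> ra r1 e0; have s01 : 0 <= Num.sqrt r < 1.
  by rewrite sqrtr_ge0 -sqrtr1 ltr_sqrt.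
have [N HN] := psum_unif ra s01 e0.
exists N => n /HN h p Dp; apply: ltW; apply: h.
have /ltW rp : nsq p < r by [].
exact: ler_wsqrtr.
Qed.

Lemma ps_bdd a r : rad1 a -> r < 1 -> exists2 M, 0 <= M &
  forall p, discr r p -> cabs (ps a p) <= M.
Proof.
move=> ra r1; have [N /(_ N (leqnn _)) HN] := ps_unif ra r1 ltr01.
exists (1 + \sum_(k < N) cabs (a k)); first by rewrite addr_ge0// sumr_ge0// => i _; exact: cabs_ge0.
move=> p Dp; have := cabsD (ps a p - \sum_(k < N) a k * toC p ^+ k) (\sum_(k < N) a k * toC p ^+ k).
rewrite subrK => /le_trans; apply; apply: lerD; first exact: HN.
apply: le_trans (cabs_sum _ _ _) _; apply: ler_sum => i _.
rewrite cabsM cabsX ler_piMr ?cabs_ge0// exprn_ile1 ?cabs_ge0//.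
by apply: cabs_toC_le1 Dp; exact: ltW.
Qed.

Lemma ps_partial_bdd a r n : r <= 1 -> forall p, discr r p ->
  cabs (\sum_(k < n) a k * toC p ^+ k) <= \sum_(k < n) cabs (a k).
Proof.
move=> r1 p Dp; apply: le_trans (cabs_sum _ _ _) _; apply: ler_sum => i _.
rewrite cabsM cabsX ler_piMr ?cabs_ge0// exprn_ile1 ?cabs_ge0//.
exact: cabs_toC_le1 Dp.
Qed.

Lemma cmeas_partial (D : set (plane R)) a n : cmeas D (fun p => \sum_(k < n) a k * toC p ^+ k).
Proof.
apply: (@cmeas_sum _ _ _ _ _ (fun k p => a k * toC p ^+ k)) => k.
by apply: cmeasM; [exact: cmeas_cst|apply: cmeasX; exact: cmeas_toC].
Qed.

(** Uniform convergence on the smaller disc allows termwise integration, and orthogonality keeps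
    only degree m. *)
Lemma pair_mono a r m : rad1 a -> r < 1 ->
  CI L2 (discr r) (fun p => wC p * (ps a p * conjc (toC p) ^+ m)) = a m * ((gam r m)%:C)%C.
Proof.
move=> ra r1; have r1' := ltW r1; have [Ma Ma0 HMa] := ps_bdd ra r1.
have mz D : cmeas D (fun p => conjc (toC p) ^+ m) by apply: cmeasX; apply: cmeasJ; exact: cmeas_toC.
have zle p : discr r p -> cabs (conjc (toC p) ^+ m) <= 1.
  by move=> Dp; have := mono_le1 0 m r1' Dp; rewrite expr0 mul1r.
have H : ccvg (fun N => CI L2 (discr r)
   (fun p => wC p * ((\sum_(k < N) a k * toC p ^+ k) * conjc (toC p) ^+ m)))
   (CI L2 (discr r) (fun p => wC p * (ps a p * conjc (toC p) ^+ m))).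
  apply: CI_w_unif => //.
  - by move=> n; apply: cmeasM => //; exact: cmeas_partial.
  - by apply: cmeasM => //; exact: cmeas_ps.
  - move=> n; exists (\sum_(k < n) cabs (a k)) => p Dp; rewrite cabsM.
    by rewrite -[leRHS]mulr1 ler_pM ?cabs_ge0 ?zle//; exact: ps_partial_bdd Dp.
  - exists Ma => p Dp; rewrite cabsM.
    by rewrite -[leRHS]mulr1 ler_pM ?cabs_ge0 ?zle ?HMa.
  move=> e e0; have [N HN] := ps_unif ra r1 e0; exists N => n /HN h p Dp.
  rewrite -mulrBl cabsM cabsC -[leRHS]mulr1 ler_pM ?cabs_ge0 ?zle//; exact: h.
(* From m + 1 terms on, the truncated integrals no longer change. *)
apply: (ccvg_unique H) => e e0; exists m.+1 => n mn.
suff -> : CI L2 (discr r) (fun p => wC p * ((\sum_(k < n) a k * toC p ^+ k) * conjc (toC p) ^+ m))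
  = a m * ((gam r m)%:C)%C by rewrite subrr cabs0.
pose Gk k p := a k * (wC p * (toC p ^+ k * conjc (toC p) ^+ m)).
have ik k : cint L2 (discr r) (fun p => wC p * (toC p ^+ k * conjc (toC p) ^+ m)).
  apply: (cint_bdd r1' (M := 1)); first exact: cmeas_mono.
  by move=> p; exact: mono_le1.
rewrite (@eq_CI _ _ _ _ _ _ (fun p => \sum_(k < n) Gk k p)); last first.
  by move=> p _; rewrite mulr_suml mulr_sumr; apply: eq_bigr => k _; rewrite /Gk; ring.
rewrite CI_sum; last first.
- by move=> k; apply: cintZ (ik k); exact: measurable_discr.
- exact: measurable_discr.
rewrite (bigD1 (Ordinal mn)) //= big1 ?addr0.
  by rewrite CIZ ?mono_pair ?eqxx//; exact: measurable_discr.
move=> i im; rewrite CIZ ?mono_pair//; last exact: measurable_discr.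
by move: im; rewrite -val_eqE /= => /negbTE ->; rewrite mulr0.
Qed.

(** Only b is truncated; [pair_mono] evaluates a against each monomial, so that a single sum
    remains. *)
Lemma pair_ps a b r : rad1 a -> rad1 b -> r < 1 ->
  ccvg (fun N => \sum_(m < N) a m * conjc (b m) * ((gam r m)%:C)%C)
    (CI L2 (discr r) (fun p => wC p * (ps a p * conjc (ps b p)))).
Proof.
move=> ra rb r1; have r1' := ltW r1.
have [Ma Ma0 HMa] := ps_bdd ra r1; have [Mb Mb0 HMb] := ps_bdd rb r1.
have H : ccvg (fun N => CI L2 (discr r)
   (fun p => wC p * (ps a p * conjc (\sum_(k < N) b k * toC p ^+ k))))
   (CI L2 (discr r) (fun p => wC p * (ps a p * conjc (ps b p)))).
  apply: CI_w_unif => //.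
  - by move=> n; apply: cmeasM; [exact: cmeas_ps|apply: cmeasJ; exact: cmeas_partial].
  - by apply: cmeasM; [exact: cmeas_ps|apply: cmeasJ; exact: cmeas_ps].
  - move=> n; exists (Ma * \sum_(k < n) cabs (b k)) => p Dp; rewrite cabsM cabsJ.
    by rewrite ler_pM ?cabs_ge0 ?HMa//; exact: ps_partial_bdd Dp.
  - exists (Ma * Mb) => p Dp; rewrite cabsM cabsJ.
    by apply: ler_pM; rewrite ?cabs_ge0//; [exact: HMa|exact: HMb].
  move=> e e0; have M1 : 0 < Ma + 1 by rewrite ltr_wpDl.
  have [N HN] := ps_unif rb r1 (divr_gt0 e0 M1); exists N => n /HN h p Dp.
  rewrite -mulrBr cabsM -conjcN -conjcD cabsJ cabsC.
  apply: (@le_trans _ _ ((Ma + 1) * (e / (Ma + 1)))); last by rewrite mulrC divfK// gt_eqF.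
  by rewrite ler_pM ?cabs_ge0 ?h//; apply: le_trans (HMa _ Dp) _; rewrite lerDl.
apply: ccvg_ext H => N.
have ik k : cint L2 (discr r) (fun p => wC p * (ps a p * conjc (toC p) ^+ k)).
  apply: (cint_bdd r1' (M := Ma)).
    by apply: cmeasM; [exact: cmeas_ps|apply: cmeasX; apply: cmeasJ; exact: cmeas_toC].
  move=> p Dp; rewrite cabsM -[leRHS]mulr1 ler_pM ?cabs_ge0 ?HMa//.
  by have := mono_le1 0 k r1' Dp; rewrite expr0 mul1r.
rewrite (@eq_CI _ _ _ _ _ _ (fun p => \sum_(k < N) conjc (b k) * (wC p * (ps a p * conjc (toC p) ^+ k)))); last first.
  move=> p _; rewrite conjc_sum mulr_sumr mulr_sumr; apply: eq_bigr => k _.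
  by rewrite conjcM conjcX; ring.
rewrite (@CI_sum _ _ _ _ _ (measurable_discr r) N (fun k p => conjc (b k) * (wC p * (ps a p * conjc (toC p) ^+ k)))); last first.
  by move=> k; apply: cintZ (ik k); exact: measurable_discr.
apply: eq_bigr => k _; rewrite CIZ ?pair_mono//; last exact: measurable_discr.
by ring.
Qed.

End WeightedPairing.

(** * Holomorphic functions of the plane as power series *)

Section HolomorphicPowerSeries.
Context {R : realType}.
Implicit Types (f : R * R -> R[i]) (a : nat -> R[i]).

Lemma toCK : cancel (@toC R) ofC.
Proof. by case. Qed.

Lemma ofCK : cancel (@ofC R) toC.
Proof. by case. Qed.

Lemma toC_eq0 (h : R * R) : (toC h == 0) = (h == 0).
Proof. by case: h => x y; rewrite /toC eq_complex /= xpair_eqE. Qed.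

Lemma holomorphic_cdiff f (w : R[i]) : holomorphic_on disc f -> cabs w < 1 ->
  exists l, cdiff (fun z => f (ofC z)) w l.
Proof.
move=> hf w1; have Dw : disc (ofC w).
  rewrite /disc /= -cabs_sqr -[ltRHS](expr1n _ 2).
  by rewrite ltr_pXn2r ?nnegrE ?cabs_ge0.
have [l hl] := hf _ Dw; exists l => e e0; have [d d0 hd] := hl e e0.
exists d => // h hh; have [->|h0] := eqVneq h 0.
  by rewrite addr0 subrr mulr0 subrr cabs0 mulr0.
have := hd (ofC h); rewrite -toC_eq0 ofCK => /(_ h0 hh)/ltW.
have -> : ofC w + ofC h = ofC (w + h) by rewrite /ofC ReD ImD.
rewrite -cabs_gt0 in h0; rewrite -(ler_pM2r h0) -cabsM mulrBl divfK//.
by rewrite -cabs_gt0.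
Qed.

Lemma cdiff_holomorphic (F : R[i] -> R[i]) :
  (forall w, cabs w < 1 -> exists l, cdiff F w l) ->
  holomorphic_on disc (fun p => F (toC p)).
Proof.
move=> hF p Dp; have p1 : cabs (toC p) < 1.
  rewrite -(ltr_pXn2r (ltn0Sn 1)) ?nnegrE ?cabs_ge0// expr1n cabs_sqr.
  exact: Dp.
have [l hl] := hF _ p1; exists l => e e0.
have [d d0 hd] := hl _ (divr_gt0 e0 (ltr0Sn R 1)); exists d => // h h0 hh.
have := hd _ hh; have -> : toC (p + h) = toC p + toC h by [].
have h0' : 0 < cabs (toC h) by rewrite cabs_gt0 toC_eq0.
rewrite -ler_pdivrMr// -cabsV -cabsM mulrBl mulfK ?toC_eq0// => /le_lt_trans; apply.
by rewrite ltr_pdivrMr//; lra.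
Qed.

Lemma psum_cdiff a (w : R[i]) : rad1 a -> cabs w < 1 -> cdiff (psum a) w (psum (dcoef a) w).
Proof.
move=> ra w1 e e0; have w0 := cabs_ge0 w.
have r01 : 0 < (1 + cabs w) / 2 < 1 by apply/andP; split; lra.
have [C C0 HC] := psum_taylor1 ra r01.
have C1 : 0 < C + 1 by rewrite ltr_wpDl.
exists (Num.min ((1 - cabs w) / 2) (e / (C + 1))).
  by rewrite lt_min divr_gt0 ?subr_gt0//= divr_gt0.
move=> h; rewrite lt_min ltr_pdivlMr// => /andP[h1 h2].
apply: le_trans (HC w h _ _) _; first by lra.
  by apply: le_trans (cabsD _ _) _; lra.
rewrite expr2 mulrA ler_wpM2r ?cabs_ge0//; move: h2; rewrite ltr_pdivlMr//.
by have := cabs_ge0 h; nra.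
Qed.

Lemma holomorphic_psum a : rad1 a -> holomorphic_on disc (fun p => psum a (toC p)).
Proof.
by move=> ra; apply: cdiff_holomorphic => w w1; exists (psum (dcoef a) w); exact: psum_cdiff.
Qed.

Lemma holomorphic_taylor f : holomorphic_on disc f ->
  exists2 a, rad1 a & forall p, disc p -> f p = psum a (toC p).
Proof.
move=> hf; have [w w1|a ra ha] := taylor_disc (F := fun z => f (ofC z)).
  exact: holomorphic_cdiff.
exists a => // p Dp; rewrite -ha ?toCK//; exact: toC_lt1.
Qed.

Lemma cdiffD F G w l m : cdiff F w l -> cdiff G w m ->
  cdiff (fun z : R[i] => F z + G z : R[i]) w (l + m).
Proof.
move=> hF hG e e0; have e2 : 0 < e / 2 by rewrite divr_gt0.
have [d1 d10 h1] := hF _ e2; have [d2 d20 h2] := hG _ e2.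
exists (Num.min d1 d2); first by rewrite lt_min d10.
move=> h; rewrite lt_min => /andP[/h1 a1 /h2 a2].
have -> : F (w + h) + G (w + h) - (F w + G w) - (l + m) * h =
  (F (w + h) - F w - l * h) + (G (w + h) - G w - m * h) by ring.
by apply: le_trans (cabsD _ _) _; lra.
Qed.

Lemma cdiffM F G w l m : cdiff F w l -> cdiff G w m ->
  cdiff (fun z : R[i] => F z * G z : R[i]) w (l * G w + F w * m).
Proof.
move=> hF hG e e0.
have G0 := cabs_ge0 (G w); have F0 := cabs_ge0 (F w); have l0 := cabs_ge0 l.
pose K := 1 + cabs (G w) + 1 + cabs (F w) + cabs l.
have K0 : 0 < K by rewrite /K; lra.
have eK : 0 < e / K by rewrite divr_gt0.
have [d1 d10 h1] := hF _ eK; have [d2 d20 h2] := hG _ eK.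
have [d3 d30 h3] := cdiff_contat hG eK.
have [d4 d40 h4] := cdiff_contat hG ltr01.
exists (Num.min (Num.min d1 d2) (Num.min d3 d4)).
  by rewrite !lt_min d10 d20 d30.
move=> h; rewrite !lt_min => /andP[/andP[/h1 a1 /h2 a2] /andP[/h3 a3 /h4 a4]].
have -> : F (w + h) * G (w + h) - F w * G w - (l * G w + F w * m) * h =
  (F (w + h) - F w - l * h) * G (w + h) + F w * (G (w + h) - G w - m * h)
  + l * h * (G (w + h) - G w) by ring.
have gb : cabs (G (w + h)) <= 1 + cabs (G w).
  by have := cabsD (G (w + h) - G w) (G w); rewrite subrK; lra.
apply: le_trans (cabsD _ _) _; apply: le_trans (lerD (cabsD _ _) (lexx _)) _.
rewrite !cabsM; have hh := cabs_ge0 h.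
apply: (@le_trans _ _ (e / K * cabs h * (1 + cabs (G w)) + cabs (F w) * (e / K * cabs h)
   + cabs l * cabs h * (e / K))).
  apply: lerD; first apply: lerD.
  - by apply: ler_pM; rewrite ?cabs_ge0.
  - by rewrite ler_wpM2l.
  - by rewrite ler_wpM2l ?mulr_ge0// ltW.
have -> : e / K * cabs h * (1 + cabs (G w)) + cabs (F w) * (e / K * cabs h) +
  cabs l * cabs h * (e / K) = (e / K * (K - 1)) * cabs h by rewrite /K; ring.
rewrite ler_wpM2r// mulrAC ler_pdivrMr// ler_wpM2l ?(ltW e0)//; lra.
Qed.

Lemma cdiff_cst w k : cdiff (fun _ : R[i] => k : R[i]) w 0.
Proof.
move=> e e0; exists 1 => // h _; rewrite subrr mul0r subrr cabs0.
by rewrite mulr_ge0 ?cabs_ge0// ltW.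
Qed.

End HolomorphicPowerSeries.

(** * The weighted space of square integrable functions *)

Section BergmanL2.
Context {R : realType}.
Variable alpha : R.
Hypothesis alpha_gt : -1 < alpha.
Local Notation L2 := (@leb2 R).
Local Notation w := (wt alpha).
Local Notation wC p := ((w p)%:C)%C.
Local Notation D := (discr (1 : R)).
Local Notation gam1 n := (gam alpha 1 n).
Implicit Types (f g h k : plane R -> R[i]) (p : plane R) (a b : nat -> R[i]).

Let mD : measurable D := measurable_discr 1.

Definition L2f f := cmeas D f /\
  L2.-integrable D (EFin \o (fun p => w p * cabs (f p) ^+ 2)).

(** The square of the norm. *)
Definition nrm f : R := \int[L2]_(p in D) (w p * cabs (f p) ^+ 2).

Definition ip f g : R[i] := CI L2 D (fun p => wC p * (f p * conjc (g p))).

Lemma ipAE f g : ipA alpha f g = ip f g.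
Proof.
rewrite /ipA /ip /CI /Rintegral /intA; congr Complex; congr fine;
  apply: eq_integral => p _.
  by rewrite ReZ.
by rewrite ImZ.
Qed.

Lemma wsq_ge0 f p : 0 <= w p * cabs (f p) ^+ 2.
Proof. by rewrite mulr_ge0 ?wt_ge0 ?sqr_ge0. Qed.

Lemma L2AE f : L2A alpha f <-> L2f f.
Proof.
split=> [[m1 m2 h]|[[m1 m2] h]].
  have mf : cmeas D f by split; [exact: m1|exact: m2].
  split => //; apply/integrableP; split.
    apply/measurable_EFinP; apply: measurable_funM; first exact: measurable_wt.
    exact: cmeas_abs2.
  rewrite (eq_integral (fun p => (w p * cabs (f p) ^+ 2)%:E)); first exact: h.
  by move=> p _ /=; rewrite ger0_norm ?wsq_ge0.
split; [exact: m1|exact: m2|].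
have /integrableP[_] := h; apply: le_lt_trans.
rewrite /intA le_eqVlt; apply/orP; left; apply/eqP.
by apply: eq_integral => p _ /=; rewrite ger0_norm ?wsq_ge0.
Qed.

(** The weighted inequality of arithmetic and geometric means. Its free parameter d lets [ip_le]
    stand in for the Cauchy-Schwarz inequality. *)
Lemma cabsM2_le (z v : R[i]) (d : R) : 0 < d ->
  cabs (z * conjc v) <= d * cabs z ^+ 2 + d^-1 * cabs v ^+ 2.
Proof.
move=> d0; rewrite cabsM cabsJ.
have := sqr_ge0 (d * cabs z - cabs v); have z0 := cabs_ge0 z; have v0 := cabs_ge0 v.
move=> h; rewrite -(ler_pM2l d0) mulrDr [d * (d^-1 * _)]mulrA divff ?gt_eqF// mul1r.
have : 0 <= d * cabs z * cabs v by rewrite !mulr_ge0// ltW.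
by move: h; rewrite !expr2; nra.
Qed.

Lemma integrable_pair_bound f g (d : R) : L2f f -> L2f g ->
  L2.-integrable D (EFin \o (fun p => d * (w p * cabs (f p) ^+ 2) +
    d^-1 * (w p * cabs (g p) ^+ 2))).
Proof.
by move=> [_ hf] [_ hg]; apply: integrableDR => //; apply: integrableZR.
Qed.

Lemma pair_bound f g (d : R) p : 0 < d -> cabs (wC p * (f p * conjc (g p))) <=
  d * (w p * cabs (f p) ^+ 2) + d^-1 * (w p * cabs (g p) ^+ 2).
Proof.
move=> d0; rewrite cabsM cabs_w//.
rewrite [d * _]mulrCA [d^-1 * _]mulrCA -mulrDr ler_wpM2l ?wt_ge0//.
exact: cabsM2_le.
Qed.

Lemma cint_pair f g : L2f f -> L2f g -> cint L2 D (fun p => wC p * (f p * conjc (g p))).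
Proof.
move=> hf hg; apply: cint_dom (integrable_pair_bound 1 hf hg) _ => //.
  apply: cmeasM; first exact: cmeas_w.
  by apply: cmeasM; [case: hf|apply: cmeasJ; case: hg].
by move=> p _; exact: pair_bound.
Qed.

Lemma ip_le f g (d : R) : 0 < d -> L2f f -> L2f g ->
  cabs (ip f g) <= 2 * (d * nrm f + d^-1 * nrm g).
Proof.
move=> d0 hf hg.
apply: le_trans (CI_le mD (cint_pair hf hg) (integrable_pair_bound d hf hg) _) _.
  by move=> p _; exact: pair_bound.
rewrite RintegralDR//; [|apply: integrableZR => //; case: hf => //|apply: integrableZR => //; case: hg => //].
by rewrite !RintegralZl//; [case: hg|case: hf].
Qed.

Lemma L2f_dom f g (M : R) : cmeas D f -> L2f g ->
  (forall p, D p -> cabs (f p) ^+ 2 <= M * cabs (g p) ^+ 2) -> L2f f.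
Proof.
move=> mf [mg ig] fg; split => //.
apply: (@integrable_dom _ _ _ _ _ mD _ (fun p => M * (w p * cabs (g p) ^+ 2))).
- by apply: measurable_funM; [exact: measurable_wt|exact: cmeas_abs2].
- exact: integrableZR.
by move=> p Dp; rewrite ger0_norm ?wsq_ge0// [leRHS]mulrCA ler_wpM2l ?wt_ge0 ?fg.
Qed.

Lemma L2fD f g : L2f f -> L2f g -> L2f (fun p => f p + g p).
Proof.
move=> [mf hf] [mg hg]; have mfg := cmeasD mf mg; split => //.
apply: (@integrable_dom _ _ _ _ _ mD _
  (fun p => 2 * (w p * cabs (f p) ^+ 2) + 2 * (w p * cabs (g p) ^+ 2))).
- by apply: measurable_funM; [exact: measurable_wt|exact: cmeas_abs2].
- by apply: integrableDR => //; apply: integrableZR.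
move=> p Dp; rewrite ger0_norm ?(wsq_ge0 (fun p => f p + g p))//.
rewrite ![2 * (_ * _)]mulrCA -mulrDr ler_wpM2l ?wt_ge0//.
have := cabsD (f p) (g p); have := cabs_ge0 (f p + g p).
have := cabs_ge0 (f p); have := cabs_ge0 (g p); have := sqr_ge0 (cabs (f p) - cabs (g p)).
by rewrite !expr2; nra.
Qed.

Lemma L2fZ c f : L2f f -> L2f (fun p => c * f p).
Proof.
move=> hf; apply: (@L2f_dom _ f (cabs c ^+ 2)) => //.
  by apply: cmeasM; [exact: cmeas_cst|case: hf].
by move=> p _; rewrite cabsM exprMn.
Qed.

Lemma eq_L2f f g : {in D, f =1 g} -> L2f f -> L2f g.
Proof.
move=> fg [mf hf]; split; first exact: eq_cmeas mf.
by apply: eq_integrableR hf => // p Dp; rewrite fg.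
Qed.

Lemma L2fB f g : L2f f -> L2f g -> L2f (fun p => f p - g p).
Proof.
move=> hf hg; apply: eq_L2f (L2fD hf (L2fZ (-1) hg)) => p _.
by rewrite mulN1r.
Qed.

Lemma eq_ip f f' g g' : {in D, f =1 f'} -> {in D, g =1 g'} -> ip f g = ip f' g'.
Proof. by move=> ff gg; apply: eq_CI => p Dp; rewrite ff ?gg. Qed.

Lemma ipDl f f' g : L2f f -> L2f f' -> L2f g ->
  ip (fun p => f p + f' p) g = ip f g + ip f' g.
Proof.
move=> hf hf' hg; rewrite /ip -CID//; [|exact: cint_pair|exact: cint_pair].
by apply: eq_CI => p _; ring.
Qed.

Lemma ipZl c f g : L2f f -> L2f g -> ip (fun p => c * f p) g = c * ip f g.
Proof.
move=> hf hg; rewrite /ip -CIZ//; last exact: cint_pair.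
by apply: eq_CI => p _; ring.
Qed.

Lemma ipC f g : L2f f -> L2f g -> ip g f = conjc (ip f g).
Proof.
move=> hf hg; rewrite /ip -CIJ//; last exact: cint_pair.
apply: eq_CI => p _; rewrite !conjcM conjc_real [conjc (conjc _)](_ : _ = g p).
  by ring.
by apply: complexP; rewrite !ReImE// opprK.
Qed.

Lemma ipBl f f' g : L2f f -> L2f f' -> L2f g ->
  ip (fun p => f p - f' p) g = ip f g - ip f' g.
Proof.
move=> hf hf' hg; rewrite -mulN1r -ipZl// -ipDl//; last exact: L2fZ.
by apply: eq_ip => p _; rewrite ?mulN1r.
Qed.

Lemma ipDr f g g' : L2f f -> L2f g -> L2f g' ->
  ip f (fun p => g p + g' p) = ip f g + ip f g'.
Proof.
move=> hf hg hg'; rewrite (ipC (L2fD hg hg') hf) ipDl// conjcD.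
by rewrite -!ipC.
Qed.

Lemma ipZr c f g : L2f f -> L2f g -> ip f (fun p => c * g p) = conjc c * ip f g.
Proof.
by move=> hf hg; rewrite (ipC (L2fZ c hg) hf) ipZl// conjcM -ipC.
Qed.

Lemma CI_real (E : set (plane R)) G (u : plane R -> R) : measurable E ->
  (forall p, G p = ((u p)%:C)%C) -> CI L2 E G = ((\int[L2]_(p in E) u p)%:C)%C.
Proof.
move=> mE H; apply: complexP => /=; first by apply: eq_Rintegral => p _; rewrite H.
by rewrite (@eq_Rintegral _ _ _ _ _ (fun=> 0)) ?Rintegral_cst ?mul0r// => p _; rewrite H.
Qed.

Lemma wC_sq f p : wC p * (f p * conjc (f p)) = ((w p * cabs (f p) ^+ 2)%:C)%C.
Proof. by rewrite mulcJ -(rmorphM (real_complex R)). Qed.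

Lemma ip_nrm f : ip f f = ((nrm f)%:C)%C.
Proof. exact: CI_real mD (wC_sq f). Qed.

Lemma nrm_ge0 f : 0 <= nrm f.
Proof. by apply: Rintegral_ge0 => p _; exact: wsq_ge0. Qed.

Lemma nrmZ c f : L2f f -> nrm (fun p => c * f p) = cabs c ^+ 2 * nrm f.
Proof.
move=> [_ hf]; rewrite /nrm -RintegralZl//; apply: eq_Rintegral => p _.
by rewrite cabsM exprMn mulrCA.
Qed.

Lemma darea_gt0 : 0 < darea :> R.
Proof.
pose I : set (measurableTypeR R) := `[0, 2^-1]%classic.
have mI : measurable I by exact: measurable_itv.
have IE : lebesgue_measure I = (2^-1)%:E.
  by rewrite lebesgue_measure_itv /= lte_fin invr_gt0 ltr0n -EFinB subr0.
rewrite -lte_fin -leb2_disc.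
apply: (@lt_le_trans _ _ (L2 (I `*` I))).
  have -> : L2 (I `*` I) = (lebesgue_measure I * lebesgue_measure I)%E :=
    product_measure1E _ _ mI mI.
  by rewrite IE -EFinM lte_fin mulr_gt0 ?invr_gt0.
apply: le_measure; rewrite ?inE//; first exact: measurableX.
move=> [x y]; rewrite /I /discr /nsq /= !in_itv /= => -[/andP[x0 x1] /andP[y0 y1]].
by rewrite !expr2; nra.
Qed.

(** A zero integral would make the weight vanish almost everywhere on E, but it is positive on the
    disc. *)
Lemma w_pos (E : set (plane R)) : measurable E -> E `<=` D -> (0 < L2 E)%E ->
  0 < \int[L2]_(p in E) w p.
Proof.
move=> mE ED E0; rewrite lt_neqAle Rintegral_ge0 ?andbT; last by move=> p _; exact: wt_ge0.
apply/eqP => I0.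
have iw : L2.-integrable E (EFin \o w).
  by apply: (integrableS mD mE ED); exact: integrable_w.
have mw : measurable_fun E (EFin \o w) by apply/measurable_EFinP; exact: measurable_wt.
have : (\int[L2]_(p in E) `|(EFin \o w) p| = 0)%E.
  rewrite (eq_integral (EFin \o w)); last first.
    by move=> p _ /=; rewrite ger0_norm ?wt_ge0.
  have /fineK <- := integrable_fin_num mE iw.
  by congr (_%:E); rewrite [RHS]I0.
move=> /(ae_eq_integral_abs [the {measure set (plane R) -> \bar R} of L2] mE mw) [N [mN N0 hN]].
suff : (L2 E <= 0)%E by move=> /(lt_le_trans E0); rewrite ltxx.
rewrite -[X in (_ <= X)%E]N0; apply: le_measure; rewrite ?inE//.
move=> p Ep; apply: hN => /= /(_ Ep) [] h.
by have := wt_gt0 alpha_gt (ED p Ep); rewrite h ltxx.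
Qed.

(** On the annulus where the squared modulus is at least s, its n-th power is at least s^n; c is the
    mass of that annulus. So dividing by the moments preserves radii of convergence. *)
Lemma gam_lower (s : R) : 0 <= s < 1 -> exists2 c : R, 0 < c & forall n, c * s ^+ n <= gam1 n.
Proof.
move=> /andP[s0 s1]; pose E := discr 1 `\` discr s : set (plane R).
have mE : measurable E by apply: measurableD; exact: measurable_discr.
have ED : E `<=` D by move=> p [].
exists (\int[L2]_(p in E) w p).
  apply: w_pos => //.
  have h : 0 < 1 - s <= 1 by apply/andP; split; lra.
  have -> : E = discr 1 `\` discr (1 - (1 - s)) by rewrite subKr.
  rewrite leb2_annulus// lte_fin mulr_gt0 ?darea_gt0//.
  by case/andP: h.
move=> n.
have iE : L2.-integrable E (EFin \o (fun p => w p * nsq p ^+ n)).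
  by apply: (integrableS mD mE ED); exact: integrable_gam.
have iw : L2.-integrable E (EFin \o w).
  by apply: (integrableS mD mE ED); exact: integrable_w.
apply: (@le_trans _ _ (\int[L2]_(p in E) (w p * nsq p ^+ n))).
  rewrite mulrC -RintegralZl//; apply: le_Rintegral => //.
    exact: integrableZR.
  move=> p [_ /negP]; rewrite /discr /= -leNgt => sp.
  rewrite mulrC ler_wpM2l ?wt_ge0// lerXn2r ?nnegrE//; exact: le_trans sp.
rewrite /Rintegral fine_le//.
- exact: integrable_fin_num.
- by apply: integrable_fin_num => //; exact: integrable_gam.
apply: ge0_subset_integral => //.
  by apply: (measurable_int L2); exact: integrable_gam.
by move=> p _; rewrite lee_fin mulr_ge0 ?wt_ge0 ?exprn_ge0 ?nsq_ge0.
Qed.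

Lemma gam_gt0 n : 0 < gam1 n.
Proof.
have h : 0 <= (2^-1 : R) < 1 by rewrite invr_ge0 ler0n/= invf_lt1// ltr1n.
have [c c0 /(_ n)] := gam_lower h; apply: lt_le_trans.
by rewrite mulr_gt0// exprn_gt0// invr_gt0.
Qed.

Lemma ccvg_Re_ge (u : nat -> R[i]) l (B : R) N : ccvg u l ->
  (forall n, (N <= n)%N -> B <= complex.Re (u n)) -> B <= complex.Re l.
Proof.
move=> ul uB; apply: ler_inf_eps => e e0; have [N' HN'] := ul e e0.
have := HN' _ (leq_maxr N N'); have := uB _ (leq_maxl N N').
have := abs_Re_le (u (maxn N N') - l); rewrite ReD ReN.
by move=> /(le_trans (ler_norm _)); lra.
Qed.

Lemma ccvg_Re_le (u : nat -> R[i]) l (B : R) N : ccvg u l ->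
  (forall n, (N <= n)%N -> complex.Re (u n) <= B) -> complex.Re l <= B.
Proof.
move=> ul uB; rewrite -lerN2 -ReN; apply: (@ccvg_Re_ge (fun n => - u n) _ _ N).
  by move=> e /ul[M HM]; exists M => n /HM; rewrite -opprD cabsN.
by move=> n /uB; rewrite ReN lerN2.
Qed.

Lemma ps_nrm_r a (r : R) : rad1 a -> r < 1 ->
  ccvg (fun N => ((\sum_(m < N) cabs (a m) ^+ 2 * gam alpha r m)%:C)%C)
    ((\int[L2]_(p in discr r) (w p * cabs (ps a p) ^+ 2))%:C)%C.
Proof.
move=> ra r1; have := pair_ps alpha_gt ra ra r1.
have -> : CI L2 (discr r) (fun p => wC p * (ps a p * conjc (ps a p))) =
    ((\int[L2]_(p in discr r) (w p * cabs (ps a p) ^+ 2))%:C)%C.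
  exact: CI_real (measurable_discr r) (wC_sq (ps a)).
apply: ccvg_ext => N; rewrite (rmorph_sum (real_complex R)); apply: eq_bigr => m _.
by rewrite mulcJ -(rmorphM (real_complex R)).
Qed.

(** Half of Parseval: the inequality holds on each smaller disc, and finitely many moments pass to
    the limit. *)
Lemma ps_partial_le a N : rad1 a -> L2f (ps a) ->
  \sum_(m < N) cabs (a m) ^+ 2 * gam1 m <= nrm (ps a).
Proof.
move=> ra [_ hf].
have H n : \sum_(m < N) cabs (a m) ^+ 2 * gam alpha (rad n) m <= nrm (ps a).
  apply: (@le_trans _ _ (\int[L2]_(p in discr (rad n)) (w p * cabs (ps a p) ^+ 2))).
    apply: (@ccvg_Re_ge _ _ _ N (ps_nrm_r ra (rad_lt1 n))) => M NM /=.
    rewrite -(subnKC NM) big_split_ord /= lerDl sumr_ge0// => i _.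
    by rewrite mulr_ge0 ?sqr_ge0 ?gam_ge0.
  apply: Rintegral_subset => //; first exact/ltW/rad_lt1.
  by move=> p; exact: wsq_ge0.
have L : (fun n => \sum_(m < N) cabs (a m) ^+ 2 * gam alpha (rad n) m) @ \oo -->
    \sum_(m < N) cabs (a m) ^+ 2 * gam1 m.
  elim: (N) => [|M IH].
    by under eq_fun do rewrite big_ord0; rewrite big_ord0; exact: cvg_cst.
  under eq_fun do rewrite big_ord_recr; rewrite big_ord_recr; apply: cvgD => //.
  by apply: cvgMr; apply: Rint_rad; exact: integrable_gam.
rewrite -(cvg_lim _ L)//; apply: limr_le; first by apply/cvg_ex; exists (\sum_(m < N) cabs (a m) ^+ 2 * gam1 m).
by near=> n; exact: H.
Unshelve. all: by end_near. Qed.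

(** The other half of Parseval, by monotone convergence along the discs of squared radius
    [rad n]. *)
Lemma L2f_ps a (B : R) : rad1 a ->
  (forall N, \sum_(m < N) cabs (a m) ^+ 2 * gam1 m <= B) -> L2f (ps a) /\ nrm (ps a) <= B.
Proof.
move=> ra hB.
have mps : cmeas D (ps a) by exact: cmeas_ps.
have msq (E : set (plane R)) : E `<=` D -> measurable_fun E (fun p => (w p * cabs (ps a p) ^+ 2)%:E).
  move=> ED; apply: (measurable_funS mD ED); apply/measurable_EFinP.
  by apply: measurable_funM; [exact: measurable_wt|exact: cmeas_abs2].
have H n : \int[L2]_(p in discr (rad n)) (w p * cabs (ps a p) ^+ 2) <= B.
  apply: (@ccvg_Re_le _ _ _ 0%N (ps_nrm_r ra (rad_lt1 n))) => N _ /=.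
  apply: le_trans (hB N); apply: ler_sum => m _; rewrite ler_wpM2l ?sqr_ge0//.
  by apply: gam_le => //; exact/ltW/rad_lt1.
have sub n : discr (rad n) `<=` D by apply: discr_sub; exact/ltW/rad_lt1.
have He n : (\int[L2]_(p in discr (rad n)) (w p * cabs (ps a p) ^+ 2)%:E <= B%:E)%E.
  have [M M0 HM] := ps_bdd ra (rad_lt1 n).
  have ii : L2.-integrable (discr (rad n)) (EFin \o (fun p => w p * cabs (ps a p) ^+ 2)).
    apply: (@integrable_dom _ _ _ _ _ (measurable_discr _) _ (fun p => M ^+ 2 * w p)).
    - by apply/measurable_EFinP; apply: msq.
    - by apply: integrableZR; [exact: measurable_discr|apply: integrable_w => //; exact/ltW/rad_lt1].
    move=> p Dp; rewrite ger0_norm ?wsq_ge0// mulrC ler_wpM2r ?wt_ge0//.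
    by rewrite lerXn2r ?nnegrE ?cabs_ge0 ?HM.
  have := H n; rewrite -lee_fin /Rintegral fineK//.
  by apply: integrable_fin_num => //; exact: measurable_discr.
have U : \bigcup_n discr (rad n) = D.
  apply/seteqP; split => p; first by move=> [n _ /sub].
  by move=> /rad_exhaust[N /(_ N (leqnn _))]; exists N.
have nd : nondecreasing_seq ((fun n => discr (rad n)) : nat -> set (plane R)).
  move=> n m nm; apply/subsetPset => p; rewrite /discr /= => /lt_le_trans; apply.
  by rewrite /rad lerD2l lerN2 lef_pV2 ?posrE ?ltr0n// ler_nat.
have C := @ge0_nondecreasing_set_cvg_integral _ _ _ (fun n => discr (rad n))
  (fun p => (w p * cabs (ps a p) ^+ 2)%:E) L2 nd (fun n => measurable_discr _)
  (fun n => msq _ (sub n)) (fun n p _ => wsq_ge0 (ps a) p).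
rewrite U in C.
have le : (\int[L2]_(p in D) (w p * cabs (ps a p) ^+ 2)%:E <= B%:E)%E.
  rewrite -(cvg_lim _ C)//; apply: lime_le; first by apply/cvg_ex; eexists; exact: C.
  by near=> n; exact: He.
have ii : L2.-integrable D (EFin \o (fun p => w p * cabs (ps a p) ^+ 2)).
  apply/integrableP; split; first exact: msq.
  rewrite (eq_integral (fun p => (w p * cabs (ps a p) ^+ 2)%:E)).
    by apply: le_lt_trans le _; rewrite ltry.
  by move=> p _ /=; rewrite ger0_norm ?wsq_ge0.
split => //; rewrite -lee_fin; apply: le_trans le.
by rewrite /nrm /Rintegral fineK//; exact: integrable_fin_num.
Unshelve. all: by end_near. Qed.

End BergmanL2.

(** * The Bergman projection *)

Section Projection.
Context {R : realType}.
Variable alpha : R.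
Hypothesis alpha_gt : -1 < alpha.
Local Notation L2 := (@leb2 R).
Local Notation D := (discr (1 : R)).
Local Notation gam1 n := (gam alpha 1 n).
Local Notation L2f := (L2f alpha).
Local Notation ip := (ip alpha).
Local Notation nrm := (nrm alpha).
Implicit Types (f g h k : plane R -> R[i]) (p : plane R) (a b : nat -> R[i]).

Definition mono n p : R[i] := toC p ^+ n.

Lemma L2f_bdd f (M : R) : cmeas D f -> (forall p, D p -> cabs (f p) <= M) -> L2f f.
Proof.
move=> mf fM; split => //.
apply: (@integrable_dom _ _ _ _ _ (measurable_discr 1) _ (fun p => M ^+ 2 * wt alpha p)).
- by apply: measurable_funM; [exact: measurable_wt|exact: cmeas_abs2].
- by apply: integrableZR; [exact: measurable_discr|exact: integrable_w].
move=> p Dp; rewrite ger0_norm ?wsq_ge0// mulrC ler_wpM2r ?wt_ge0//.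
have h := fM _ Dp.
by rewrite lerXn2r ?nnegrE ?cabs_ge0// (le_trans _ h)// cabs_ge0.
Qed.

Lemma L2f_mono n : L2f (mono n).
Proof.
apply: (@L2f_bdd _ 1); first by apply: cmeasX; exact: cmeas_toC.
move=> p Dp; have := mono_le1 n 0 (lexx 1) Dp.
by rewrite expr0 mulr1.
Qed.

Lemma ip_mono n m : ip (mono n) (mono m) = if n == m then ((gam1 n)%:C)%C else 0.
Proof.
rewrite -(mono_pair alpha_gt n m (lexx 1)); apply: eq_CI => p _.
by rewrite /mono conjcX.
Qed.

Lemma L2f_sum N (F : nat -> plane R -> R[i]) : (forall n, L2f (F n)) ->
  L2f (fun p => \sum_(n < N) F n p).
Proof.
move=> hF; elim: N => [|N IH].
  apply: (@L2f_bdd _ 0) => [|p _]; last by rewrite big_ord0 cabs0.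
  by under eq_fun do rewrite big_ord0; exact: cmeas_cst.
by under eq_fun do rewrite big_ord_recr; apply: L2fD.
Qed.

Lemma ip_sumr N (F : nat -> plane R -> R[i]) f : L2f f -> (forall n, L2f (F n)) ->
  ip f (fun p => \sum_(n < N) F n p) = \sum_(n < N) ip f (F n).
Proof.
move=> hf hF; elim: N => [|N IH].
  rewrite big_ord0; transitivity (CI L2 D (fun=> 0)); last first.
    by apply: CI0; exact: measurable_discr.
  by apply: eq_CI => p _; rewrite big_ord0 (_ : conjc 0 = 0) ?mulr0//; apply: complexP; rewrite //= oppr0.
rewrite big_ord_recr /= -IH -ipDr//; last exact: L2f_sum.
by apply: eq_ip => p _; rewrite ?big_ord_recr.
Qed.

Lemma ip_suml N (F : nat -> plane R -> R[i]) f : L2f f -> (forall n, L2f (F n)) ->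
  ip (fun p => \sum_(n < N) F n p) f = \sum_(n < N) ip (F n) f.
Proof.
move=> hf hF; rewrite (ipC alpha_gt hf); last exact: L2f_sum.
rewrite ip_sumr// conjc_sum; apply: eq_bigr => i _.
by rewrite -ipC.
Qed.

(** The Taylor coefficients that the projection of g must have. *)
Definition bcoef g n : R[i] := ip g (mono n) / ((gam1 n)%:C)%C.

Lemma gam1C_neq0 n : ((gam1 n)%:C)%C != 0 :> R[i].
Proof. by rewrite -cabs_gt0 cabsR normr_gt0 gt_eqF// gam_gt0. Qed.

(** The squared norm of g minus its projection to the first N monomials is nonnegative. *)
Lemma bessel g N : L2f g -> \sum_(n < N) cabs (bcoef g n) ^+ 2 * gam1 n <= nrm g.
Proof.
move=> hg; pose S p := \sum_(n < N) bcoef g n * mono n p.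
have hbm n : L2f (fun p => bcoef g n * mono n p) by apply: L2fZ => //; exact: L2f_mono.
have hS : L2f S by apply: (@L2f_sum N (fun n p => bcoef g n * mono n p)).
pose B := \sum_(n < N) cabs (bcoef g n) ^+ 2 * gam1 n.
have ib n : ip g (fun p => bcoef g n * mono n p) = ((cabs (bcoef g n) ^+ 2 * gam1 n)%:C)%C.
  rewrite ipZr//; last exact: L2f_mono.
  rewrite (rmorphM (real_complex R)) /= -mulcJ mulrAC.
  by rewrite /bcoef [_ / _ * _]divfK ?gam1C_neq0// mulrC.
have BC : ((B%:C)%C : R[i]) = \sum_(n < N) ((cabs (bcoef g n) ^+ 2 * gam1 n)%:C)%C.
  by rewrite /B (rmorph_sum (real_complex R)).
have gS : ip g S = (B%:C)%C.
  by rewrite (@ip_sumr N (fun n p => bcoef g n * mono n p))// BC; apply: eq_bigr => n _.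
have SS : ip S S = (B%:C)%C.
  rewrite (@ip_suml N (fun n p => bcoef g n * mono n p))// BC; apply: eq_bigr => n _.
  rewrite ipZl//; last exact: L2f_mono.
  rewrite (@ip_sumr N (fun n p => bcoef g n * mono n p))//; last exact: L2f_mono.
  rewrite (bigD1 n) //= big1 ?addr0; last first.
    move=> i /negbTE ni; rewrite ipZr//; [|exact: L2f_mono|exact: L2f_mono].
    by rewrite ip_mono eq_sym val_eqE ni mulr0.
  rewrite ipZr; [|by []|exact: L2f_mono|exact: L2f_mono].
  by rewrite ip_mono eqxx mulrA mulcJ -(rmorphM (real_complex R)).
have : ip (fun p => g p - S p) (fun p => g p - S p) = ((nrm g - B)%:C)%C.
  rewrite ipBl//; last exact: L2fB.
  have E h : L2f h -> ip h (fun p => g p - S p) = ip h g - ip h S.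
    move=> hh; rewrite (ipC alpha_gt (L2fB alpha_gt hg hS) hh) ipBl// conjcD conjcN.
    by rewrite -!ipC.
  rewrite !E// (ipC alpha_gt hg hS) gS SS ip_nrm// conjc_real subrr subr0.
  by rewrite -rmorphB.
rewrite ip_nrm// => /(congr1 (@complex.Re R)) /= h.
by rewrite -subr_ge0 -h nrm_ge0.
Qed.

Lemma rad1_bessel b (B : R) : (forall n, cabs (b n) ^+ 2 * gam1 n <= B) -> rad1 b.
Proof.
move=> hB r /andP[r0 r1].
have s01 : 0 <= r ^+ 2 < 1 by rewrite sqr_ge0 /= expr_lt1.
have [c c0 hc] := gam_lower alpha_gt s01.
(* [gam_lower] at r^2 bounds the square of the quantity by B / c; adding 1 dispenses with the square
   root. *)
exists (B / c + 1) => n; have b0 := cabs_ge0 (b n); have rn : 0 <= r ^+ n by rewrite exprn_ge0.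
have : (cabs (b n) * r ^+ n) ^+ 2 <= B / c.
  rewrite ler_pdivlMr//; apply: le_trans (hB n).
  rewrite exprMn -mulrA ler_wpM2l ?sqr_ge0// mulrC.
  by apply: le_trans (hc n); rewrite -!exprM mulnC.
have : 0 <= cabs (b n) * r ^+ n by rewrite mulr_ge0.
by rewrite expr2; nra.
Qed.

(** Both sides are limits over the discs of squared radius [rad N], where [pair_mono] applies. *)
Lemma ip_ps_mono a n : rad1 a -> L2f (ps a) -> ip (ps a) (mono n) = a n * ((gam1 n)%:C)%C.
Proof.
move=> ra ha.
have H := CI_rad (cint_pair alpha_gt ha (L2f_mono n)).
apply: (ccvg_unique H).
apply: (ccvg_ext (u := fun N => a n * ((gam alpha (rad N) n)%:C)%C)).
  move=> N; rewrite -(pair_mono alpha_gt n ra (rad_lt1 N)); apply: eq_CI => p _.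
  by rewrite /mono conjcX.
apply: ccvgZ; apply/ccvgP; split => /=; last exact: cvg_cst.
by apply: Rint_rad; exact: integrable_gam.
Qed.

Definition tailc N a n : R[i] := if (n < N)%N then 0 else a n.

Lemma rad1_tailc N a : rad1 a -> rad1 (tailc N a).
Proof.
apply: rad1_le => n; rewrite /tailc; case: ifP => // _.
by rewrite cabs0 cabs_ge0.
Qed.

Lemma ps_tailc N a p : rad1 a -> D p ->
  ps (tailc N a) p = ps a p - \sum_(n < N) a n * mono n p.
Proof.
move=> ra /toC_lt1 p1; apply: (ccvg_unique (psum_cvg (rad1_tailc N ra) p1)).
have := ccvgB (psum_cvg ra p1) (ccvg_cst (\sum_(n < N) a n * mono n p)).
move=> h e /h[M HM]; exists (maxn M N) => n; rewrite geq_max => /andP[/HM hn Nn].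
suff -> : \sum_(n0 < n) tailc N a n0 * toC p ^+ n0 =
  \sum_(n0 < n) a n0 * toC p ^+ n0 - \sum_(n0 < N) a n0 * mono n0 p by [].
rewrite -(subnKC Nn) !big_split_ord /= [X in _ = X - _]addrC addrK big1 ?add0r.
  by apply: eq_bigr => i _; rewrite /tailc ltnNge leq_addr.
by move=> i _; rewrite /tailc ltn_ord mul0r.
Qed.

(** Past an N whose partial sum of squares is within e of the supremum, any further block of the sum
    is at most e; [L2f_ps] turns this into a bound on the tail. *)
Lemma ps_tail_small a (e : R) : rad1 a -> L2f (ps a) -> 0 < e ->
  exists N, L2f (ps (tailc N a)) /\ nrm (ps (tailc N a)) <= e.
Proof.
move=> ra ha e0; pose S N := \sum_(n < N) cabs (a n) ^+ 2 * gam1 n.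
have SB N : S N <= nrm (ps a) by exact: ps_partial_le.
have ndS : {homo S : n m / (n <= m)%N >-> n <= m}.
  move=> n m nm; rewrite /S -(subnKC nm) big_split_ord /= lerDl sumr_ge0// => i _.
  by rewrite mulr_ge0 ?sqr_ge0 ?gam_ge0.
have hub : has_ubound (range S) by exists (nrm (ps a)) => _ [n _ <-].
have Sle N : S N <= sup (range S) by apply: ub_le_sup => //; exists N.
have [_ [N _ <-] hN] := @sup_adherent _ (range S) e e0 (conj (ex_intro _ _ (ex_intro2 _ _ 0%N I erefl)) hub).
exists N; apply: L2f_ps => //; first exact: rad1_tailc.
move=> M; have [K KE] : exists K, maxn N M = (N + K)%N.
  by exists (maxn N M - N)%N; rewrite subnKC// leq_maxl.
apply: (@le_trans _ _ (S (maxn N M) - S N)); last first.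
  by have := Sle (maxn N M); lra.
apply: (@le_trans _ _ (\sum_(m < maxn N M) cabs (tailc N a m) ^+ 2 * gam1 m)).
  rewrite -(subnKC (leq_maxr N M)) [X in _ <= X]big_split_ord /= lerDl sumr_ge0// => i _.
  by rewrite mulr_ge0 ?sqr_ge0 ?gam_ge0.
rewrite /S KE !big_split_ord /= [X in _ <= X - _]addrC addrK big1 ?add0r.
  by apply: ler_sum => i _; rewrite /tailc ltnNge leq_addr.
by move=> i _; rewrite /tailc ltn_ord cabs0 expr0n /= mul0r.
Qed.

Lemma A2_ps f : A2 alpha f -> exists a, [/\ rad1 a, forall p, D p -> f p = ps a p,
  L2f f & L2f (ps a)].
Proof.
move=> [/(L2AE alpha_gt) hf /holomorphic_taylor[a ra ha]]; exists a; split => //.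
by apply: (eq_L2f _ hf) => p /set_mem Dp; exact: ha.
Qed.

Lemma ps_A2 a : rad1 a -> L2f (ps a) -> A2 alpha (ps a).
Proof. by move=> ra ha; split; [exact/L2AE|exact: holomorphic_psum]. Qed.

(** The series with coefficients [bcoef g] is in the space by Bessel's inequality. Its difference
    with g is orthogonal to monomials, hence to k once the Taylor series of k is truncated. *)
Lemma projection_exists g : L2f g -> exists h, is_projA alpha g h.
Proof.
move=> hg; pose b := bcoef g.
have B n : cabs (b n) ^+ 2 * gam1 n <= nrm g.
  apply: le_trans (bessel n.+1 hg); rewrite big_ord_recr /= lerDr sumr_ge0// => i _.
  by rewrite mulr_ge0 ?sqr_ge0 ?gam_ge0.
have rb : rad1 b by exact: rad1_bessel B.
have [hb _] := L2f_ps alpha_gt rb (fun N => bessel N hg).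
exists (ps b); split; first exact: ps_A2.
move=> k /A2_ps[a [ra ka hk ha]]; rewrite ipAE.
pose u p := g p - ps b p; have hu : L2f u by exact: L2fB.
have um n : ip u (mono n) = 0.
  rewrite /u ipBl//; last exact: L2f_mono.
  by rewrite ip_ps_mono// /b /bcoef divfK ?gam1C_neq0// subrr.
rewrite (@eq_ip _ _ _ u k (ps a)) => [|//|p /set_mem Dp]; last exact: ka.
apply: cabs_eps0 => e e0.
have nu1 : 0 < 4 * (nrm u + 1) by rewrite mulr_gt0// ltr_wpDl// nrm_ge0.
(* d makes [d * nrm u] at most e / 4; only then is the tail taken so small that dividing its squared
   norm by d also leaves at most e / 4. *)
pose d := e / (4 * (nrm u + 1)); have d0 : 0 < d by rewrite divr_gt0.
have [N [hN lN]] := ps_tail_small ra ha (mulr_gt0 (divr_gt0 e0 (ltr0Sn R 3)) d0).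
pose F n p := a n * mono n p.
have hF n : L2f (F n) by apply: L2fZ => //; exact: L2f_mono.
have -> : ip u (ps a) = ip u (ps (tailc N a)).
  rewrite (@eq_ip _ _ _ u (ps a) (fun p => ps (tailc N a) p + \sum_(n < N) F n p)) => [|//|p /set_mem Dp]; last first.
    by rewrite ps_tailc// subrK.
  rewrite ipDr//; last exact: L2f_sum.
  rewrite ip_sumr// big1 ?addr0// => n _.
  by rewrite ipZr// ?um ?mulr0//; exact: L2f_mono.
apply: le_trans (ip_le alpha_gt d0 hu hN) _.
have : d^-1 * nrm (ps (tailc N a)) <= e / 4.
  by rewrite mulrC ler_pdivrMr.
have : d * nrm u <= e / 4.
  have n1 : 0 < nrm u + 1 by rewrite ltr_wpDl// nrm_ge0.
  have -> : d * nrm u = e / 4 * (nrm u / (nrm u + 1)) by rewrite /d; field; rewrite gt_eqF.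
  by rewrite ler_piMr ?divr_ge0 ?(ltW e0)// ler_pdivrMr// mul1r lerDl.
lra.
Qed.

End Projection.

(** * Real harmonic functions as real parts of power series *)

Section HarmonicRealPart.
Context {R : realType}.
Implicit Types (u f : R * R -> R) (p q : R * R).

Lemma eps_is_derive (f : R -> R) (x l : R) :
  (forall e, 0 < e -> exists2 d, 0 < d & forall h : R, `|h| < d ->
    `|f (x + h) - f x - l * h| <= e * `|h|) -> is_derive x 1 f l.
Proof.
move=> H.
have C : (fun h : R => h^-1 *: (f (h *: 1 + x) - f x)) @ 0^' --> l.
  apply/cvgrPdist_le => e e0; have [d d0 hd] := H e e0.
  near=> h; have h0 : h != 0 by near: h; exact: nbhs_dnbhs_neq.
  have hh : `|h| < d by near: h; exact: dnbhs0_lt.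
  rewrite -(ler_pM2r (_ : 0 < `|h|)) ?normr_gt0// -normrM.
  apply: le_trans (hd _ hh); rewrite /GRing.scale /= mulr1 [h + x]addrC.
  rewrite mulrBl mulrAC mulVf// mul1r distrC.
  exact: lexx.
have := cvg_lim (@norm_hausdorff _ _) C => E.
by apply: DeriveDef; [apply/cvg_ex; exists l|rewrite /derive E].
Unshelve. all: by end_near. Qed.

(** The product norm of the plane is the maximum norm, which [cabs] dominates. *)
Lemma diff_eps f p : differentiable f p -> forall e, 0 < e -> exists2 d, 0 < d &
  forall h : R * R, cabs (toC h) < d ->
  `|f (p + h) - f p - (h.1 * 'D_(e1 R) f p + h.2 * 'D_(e2 R) f p)| <= e * cabs (toC h).
Proof.
move=> df e e0.
have lin (h : R * R) : 'd f p h = h.1 * 'D_(e1 R) f p + h.2 * 'D_(e2 R) f p.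
  rewrite !deriveE// -2!linearZ/= -linearD; congr ('d f p _).
  by case: h => x y; rewrite /GRing.scale /= /e1 /e2; congr (_, _) => /=;
    rewrite /GRing.scale /= ?mulr1 ?mulr0 ?addr0 ?add0r.
have /eqaddoP := diff_locally df; move=> /(_ e e0)/nbhs_ballP[d /= d0 hd].
exists d => // h hh.
have hb : ball (0 : R * R) d h.
  split => /=; rewrite /ball /= sub0r normrN; apply: le_lt_trans hh.
    exact: (abs_Re_le (toC h)).
  exact: (abs_Im_le (toC h)).
have := hd h hb; rewrite /= -lin => H.
have E : f (p + h) - f p - 'd f p h = f (h + p) - (f p + 'd f p h).
  by rewrite [p + h]addrC opprD addrA.
rewrite E; apply: le_trans H _; rewrite ler_wpM2l ?(ltW e0)//.
by rewrite prod_normE ge_max; apply/andP; split; [exact: (abs_Re_le (toC h))|exact: (abs_Im_le (toC h))].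
Qed.

Lemma disc_open p : disc p -> exists2 d, 0 < d & forall q,
  `|q.1 - p.1| <= d -> `|q.2 - p.2| <= d -> disc q.
Proof.
move: p => [x y]; rewrite /disc /= => h; pose d := (1 - (x ^+ 2 + y ^+ 2)) / 8.
(* Moving both coordinates by at most d raises the squared modulus 1 - 8 d by at most 4 d + 2 d^2,
   and d <= 1 / 8. *)
have hx := sqr_ge0 x; have hy := sqr_ge0 y.
exists d; first by rewrite /d divr_gt0 ?subr_gt0.
move=> [a b] /=; rewrite !ler_norml => /andP[a1 a2] /andP[b1 b2].
have d0 : 0 < d by rewrite /d divr_gt0 ?subr_gt0.
have x1 : -1 <= x <= 1 by rewrite !expr2 in h hx hy; apply/andP; split; nra.
have y1 : -1 <= y <= 1 by rewrite !expr2 in h hx hy; apply/andP; split; nra.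
have dE : x ^+ 2 + y ^+ 2 = 1 - 8 * d by rewrite /d; field.
have d8 : d <= 1 / 8 by rewrite /d; lra.
move/andP: x1 => [x1 x2]; move/andP: y1 => [y1 y2].
have A : a ^+ 2 <= x ^+ 2 + 2 * d + d ^+ 2.
  have -> : a = x + (a - x) by ring.
  rewrite !expr2; nra.
have B : b ^+ 2 <= y ^+ 2 + 2 * d + d ^+ 2.
  have -> : b = y + (b - y) by ring.
  rewrite !expr2; nra.
rewrite !expr2 in A B dE *; nra.
Qed.

Lemma slice_x f x y : differentiable f (x, y) ->
  is_derive x 1 (fun t => f (t, y)) ('D_(e1 R) f (x, y)).
Proof.
move=> df; apply: eps_is_derive => e e0; have [d d0 hd] := diff_eps df e0.
have c (h : R) : cabs (toC (h, 0)) = `|h| :> R by rewrite /cabs /= expr0n addr0 sqrtr_sqr.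
exists d => // h hh; have := hd (h, 0); rewrite c => /(_ hh) /=.
rewrite mul0r addr0 [h * _]mulrC.
by rewrite (_ : (x, y) + (h, 0) = (x + h, y))//; congr (_, _); rewrite addr0.
Qed.

Lemma slice_y f x y : differentiable f (x, y) ->
  is_derive y 1 (fun t => f (x, t)) ('D_(e2 R) f (x, y)).
Proof.
move=> df; apply: eps_is_derive => e e0; have [d d0 hd] := diff_eps df e0.
have c (h : R) : cabs (toC (0, h)) = `|h| :> R by rewrite /cabs /= expr0n add0r sqrtr_sqr.
exists d => // h hh; have := hd (0, h); rewrite c => /(_ hh) /=.
rewrite mul0r add0r [h * _]mulrC.
by rewrite (_ : (x, y) + (0, h) = (x, y + h))//; congr (_, _); rewrite addr0.
Qed.

Lemma MVT_pt (f df : R -> R) (a h : R) : 0 < h ->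
  (forall x, a <= x <= a + h -> is_derive x 1 f (df x)) ->
  exists2 c, a <= c <= a + h & f (a + h) - f a = df c * h.
Proof.
move=> h0 H; have ah : a <= a + h by rewrite lerDl ltW.
have [x||c] := @MVT_segment _ f df a (a + h) ah.
- by rewrite in_itv/= => /andP[ax xb]; apply: H; rewrite !ltW.
- apply: derivable_within_continuous => x; rewrite in_itv/= => axb.
  by have [] := H _ axb.
- by rewrite in_itv/= [a + h - a]addrAC subrr add0r => ? E; exists c.
Qed.

Lemma cont_eps f p : {for p, continuous f} -> forall e, 0 < e -> exists2 d, 0 < d &
  forall q, `|q.1 - p.1| < d -> `|q.2 - p.2| < d -> `|f q - f p| < e.
Proof.
move=> /cvgrPdist_lt h e /h /nbhs_ballP[d /= d0 hd]; exists d => // q q1 q2.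
by rewrite distrC; apply: hd; split; rewrite /ball /= distrC.
Qed.

Lemma half_dist_absurd (a b c : R) :
  `|c - a| < `|a - b| / 2 -> `|c - b| < `|a - b| / 2 -> False.
Proof. by have := ler_distD c a b; rewrite [`|a - c|]distrC; lra. Qed.

Lemma itv_dist_lt (a h d x : R) : a <= x <= a + h -> h < d -> `|x - a| < d.
Proof. by move=> /andP[? ?] ?; rewrite ltr_norml; apply/andP; split; lra. Qed.

(** The second difference of u over a small square of side h is, by two mean value theorems in
    either order, h^2 times a value of one or of the other mixed derivative near p. Continuity at p
    then excludes a gap. *)
Lemma schwarz u p : harmonicR_on disc u -> disc p ->
  'D_(e2 R) ('D_(e1 R) u) p = 'D_(e1 R) ('D_(e2 R) u) p.
Proof.
move=> hu Dp; apply/eqP; rewrite -subr_eq0; apply/negPn/negP; rewrite -normr_gt0 => ne.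
set A := 'D_(e2 R) ('D_(e1 R) u) p in ne *; set B := 'D_(e1 R) ('D_(e2 R) u) p in ne *.
have [_ _ _ [_ c21 c12 _] _] := hu p Dp.
have e0 : 0 < `|A - B| / 2 by rewrite divr_gt0.
have [d1 d10 h1] := cont_eps c21 e0; have [d2 d20 h2] := cont_eps c12 e0.
rewrite -/A in h1; rewrite -/B in h2.
have [d3 d30 h3] := disc_open Dp.
pose h := Num.min (Num.min (d1 / 2) (d2 / 2)) d3.
have hp : 0 < h by rewrite /h !lt_min !divr_gt0.
have hd1 : h < d1 by rewrite /h; apply: (@le_lt_trans _ _ (d1 / 2)); rewrite ?ge_min ?lexx//; lra.
have hd2 : h < d2 by rewrite /h; apply: (@le_lt_trans _ _ (d2 / 2)); rewrite ?ge_min ?lexx ?orbT//; lra.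
have hd3 : h <= d3 by rewrite /h ge_min lexx orbT.
case: p Dp A B ne c21 c12 e0 h1 h2 h3 => x0 y0 /= Dp A B ne c21 c12 e0 h1 h2 h3.
have inD x y : x0 <= x <= x0 + h -> y0 <= y <= y0 + h -> disc (x, y).
  move=> /andP[? ?] /andP[? ?]; apply: h3 => /=; rewrite ler_norml; apply/andP; split; lra.
have du x y : x0 <= x <= x0 + h -> y0 <= y <= y0 + h -> differentiable u (x, y).
  by move=> hx hy; have [] := hu _ (inD _ _ hx hy).
have du1 x y : x0 <= x <= x0 + h -> y0 <= y <= y0 + h -> differentiable ('D_(e1 R) u) (x, y).
  by move=> hx hy; have [] := hu _ (inD _ _ hx hy).
have du2 x y : x0 <= x <= x0 + h -> y0 <= y <= y0 + h -> differentiable ('D_(e2 R) u) (x, y).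
  by move=> hx hy; have [] := hu _ (inD _ _ hx hy).
have yl : y0 <= y0 <= y0 + h by rewrite lexx lerDl ltW.
have yr : y0 <= y0 + h <= y0 + h by rewrite lexx lerDl ltW.
have xl : x0 <= x0 <= x0 + h by rewrite lexx lerDl ltW.
have xr : x0 <= x0 + h <= x0 + h by rewrite lexx lerDl ltW.
have [|s hs Es] := @MVT_pt (fun x => u (x, y0 + h) - u (x, y0))
    (fun x => 'D_(e1 R) u (x, y0 + h) - 'D_(e1 R) u (x, y0)) x0 h hp.
  move=> x hx; apply: is_deriveB; apply: slice_x; exact: du.
have [|t ht Et] := @MVT_pt (fun y => 'D_(e1 R) u (s, y)) (fun y => 'D_(e2 R) ('D_(e1 R) u) (s, y)) y0 h hp.
  by move=> y hy; apply: slice_y; exact: du1.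
have [|t' ht' Et'] := @MVT_pt (fun y => u (x0 + h, y) - u (x0, y))
    (fun y => 'D_(e2 R) u (x0 + h, y) - 'D_(e2 R) u (x0, y)) y0 h hp.
  move=> y hy; apply: is_deriveB; apply: slice_y; exact: du.
have [|s' hs' Es'] := @MVT_pt (fun x => 'D_(e2 R) u (x, t')) (fun x => 'D_(e1 R) ('D_(e2 R) u) (x, t')) x0 h hp.
  by move=> x hx; apply: slice_x; exact: du2.
have E : 'D_(e2 R) ('D_(e1 R) u) (s, t) = 'D_(e1 R) ('D_(e2 R) u) (s', t').
  have : 'D_(e2 R) ('D_(e1 R) u) (s, t) * h * h = 'D_(e1 R) ('D_(e2 R) u) (s', t') * h * h.
    by rewrite -Et -Es' -Es -Et'; ring.
  by move=> /(mulIf (lt0r_neq0 hp))/(mulIf (lt0r_neq0 hp)).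
have n1 : `|'D_(e2 R) ('D_(e1 R) u) (s, t) - A| < `|A - B| / 2.
  by apply: (h1 (s, t)); apply: itv_dist_lt hd1.
have n2 : `|'D_(e1 R) ('D_(e2 R) u) (s', t') - B| < `|A - B| / 2.
  by apply: (h2 (s', t')); apply: itv_dist_lt hd2.
rewrite E in n1; exact: half_dist_absurd n1 n2.
Qed.

Lemma cabs_quotient (x y l : R[i]) (e : R) : y != 0 ->
  cabs (x - l * y) < e * cabs y -> cabs (x / y - l) < e.
Proof.
move=> y0 h; have hy : 0 < cabs y by rewrite cabs_gt0.
by rewrite -(ltr_pM2r hy) -cabsM mulrBl divfK.
Qed.

Lemma quarter_lt (e c : R) : 0 < e -> 0 < c -> e / 4 * c + e / 4 * c < e * c.
Proof. by move=> e0 c0; rewrite -mulrDl ltr_pM2r//; lra. Qed.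

Lemma Re_increment (x y b z : R[i]) (h : R) :
  complex.Re x - complex.Re y - complex.Re (b * z) * h =
  complex.Re (x - y - b * ((h%:C)%C * z)).
Proof. by rewrite !(ReD, ReN, ReM, ImM) /=; ring. Qed.

(** Laplace's equation and the symmetry of mixed derivatives are the Cauchy-Riemann equations of u_x
    - i u_y. *)
Lemma harmonic_gradient_holomorphic u : harmonicR_on disc u ->
  holomorphic_on disc (fun p => Complex ('D_(e1 R) u p) (- 'D_(e2 R) u p)).
Proof.
move=> hu p Dp; have [_ d1 d2 _ lap] := hu p Dp.
have sw := schwarz hu Dp.
set a := 'D_(e1 R) ('D_(e1 R) u) p in lap; set b := 'D_(e1 R) ('D_(e2 R) u) p in sw.
exists (Complex a (- b)) => e e0; have e4 : 0 < e / 4 by rewrite divr_gt0.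
have [r1 r10 h1] := diff_eps d1 e4; have [r2 r20 h2] := diff_eps d2 e4.
exists (Num.min r1 r2); first by rewrite lt_min r10.
move=> h h0; rewrite lt_min => /andP[/h1 k1 /h2 k2].
rewrite sw in k1; rewrite -/a -/b in k1 k2.
have a22 : 'D_(e2 R) ('D_(e2 R) u) p = - a by apply/eqP; rewrite -subr_eq0 opprK addrC lap.
rewrite a22 in k2.
have h0' : 0 < cabs (toC h) by rewrite cabs_gt0 toC_eq0.
apply: cabs_quotient; first by rewrite toC_eq0.
apply: le_lt_trans (cabs_le _) _; rewrite !ReImE /=.
apply: (@le_lt_trans _ _ (e / 4 * cabs (toC h) + e / 4 * cabs (toC h))); last first.
  exact: quarter_lt.
apply: lerD.
  apply: le_trans k1; rewrite le_eqVlt; apply/orP; left; apply/eqP; congr `|_|; ring.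
apply: le_trans k2; rewrite -normrN le_eqVlt; apply/orP; left; apply/eqP; congr `|_|; ring.
Qed.

Lemma rad1_antider (b : nat -> R[i]) (k : R[i]) : rad1 b ->
  rad1 (fun n => if n is m.+1 then b m / m.+1%:R else k).
Proof.
move=> rb r r01; have /andP[r0 r1] := r01; have [M HM] := rb r r01.
exists (Num.max M (cabs k)) => -[|n]; first by rewrite expr0 mulr1 le_max lexx orbT.
rewrite le_max; apply/orP; left; apply: le_trans (HM n).
rewrite cabsM cabsV cabs_nat exprS.
have n1 : n.+1%:R^-1 <= 1 :> R by rewrite invf_le1 ?ltr0n// ler1n.
rewrite (_ : _ * _ = (cabs (b n) * r ^+ n) * (n.+1%:R^-1 * r)); last by ring.
rewrite ler_piMr ?mulr_ge0 ?cabs_ge0 ?exprn_ge0//.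
by rewrite -[leRHS]mulr1 ler_pM ?invr_ge0// ltW.
Qed.

(** The series is the primitive of u_x - i u_y with constant term u(0, 0). Its real part and u have
    the same derivative along the segment from the origin to p. *)
Lemma harmonic_real_part u : harmonicR_on disc u -> exists2 a, rad1 a &
  forall p, disc p -> u p = complex.Re (psum a (toC p)).
Proof.
move=> hu.
have [b rb hb] := holomorphic_taylor (harmonic_gradient_holomorphic hu).
pose a n : R[i] := if n is m.+1 then b m / m.+1%:R else ((u (0, 0))%:C)%C.
have ra : rad1 a by exact: rad1_antider.
have ab : dcoef a = b.
  by apply/funext => n; rewrite /dcoef /a mulrC divfK// pnatr_eq0.
exists a => // p Dp.
have Dsp (s : R) : 0 <= s <= 1 -> disc (s * p.1, s * p.2).
  move=> /andP[s0 s1]; rewrite /disc /= !exprMn -mulrDr; apply: le_lt_trans Dp.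
  by rewrite ler_piMl ?addr_ge0 ?sqr_ge0// exprn_ile1.
pose v (s : R) := u (s * p.1, s * p.2) - complex.Re (psum a ((s%:C)%C * toC p)).
have toCs (s : R) : toC (s * p.1, s * p.2) = (s%:C)%C * toC p.
  by apply: complexP; rewrite !ReImE /=; ring.
have dv (s : R) : 0 <= s <= 0 + 1 -> is_derive s 1 v 0.
  rewrite add0r => s01; have Ds := Dsp s s01; have [du _ _ _ _] := hu _ Ds.
  pose l := complex.Re (psum b ((s%:C)%C * toC p) * toC p).
  have np := cabs_ge0 (toC p).
  have cp : 0 < cabs (toC p) + 1 by rewrite ltr_wpDl.
  rewrite -(subrr l); apply: is_deriveB; apply: eps_is_derive => e e0.
    have [d d0 hd] := diff_eps du (divr_gt0 e0 cp).
    exists (d / (cabs (toC p) + 1)); first by rewrite divr_gt0.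
    move=> h; rewrite ltr_pdivlMr// => hh.
    have hc : cabs (toC (h * p.1, h * p.2)) = `|h| * cabs (toC p).
      by rewrite toCs cabsM cabsR.
    have hl : cabs (toC (h * p.1, h * p.2)) < d.
      by rewrite hc; have := normr_ge0 h; nra.
    have := hd _ hl; rewrite hc /= => H.
    have El : l = p.1 * 'D_(e1 R) u (s * p.1, s * p.2) + p.2 * 'D_(e2 R) u (s * p.1, s * p.2).
      rewrite /l -toCs -(hb _ Ds) ReM /=; ring.
    rewrite El (_ : ((s + h) * p.1, (s + h) * p.2) = (s * p.1, s * p.2) + (h * p.1, h * p.2)); last first.
      by rewrite !mulrDl.
    rewrite [(_ + _) * h](_ : _ = h * p.1 * 'D_(e1 R) u (s * p.1, s * p.2) +
      h * p.2 * 'D_(e2 R) u (s * p.1, s * p.2)); last by ring.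
    apply: le_trans H _; rewrite mulrA mulrAC ler_wpM2r//.
    by rewrite mulrAC ler_pdivrMr//; nra.
  have s1 : cabs ((s%:C)%C * toC p) < 1 by rewrite -toCs; exact: toC_lt1.
  have [d d0 hd] := psum_cdiff ra s1 (divr_gt0 e0 cp).
  exists (d / (cabs (toC p) + 1)); first by rewrite divr_gt0.
  move=> h; rewrite ltr_pdivlMr// => hh.
  have hc : cabs ((h%:C)%C * toC p) = `|h| * cabs (toC p) by rewrite cabsM cabsR.
  have hl : cabs ((h%:C)%C * toC p) < d by rewrite hc; have := normr_ge0 h; nra.
  have := hd _ hl; rewrite hc ab => H.
  have -> : (((s + h)%:C)%C * toC p) = (s%:C)%C * toC p + (h%:C)%C * toC p.
    by rewrite rmorphD mulrDl.
  apply: (le_trans _ (le_trans (abs_Re_le _) (le_trans H _))).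
    by rewrite /l Re_increment.
  by rewrite mulrA mulrAC ler_wpM2r// mulrAC ler_pdivrMr//; nra.
have [c _] := MVT_pt ltr01 dv; rewrite add0r mul0r => /eqP; rewrite subr_eq0.
rewrite /v !mul1r !mul0r (_ : (p.1, p.2) = p); last by case: (p).
have -> : psum a 0 = ((u (0, 0))%:C)%C.
  have h0 : cabs (0 : R[i]) < 1 by rewrite cabs0.
  apply: (ccvg_unique (psum_cvg ra h0)) => e e0; exists 1%N => -[//|n] _.
  rewrite big_ord_recl /= expr0 mulr1 big1 ?addr0 ?subrr ?cabs0// => i _.
  by rewrite expr0n /= mulr0.
by rewrite /= subrr subr_eq0 => /eqP.
Qed.

End HarmonicRealPart.

(** * Reproducing kernels and the Berezin transform *)

Section ReproducingKernel.
Context {R : realType}.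
Variable alpha : R.
Hypothesis alpha_gt : -1 < alpha.
Local Notation L2 := (@leb2 R).
Local Notation w := (wt alpha).
Local Notation wC p := ((w p)%:C)%C.
Local Notation D := (discr (1 : R)).
Local Notation gam1 n := (gam alpha 1 n).
Local Notation L2f := (L2f alpha).
Local Notation ip := (ip alpha).
Local Notation nrm := (nrm alpha).
Implicit Types (f g h phi : plane R -> R[i]) (p q : plane R) (a b c : nat -> R[i]) (z : R[i]).

Let mD : measurable D := measurable_discr 1.

Lemma ccvg_sum N (F : nat -> nat -> R[i]) (L : nat -> R[i]) :
  (forall m, ccvg (F^~ m) (L m)) ->
  ccvg (fun n => \sum_(m < N) F n m) (\sum_(m < N) L m).
Proof.
move=> FL; elim: N => [|N IH].
  by apply: (ccvg_ext (u := fun=> 0)) => [n|]; rewrite big_ord0//; exact: ccvg_cst.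
rewrite big_ord_recr; apply: (ccvg_ext _ (ccvgD IH (FL N))) => n.
by rewrite big_ord_recr.
Qed.

Lemma ccvg_real (u : nat -> R) (l : R) : u @ \oo --> l ->
  ccvg (fun n => ((u n)%:C)%C) ((l%:C)%C).
Proof. by move=> ul; apply/ccvgP; split => //=; exact: cvg_cst. Qed.

Lemma ccvg_Re (u : nat -> R[i]) l : ccvg u l ->
  ccvg (fun n => ((complex.Re (u n))%:C)%C) (((complex.Re l)%:C)%C).
Proof. by move=> /ccvgP[ul _]; exact: ccvg_real. Qed.

(** Tannery's theorem: domination by a geometric series, uniform in n, lets the factors q n m tend
    to 1 under the sum. They will be quotients of moments on smaller discs by moments on the whole
    disc. *)
Lemma tannery c z (q : nat -> nat -> R) (J : nat -> R[i]) :
  rad1 c -> cabs z < 1 -> (forall n m, 0 <= q n m <= 1) ->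
  (forall m, (fun n => q n m) @ \oo --> (1 : R)) ->
  (forall n, ccvg (fun N => \sum_(m < N) c m * z ^+ m * ((q n m)%:C)%C) (J n)) ->
  ccvg J (psum c z).
Proof.
move=> rc z1 q01 q1 HJ e e0.
have zr : 0 <= cabs z < 1 by rewrite cabs_ge0.
have [M [x [x01 M0 HM]]] := rad1_geo rc zr.
have /andP[x0 x1] := x01; have x1' : 0 < 1 - x by rewrite subr_gt0.
have e4 : 0 < e / 4 by rewrite divr_gt0.
have M1 : 0 < M + 1 by rewrite ltr_wpDl.
pose F n m := c m * z ^+ m * ((q n m)%:C)%C.
have b n m : cabs (F n m) <= M * x ^+ m.
  have /andP[q0 ql] := q01 n m.
  rewrite !cabsM cabsX cabsR ger0_norm//; apply: le_trans (HM m).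
  by rewrite ler_piMr// mulr_ge0 ?cabs_ge0// exprn_ge0// cabs_ge0.
have [N1 H1] := expr_small x01 (divr_gt0 (mulr_gt0 e4 x1') M1).
have [N2 H2] := psum_cvg rc z1 e4.
pose N0 := maxn N1 N2.
have C : ccvg (fun n => \sum_(m < N0) F n m) (\sum_(m < N0) c m * z ^+ m).
  apply: (@ccvg_sum N0 F (fun m => c m * z ^+ m)) => m; have := ccvgZ (c m * z ^+ m) (ccvg_real (q1 m)).
  by rewrite rmorph1 mulr1.
have [N3 H3] := C _ e4.
exists N3 => n /H3 h3; have [N4 H4] := HJ n _ e4.
have h4 := H4 _ (leq_addl N0 N4).
have h2 := H2 _ (leq_maxr N1 N2); have h1 := H1 _ (leq_maxl N1 N2).
have mid : cabs (\sum_(m < N0 + N4) F n m - \sum_(m < N0) F n m) <= e / 4.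
  have -> : \sum_(m < N0 + N4) F n m = \sum_(m < N0) F n m + \sum_(i < N4) F n (N0 + i)%N.
    exact: big_split_ord.
  rewrite [_ + _ - _]addrAC subrr add0r.
  apply: le_trans (cabs_sum _ _ _) _.
  apply: (@le_trans _ _ (\sum_(i < N4) M * x ^+ N0 * x ^+ i)).
    by apply: ler_sum => i _; rewrite -mulrA -exprD; exact: b.
  rewrite -mulr_sumr; apply: le_trans (ler_wpM2l _ (sum_geo_le N4 x01)) _.
    by rewrite mulr_ge0// exprn_ge0.
  rewrite ler_pdivrMr//; move: h1; rewrite ltr_pdivlMr// => /ltW; apply: le_trans.
  by rewrite mulrC ler_wpM2l ?exprn_ge0// lerDl.
have t1 := cabs_tri (J n) (\sum_(m < N0 + N4) F n m) (psum c z).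
have t2 := cabs_tri (\sum_(m < N0 + N4) F n m) (\sum_(m < N0) F n m) (psum c z).
have t3 := cabs_tri (\sum_(m < N0) F n m) (\sum_(m < N0) c m * z ^+ m) (psum c z).
rewrite cabsC in h4.
lra.
Qed.

Lemma psum_head a z : rad1 a -> cabs z < 1 -> (forall n, a n.+1 * z ^+ n.+1 = 0) ->
  psum a z = a 0%N.
Proof.
move=> ra z1 h; apply: (ccvg_unique (psum_cvg ra z1)) => e e0; exists 1%N => -[//|n] _.
by rewrite big_ord_recl /= expr0 mulr1 big1 ?addr0 ?subrr ?cabs0// => i _; exact: h.
Qed.

(* Taylor coefficients of the reproducing kernel at [z]. *)
Definition kern z n : R[i] := conjc z ^+ n * (((gam1 n)^-1)%:C)%C.

(** Let t be the squared modulus of z and s the midpoint of t and 1. Then [gam_lower] at s bounds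
    t^n / gam1 n by a multiple of (t / s)^n. *)
Lemma kern_bound z : cabs z < 1 -> exists B x : R, [/\ 0 <= x < 1, 0 <= B &
  forall n, cabs (kern z n) ^+ 2 * gam1 n <= B * x ^+ n].
Proof.
move=> z1; have z0 := cabs_ge0 z; pose t := cabs z ^+ 2.
have t0 : 0 <= t by exact: sqr_ge0.
have t1 : t < 1 by rewrite expr_lt1.
pose s := (1 + t) / 2; have s0 : 0 < s by rewrite /s; lra.
have s01 : 0 <= s < 1 by rewrite ltW//= /s; lra.
have [k k0 hk] := gam_lower alpha_gt s01.
exists k^-1, (t / s); split.
- by apply/andP; split; [rewrite divr_ge0// ltW|rewrite ltr_pdivrMr// mul1r /s; lra].
- by rewrite invr_ge0 ltW.
move=> n; have g0 := gam_gt0 alpha_gt n.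
rewrite /kern cabsM cabsX cabsJ cabsR ger0_norm ?invr_ge0 ?(ltW g0)// exprMn -exprM mulnC exprM -/t.
have -> : t ^+ n * (gam1 n)^-1 ^+ 2 * gam1 n = t ^+ n * (gam1 n)^-1 by field; rewrite gt_eqF.
rewrite expr_div_n mulrCA ler_wpM2l ?exprn_ge0//.
by rewrite -invfM lef_pV2 ?posrE// mulr_gt0// exprn_gt0.
Qed.

Lemma rad1_kern z : cabs z < 1 -> rad1 (kern z).
Proof.
move=> /kern_bound[B [x [/andP[x0 x1] B0 hB]]]; apply: (rad1_bessel alpha_gt (B := B)) => n.
by apply: le_trans (hB n) _; rewrite ler_piMr// exprn_ile1// ltW.
Qed.

Lemma L2f_kern z : cabs z < 1 -> L2f (ps (kern z)).
Proof.
move=> z1; have [B [x [x01 B0 hB]]] := kern_bound z1.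
apply: (L2f_ps alpha_gt (B := B * (1 - x)^-1) (rad1_kern z1) _).1 => N.
apply: (@le_trans _ _ (\sum_(m < N) B * x ^+ m)); first by apply: ler_sum => m _; exact: hB.
by rewrite -mulr_sumr ler_wpM2l// sum_geo_le.
Qed.

Lemma A2_kern z : cabs z < 1 -> A2 alpha (ps (kern z)).
Proof. by move=> z1; apply: (ps_A2 alpha_gt (rad1_kern z1)); exact: L2f_kern. Qed.

(** If c_m are the coefficients of F times the kernel, the pairing over a smaller disc is the sum of
    c_m z^m times a quotient of moments, and [tannery] gives the limit. *)
Lemma kernel_pairing (F : R[i] -> R[i]) z : cabs z < 1 ->
  (forall v, cabs v < 1 -> exists l, cdiff F v l) ->
  ccvg (fun n => CI L2 (discr (rad n)) (fun p =>
      wC p * (F (toC p) * ps (kern z) p * conjc (ps (kern z) p))))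
    (F z * psum (kern z) z).
Proof.
move=> z1 dF; have rk := rad1_kern z1.
have [v vv|c rc hc] := @taylor_disc _ (fun v => F v * psum (kern z) v).
  have [l hl] := dF v vv.
  by eexists; apply: cdiffM hl (psum_cdiff rk vv).
rewrite (hc _ z1).
apply: (tannery (q := fun n m => gam alpha (rad n) m / gam1 m) rc z1).
- move=> n m; have g0 := gam_gt0 alpha_gt m.
  apply/andP; split; first by rewrite divr_ge0 ?gam_ge0 ?(ltW g0).
  by rewrite ler_pdivrMr// mul1r gam_le//; exact/ltW/rad_lt1.
- move=> m; rewrite -[X in _ --> X](@divff _ (gam1 m)) ?gt_eqF ?gam_gt0//.
  apply: cvgMl; apply: Rint_rad; exact: integrable_gam.
move=> n; have r1 := rad_lt1 n : rad n < 1 :> R.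
rewrite (@eq_CI _ _ _ _ _ _ (fun p => wC p * (ps c p * conjc (ps (kern z) p)))); last first.
  move=> p /set_mem Dp; rewrite /ps -hc//; apply: toC_lt1.
  by apply: discr_sub Dp; exact: ltW.
apply: ccvg_ext (pair_ps alpha_gt rc rk r1) => N; apply: eq_bigr => m _.
rewrite /kern conjcM conjcX conjc_real (_ : conjc (conjc z) = z); last first.
  by apply: complexP; rewrite !ReImE ?opprK.
by rewrite mulrA -mulrA -rmorphM mulrC [_^-1 * _]mulrC mulrC.
Qed.

(** The case F = 1 of [kernel_pairing], where the integrals converge to the squared norm of the
    kernel. *)
Lemma psum_kern z : cabs z < 1 -> psum (kern z) z = ((nrm (ps (kern z)))%:C)%C.
Proof.
move=> z1; have hK := L2f_kern z1.
have := kernel_pairing z1 (fun v _ => ex_intro _ 0 (cdiff_cst v 1)).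
rewrite mul1r => H; apply: (ccvg_unique H); rewrite -ip_nrm.
apply: ccvg_ext (CI_rad (cint_pair alpha_gt hK hK)) => n; apply: eq_CI => p _.
by rewrite mul1r.
Qed.

Lemma real_expr_div (t k : R) m :
  ((t ^+ m / k)%:C)%C = (t%:C)%C ^+ m * ((k^-1)%:C)%C.
Proof. by rewrite -(rmorphXn (real_complex R)) -rmorphM. Qed.

(** The value of the kernel at its own point is a series of nonnegative terms that starts with the
    inverse of [gam1 0]. *)
Lemma nrm_kern_gt0 z : cabs z < 1 -> 0 < nrm (ps (kern z)).
Proof.
move=> z1; apply: (@lt_le_trans _ _ (gam1 0)^-1); first by rewrite invr_gt0 gam_gt0.
have := psum_cvg (rad1_kern z1) z1; rewrite psum_kern//.
move=> /(@ccvg_Re_ge _ _ _ (gam1 0)^-1 1%N) /=; apply => -[//|N] _.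
have E m : kern z m * z ^+ m = (((cabs z ^+ 2) ^+ m / gam1 m)%:C)%C.
  by rewrite /kern mulrAC -exprMn [conjc z * z]mulrC mulcJ real_expr_div.
rewrite Re_sum big_ord_recl E /= expr0 mul1r lerDl sumr_ge0// => i _.
rewrite E; apply: divr_ge0; last exact: gam_ge0.
by apply: exprn_ge0; exact: sqr_ge0.
Qed.

Definition bdd phi := cmeas D phi /\ exists M, forall p, D p -> cabs (phi p) <= M.

(** The sesquilinear form of the Toeplitz operator; [toeplitz_form] shows that pairing with f
    removes the projection. *)
Definition sform phi f g : R[i] := ip (fun p => phi p * f p) g.

Lemma L2f_bddM phi f : bdd phi -> L2f f -> L2f (fun p => phi p * f p).
Proof.
move=> [mp [M hM]] hf; apply: (@L2f_dom _ alpha alpha_gt _ f (M ^+ 2)) => //.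
  by apply: cmeasM => //; exact: hf.1.
move=> p Dp; rewrite cabsM exprMn ler_wpM2r ?sqr_ge0// lerXn2r ?nnegrE ?cabs_ge0 ?hM//.
exact: le_trans (cabs_ge0 _) (hM p Dp).
Qed.

Lemma sform_affine phi (k m : R[i]) f g : bdd phi -> L2f f -> L2f g ->
  sform (fun p => k * phi p + m) f g = k * sform phi f g + m * ip f g.
Proof.
move=> bp hf hg; have hpf := L2f_bddM bp hf.
rewrite /sform -!ipZl// -ipDl//; [|exact: L2fZ|exact: L2fZ].
by apply: eq_ip => p _ //; rewrite mulrDl mulrA.
Qed.

Lemma sform_comb phi (k m : R[i]) f g : bdd phi -> L2f f -> L2f g ->
  let h p := k * f p + m * g p in
  sform phi h h = k * conjc k * sform phi f f + m * conjc m * sform phi g g +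
    (k * conjc m * sform phi f g + m * conjc k * sform phi g f).
Proof.
move=> bp hf hg h; have hpf := L2f_bddM bp hf; have hpg := L2f_bddM bp hg.
have hkf := L2fZ alpha_gt k hf; have hmg := L2fZ alpha_gt m hg.
have hh : L2f h by exact: L2fD.
rewrite /sform (@eq_ip _ _ _ (fun p => k * (phi p * f p) + m * (phi p * g p)) h h) => [|p _|//]; last first.
  by rewrite /h; ring.
rewrite ipDl// ?ipZl//; [|exact: L2fZ|exact: L2fZ].
by rewrite /h !ipDr// !ipZr//; ring.
Qed.

Lemma Re_mul_sq (x y : R[i]) : complex.Re (x * y * conjc y) = complex.Re x * cabs y ^+ 2.
Proof. by rewrite -mulrA mulcJ ReM /= mulr0 subr0. Qed.

Lemma Re_w_mul_sq p (x y : R[i]) :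
  complex.Re (wC p * (x * y * conjc y)) = w p * (complex.Re x * cabs y ^+ 2).
Proof. by rewrite ReZ Re_mul_sq. Qed.

Lemma Re_sform phi f : complex.Re (sform phi f f) =
  \int[L2]_(p in D) (w p * (complex.Re (phi p) * cabs (f p) ^+ 2)).
Proof.
by apply: eq_Rintegral => p _; exact: Re_w_mul_sq.
Qed.

(** Real parts are taken in [kernel_pairing] before the limit: u, unlike the series, is known to be
    bounded, so its integrals over smaller discs converge to that over the whole disc. *)
Lemma berezin_real (u : plane R -> R) a z : rad1 a -> cabs z < 1 ->
  bdd (fun p => ((u p)%:C)%C) -> (forall p, D p -> u p = complex.Re (ps a p)) ->
  sform (fun p => ((u p)%:C)%C) (ps (kern z)) (ps (kern z)) =
  ((complex.Re (psum a z) * nrm (ps (kern z)))%:C)%C.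
Proof.
move=> ra z1 bu ua; have hK := L2f_kern z1.
have := kernel_pairing z1 (fun v hv => ex_intro _ _ (psum_cdiff ra hv)).
move=> /ccvg_Re; rewrite psum_kern// ReM /= mulr0 subr0 => H.
have H' := CI_rad (cint_pair alpha_gt (L2f_bddM bu hK) hK).
apply: (ccvg_unique H'); apply: ccvg_ext H => n.
rewrite [RHS](@eq_CI _ _ _ _ _ _ (fun p => ((w p * (u p * cabs (ps (kern z) p) ^+ 2))%:C)%C)); last first.
  by move=> p _; rewrite -mulrA mulcJ !rmorphM.
rewrite (@CI_real _ _ _ (fun p => w p * (u p * cabs (ps (kern z) p) ^+ 2)))//; last first.
  exact: measurable_discr.
apply: (congr1 (fun t : R => (t%:C)%C)); apply: eq_Rintegral => p /set_mem Dp.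
rewrite ua; first exact: (Re_w_mul_sq p (psum a (toC p)) (ps (kern z) p)).
by apply: discr_sub Dp; exact/ltW/rad_lt1.
Qed.

Definition contD phi p := forall e, 0 < e -> exists2 d : R, 0 < d &
  forall q, D q -> cabs (toC q - toC p) < d -> cabs (phi q - phi p) < e.

Lemma contD_ps a p : rad1 a -> D p -> contD (ps a) p.
Proof.
move=> ra Dp e e0; have [d d0 hd] := cdiff_contat (psum_cdiff ra (toC_lt1 Dp)) e0.
have E q : toC p + (toC q - toC p) = toC q by rewrite addrC subrK.
by exists d => [//|q _ /hd]; rewrite E.
Qed.

Lemma contD_affine phi (k m : R[i]) p : contD phi p -> contD (fun q => k * phi q + m) p.
Proof.
move=> cp e e0; have k1 : 0 < cabs k + 1 by rewrite ltr_wpDl ?cabs_ge0.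
have [d d0 hd] := cp _ (divr_gt0 e0 k1); exists d => // q Dq /(hd q Dq).
rewrite ltr_pdivlMr// => h; rewrite opprD addrACA subrr addr0 -mulrBr cabsM.
by apply: le_lt_trans h; rewrite mulrC ler_wpM2l ?cabs_ge0// lerDl.
Qed.

Lemma bdd_affine phi (k m : R[i]) : bdd phi -> bdd (fun q => k * phi q + m).
Proof.
move=> [mp [M hM]]; split.
  by apply: cmeasD; [apply: cmeasM => //; exact: cmeas_cst|exact: cmeas_cst].
exists (cabs k * M + cabs m) => p Dp; apply: le_trans (cabsD _ _) _.
by rewrite cabsM lerD2r ler_wpM2l ?cabs_ge0 ?hM.
Qed.

(** A square with corner p rather than a ball, since its product measure is explicit. *)
Lemma small_square p (d : R) : D p -> 0 < d -> exists E, [/\ measurable E, E `<=` D,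
  (0 < L2 E)%E & forall q, E q -> cabs (toC q - toC p) < d].
Proof.
move=> Dp d0; have [r r0 hr] := @disc_open _ p Dp.
pose s := Num.min r (d / 4); have s0 : 0 < s by rewrite lt_min r0 divr_gt0.
have sr : s <= r by rewrite ge_min lexx.
have sd : s <= d / 4 by rewrite ge_min lexx orbT.
pose I x : set (measurableTypeR R) := `[x, x + s]%classic.
have mI x : measurable (I x) by exact: measurable_itv.
have IE x : lebesgue_measure (I x) = s%:E.
  by rewrite lebesgue_measure_itv /= lte_fin ltrDl s0 -EFinB addrAC subrr add0r.
have near q : (I p.1 `*` I p.2) q -> `|q.1 - p.1| <= s /\ `|q.2 - p.2| <= s.
  move=> [/=]; rewrite /I /= !in_itv /= => /andP[? ?] /andP[? ?].
  by split; rewrite ler_norml; apply/andP; split; lra.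
exists (I p.1 `*` I p.2); split.
- exact: measurableX.
- by move=> q /near[q1 q2]; apply: hr; exact: le_trans sr.
- have -> : L2 (I p.1 `*` I p.2) = (lebesgue_measure (I p.1) * lebesgue_measure (I p.2))%E :=
    product_measure1E _ _ (mI _) (mI _).
  by rewrite !IE -EFinM lte_fin mulr_gt0.
move=> q /near[q1 q2]; apply: le_lt_trans (cabs_le _) _; rewrite !ReImE /=.
by apply: (@le_lt_trans _ _ (s + s)); [exact: lerD|lra].
Qed.

Lemma wint_gt0 (F : plane R -> R) p (d k : R) :
  L2.-integrable D (EFin \o (fun q => w q * F q)) -> (forall q, D q -> 0 <= F q) ->
  D p -> 0 < d -> 0 < k -> (forall q, D q -> cabs (toC q - toC p) < d -> k <= F q) ->
  0 < \int[L2]_(q in D) (w q * F q).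
Proof.
move=> iF F0 Dp d0 k0 hF; have [E [mE ED E0 hE]] := small_square Dp d0.
have iFE := integrableS mD mE ED iF.
have iw : L2.-integrable E (EFin \o w).
  by apply: (integrableS mD mE ED); exact: integrable_w.
apply: (@lt_le_trans _ _ (k * \int[L2]_(q in E) w q)); first by rewrite mulr_gt0// w_pos.
apply: (@le_trans _ _ (\int[L2]_(q in E) (w q * F q))).
  rewrite -RintegralZl//; apply: le_Rintegral => //.
    exact: integrableZR.
  by move=> q Eq; rewrite mulrC ler_wpM2l ?wt_ge0// hF ?hE//; exact: ED.
rewrite /Rintegral fine_le//; [exact: integrable_fin_num|exact: integrable_fin_num|].
apply: ge0_subset_integral => //; first exact: (measurable_int L2).
by move=> q Dq; rewrite lee_fin mulr_ge0 ?wt_ge0// F0.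
Qed.

Lemma integrable_sform phi f : bdd phi -> L2f f ->
  L2.-integrable D (EFin \o (fun p => w p * (complex.Re (phi p) * cabs (f p) ^+ 2))).
Proof.
move=> bp hf; have [h _] := cint_pair alpha_gt (L2f_bddM bp hf) hf.
apply: (eq_integrableR mD _ h) => p _; exact: Re_w_mul_sq.
Qed.

Lemma half_Re_le (x y : R[i]) : cabs (y - x) < complex.Re x / 2 ->
  complex.Re x / 2 <= complex.Re y.
Proof.
by move=> /(le_lt_trans (abs_Re_le _)); rewrite ReD ReN ltr_norml => /andP[+ _]; lra.
Qed.

Lemma half_cabs_le (x y : R[i]) : cabs (y - x) < cabs x / 2 ->
  (cabs x / 2) ^+ 2 <= cabs y ^+ 2.
Proof.
move=> h; apply: lerXn2r; rewrite ?nnegrE ?divr_ge0 ?cabs_ge0//.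
by have := cabs_tri x y 0; rewrite !subr0 cabsC; lra.
Qed.

(** The integrand is nonnegative and continuous; were it positive at p, it would be bounded below on
    a small square of positive mass. *)
Lemma sform_eq0_pt phi b p : bdd phi -> contD phi p ->
  (forall q, D q -> 0 <= complex.Re (phi q)) -> rad1 b -> L2f (ps b) ->
  complex.Re (sform phi (ps b) (ps b)) = 0 -> D p -> ps b p != 0 ->
  complex.Re (phi p) = 0.
Proof.
move=> bp cp pos rb hb S0 Dp b0; apply/eqP; rewrite eq_le pos// andbT leNgt; apply/negP => r0.
have b0' : 0 < cabs (ps b p) by rewrite cabs_gt0.
have [d1 d10 h1] := cp _ (divr_gt0 r0 (ltr0Sn R 1)).
have [d2 d20 h2] := contD_ps rb Dp (divr_gt0 b0' (ltr0Sn R 1)).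
suff : 0 < complex.Re (sform phi (ps b) (ps b)) by rewrite S0 ltxx.
rewrite Re_sform; apply: (@wint_gt0 _ p (Num.min d1 d2)
  (complex.Re (phi p) / 2 * (cabs (ps b p) / 2) ^+ 2)) => //.
- exact: integrable_sform.
- by move=> q Dq; rewrite mulr_ge0 ?pos ?sqr_ge0.
- by rewrite lt_min d10.
- by rewrite mulr_gt0 ?exprn_gt0 ?divr_gt0.
move=> q Dq; rewrite lt_min => /andP[/(h1 q Dq) k1 /(h2 q Dq) k2].
apply: ler_pM; rewrite ?sqr_ge0 ?divr_ge0 ?pos//.
  exact: half_Re_le.
exact: half_cabs_le.
Qed.

(** The Berezin transform fixes phi, written without normalizing the kernel. *)
Definition berezin_fix phi := forall p, D p ->
  sform phi (ps (kern (toC p))) (ps (kern (toC p))) =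
  phi p * ((nrm (ps (kern (toC p))))%:C)%C.

Lemma berezin_affine phi (k m : R[i]) : bdd phi -> berezin_fix phi ->
  berezin_fix (fun p => k * phi p + m).
Proof.
move=> bp hp p Dp; have hK := L2f_kern (toC_lt1 Dp).
by rewrite sform_affine// hp// ip_nrm mulrDl mulrA.
Qed.

Lemma disc0 : D ((0, 0) : plane R).
Proof. by rewrite /discr /nsq /= expr0n /= addr0 ltr01. Qed.

Lemma kern0 z : kern z 0 = (((gam1 0)^-1)%:C)%C.
Proof. by rewrite /kern expr0 mul1r. Qed.

Lemma kern0_neq0 z : kern z 0 != 0.
Proof.
by rewrite kern0 -cabs_gt0 cabsR normr_gt0 invr_eq0 gt_eqF// gam_gt0.
Qed.

(* A zero of [Re phi] at [p] makes [sform phi] vanish at the kernel of [p],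
   hence [Re phi] vanishes wherever that kernel does not: first at the origin,
   then everywhere since the kernel of the origin is constant. *)
Lemma strong_minimum phi f : bdd phi -> (forall p, D p -> contD phi p) ->
  berezin_fix phi -> (forall p, D p -> 0 <= complex.Re (phi p)) ->
  A2 alpha f -> nrm f = 1 -> complex.Re (sform phi f f) = 0 ->
  forall p, D p -> complex.Re (phi p) = 0.
Proof.
move=> bp cp Bp pos /(A2_ps alpha_gt)[b [rb fb hf hb]] nf S0.
have Kzero q p : D q -> complex.Re (phi q) = 0 -> D p -> ps (kern (toC q)) p != 0 ->
    complex.Re (phi p) = 0.
  move=> Dq q0 Dp; have q1 := toC_lt1 Dq.
  apply: (sform_eq0_pt bp (cp p Dp) pos (rad1_kern q1) (L2f_kern q1)) Dp.
  by rewrite Bp// ReM /= mulr0 subr0 q0 mul0r.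
have [q [Dq q0]] : exists q, D q /\ ps b q != 0.
  apply: contrapT => H; have : nrm f = 0; last by rewrite nf => /eqP; rewrite oner_eq0.
  rewrite /nrm (@eq_Rintegral _ _ _ _ _ (fun=> 0)) ?Rintegral_cst ?mul0r// => p /set_mem Dp.
  rewrite fb// (_ : ps b p = 0) ?cabs0 ?expr0n ?mulr0//.
  by apply/eqP/negPn/negP => h; apply: H; exists p.
have z0 : complex.Re (phi (0, 0)) = 0.
  apply: (Kzero q); [exact: Dq| |exact: disc0|].
    apply: (sform_eq0_pt bp (cp q Dq) pos rb hb) => //.
    by rewrite -S0; congr complex.Re; apply: eq_ip => p /set_mem Dp; rewrite fb.
  rewrite /ps psum_head ?kern0_neq0//; [exact/rad1_kern/toC_lt1| |].
    exact: (toC_lt1 disc0).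
  by move=> n; rewrite (_ : toC (0, 0) = 0)// expr0n mulr0.
move=> p Dp; apply: (Kzero _ _ disc0 z0 Dp).
have z1 := toC_lt1 disc0; rewrite /ps psum_head ?kern0_neq0//.
- exact: rad1_kern.
- exact: toC_lt1.
move=> n; rewrite /kern (_ : conjc (toC (0, 0)) = 0); last by apply: complexP => //=; rewrite oppr0.
by rewrite expr0n !mul0r.
Qed.

(** This is [sform_eq0_pt] for the constant symbol 1, whose real part has no zero. *)
Lemma nrm_eq0 f p : A2 alpha f -> nrm f = 0 -> D p -> f p = 0.
Proof.
move=> /(A2_ps alpha_gt)[b [rb fb hf hb]] nf Dp; apply/eqP; rewrite fb//; apply/negPn/negP => b0.
have b1 : bdd (fun=> 1) by split; [exact: cmeas_cst|exists (cabs 1)].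
have c1 q : contD (fun=> 1) q by move=> e e0; exists 1 => // *; rewrite subrr cabs0.
have := @sform_eq0_pt (fun=> 1) b p b1 (c1 p) (fun q _ => ler01) rb hb _ Dp b0.
rewrite /= => H; suff /H/eqP : complex.Re (sform (fun=> 1) (ps b) (ps b)) = 0 by rewrite oner_eq0.
rewrite /sform (@eq_ip _ _ _ f _ f); [by rewrite ip_nrm /= nf| |].
  by move=> q /set_mem Dq; rewrite mul1r fb.
by move=> q /set_mem Dq; rewrite fb.
Qed.

(** * Continuity, boundedness and Berezin identity of a harmonic symbol *)

Section HarmonicSymbol.
Variable phi : plane R -> R[i].
Hypothesis phi_bounded : LinfA phi.
Hypothesis phi_harmonic : harmonic_on disc phi.

Lemma symbol_ps : exists a b, [/\ rad1 a, rad1 b,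
  forall p, D p -> complex.Re (phi p) = complex.Re (ps a p) &
  forall p, D p -> complex.Im (phi p) = complex.Re (ps b p)].
Proof.
have [/harmonic_real_part[a ra ha] /harmonic_real_part[b rb hb]] := phi_harmonic.
by exists a, b.
Qed.

Lemma contD_symbol p : D p -> contD phi p.
Proof.
move=> Dp e e0; have [a [b [ra rb ha hb]]] := symbol_ps.
have e2 : 0 < e / 2 by rewrite divr_gt0.
have [d1 d10 h1] := contD_ps ra Dp e2; have [d2 d20 h2] := contD_ps rb Dp e2.
exists (Num.min d1 d2); first by rewrite lt_min d10.
move=> q Dq; rewrite lt_min => /andP[/(h1 q Dq) k1 /(h2 q Dq) k2].
apply: le_lt_trans (cabs_le _) _; rewrite !(ReD, ImD, ReN, ImN) !ha// !hb// -!ReN -!ReD.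
have := abs_Re_le (ps a q - ps a p); have := abs_Re_le (ps b q - ps b p); lra.
Qed.

(** The essential bound holds everywhere: by continuity, exceeding it at one point means exceeding
    it on a square of positive measure. *)
Lemma bdd_symbol : bdd phi.
Proof.
have [a [b [ra rb ha hb]]] := symbol_ps; split.
  split.
    apply: (eq_measurable_fun (fun p => complex.Re (ps a p))) (cmeas_ps ra (lexx 1)).1.
    by move=> p /set_mem Dp; rewrite ha.
  apply: (eq_measurable_fun (fun p => complex.Re (ps b p))) (cmeas_ps rb (lexx 1)).1.
  by move=> p /set_mem Dp; rewrite hb.
have [_ _ [M [N [mN N0 hN]]]] := phi_bounded.
exists M => p Dp; rewrite leNgt; apply/negP => pM.
have eM : 0 < cabs (phi p) - M by rewrite subr_gt0.
have [d d0 hd] := contD_symbol Dp eM.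
have [E [mE ED E0 hE]] := small_square Dp d0.
suff : (L2 E <= 0)%E by move=> /(lt_le_trans E0); rewrite ltxx.
rewrite -[X in (_ <= X)%E]N0; apply: le_measure; rewrite ?inE//.
move=> q Eq; apply: hN => /= /(_ (ED _ Eq)) qM.
have := hd _ (ED _ Eq) (hE _ Eq); have := cabs_tri (phi p) (phi q) 0.
rewrite !subr0 cabsC; lra.
Qed.

Lemma berezin_symbol : berezin_fix phi.
Proof.
move=> p Dp; have [a [b [ra rb ha hb]]] := symbol_ps.
have [[m1 m2] [M hM]] := bdd_symbol; have z1 := toC_lt1 Dp; have hK := L2f_kern z1.
pose u q := complex.Re (phi q); pose v q := complex.Im (phi q).
have bu : bdd (fun q => ((u q)%:C)%C).
  split; first exact: cmeas_real.
  by exists M => q Dq; rewrite cabsR; apply: le_trans (abs_Re_le _) (hM q Dq).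
have bv : bdd (fun q => ((v q)%:C)%C).
  split; first exact: cmeas_real.
  by exists M => q Dq; rewrite cabsR; apply: le_trans (abs_Im_le _) (hM q Dq).
have hu := L2f_bddM bu hK; have hv := L2f_bddM bv hK.
(* The symbol is a combination of two real harmonic functions, each the real part of its own series,
   so [berezin_real] is applied to both. *)
rewrite /sform (@eq_ip _ _ _ (fun q => ((u q)%:C)%C * ps (kern (toC p)) q +
   Complex 0 1 * (((v q)%:C)%C * ps (kern (toC p)) q)) _ (ps (kern (toC p)))) => [|q _|//]; last first.
  by rewrite mulrA -mulrDl; congr (_ * _); apply: complexP; rewrite !ReImE /=; ring.
rewrite ipDl//; last exact: L2fZ.
rewrite ipZl// [X in X + _](berezin_real ra z1 bu ha) [X in _ + _ * X](berezin_real rb z1 bv hb).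
rewrite -/(ps a p) -/(ps b p) -ha// -hb//.
by apply: complexP; rewrite !ReImE /=; ring.
Qed.

End HarmonicSymbol.
End ReproducingKernel.

(** * Convex sets of the plane and proper separation *)

Section PlaneConvexity.
Context {R : realType}.
Implicit Types (p q x y : R * R) (C S : set (R * R)).

Definition convex2 C := forall p q (s : R), 0 <= s <= 1 -> C p -> C q ->
  C ((1 - s) * p.1 + s * q.1, (1 - s) * p.2 + s * q.2).

(** A convex set with an axis segment around the origin and a point (a2, l2) above it contains a
    half neighbourhood of the origin: (a, l) combines (a2, l2), with weight l / l2, and a point of
    the segment. *)
Lemma half_strip (V : R -> R -> Prop) (n m a2 l2 : R) :
  (forall a l a' l' s, 0 <= s <= 1 -> V a l -> V a' l' ->
    V ((1 - s) * a + s * a') ((1 - s) * l + s * l')) ->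
  0 < n -> m < 0 -> 0 < l2 -> V n 0 -> V m 0 -> V a2 l2 ->
  exists2 d, 0 < d & forall a l, `|a| <= d -> 0 <= l <= d -> V a l.
Proof.
move=> cV n0 m0 l20 Vn Vm V2.
have seg a : m <= a <= n -> V a 0.
  move=> /andP[ma an]; have nm : 0 < n - m by lra.
  pose s := (a - m) / (n - m).
  have := @cV m 0 n 0 s; rewrite !mulr0 addr0.
  have -> : (1 - s) * m + s * n = a by rewrite /s; field; rewrite gt_eqF.
  apply => //; rewrite /s; apply/andP; split; first by rewrite divr_ge0; lra.
  by rewrite ler_pdivrMr// mul1r; lra.
pose r := Num.min n (- m); have r0 : 0 < r by rewrite lt_min n0 oppr_gt0.
have rn : r <= n by rewrite ge_min lexx.
have rm : r <= - m by rewrite ge_min lexx orbT.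
have A1 : 0 < 4 * (`|a2| + 1) by rewrite mulr_gt0// ltr_wpDl.
(* The weight s is at most 1 / 2, and both a and s a2 are at most r / 4 in absolute value, so the
   point needed on the axis lies within r of the origin. *)
pose d := Num.min (l2 / 2) (Num.min (r / 4) (r * l2 / (4 * (`|a2| + 1)))).
have d0 : 0 < d by rewrite !lt_min !divr_gt0 ?mulr_gt0 ?ltr_wpDl.
have d1 : d <= l2 / 2 by rewrite ge_min lexx.
have d2 : d <= r / 4 by rewrite !ge_min lexx orbT.
have d3 : d <= r * l2 / (4 * (`|a2| + 1)) by rewrite !ge_min lexx !orbT.
exists d => // a l ad /andP[l0 ld].
pose s := l / l2.
have s0 : 0 <= s by rewrite divr_ge0// ltW.
have s2 : s <= 1 / 2 by rewrite ler_pdivrMr//; lra.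
have sa : `|s * a2| <= r / 4.
  rewrite normrM ger0_norm// /s mulrAC ler_pdivrMr//.
  have : l * (4 * (`|a2| + 1)) <= r * l2 by rewrite -ler_pdivlMr//; exact: le_trans d3.
  by have := normr_ge0 a2; nra.
have s1 : 1 - s != 0 by apply/eqP; lra.
have := @cV ((a - s * a2) / (1 - s)) 0 a2 l2 s.
have -> : (1 - s) * ((a - s * a2) / (1 - s)) + s * a2 = a by field.
have -> : (1 - s) * 0 + s * l2 = l by rewrite mulr0 add0r /s divfK// gt_eqF.
apply => //; first by apply/andP; split; lra.
apply: seg; move: ad sa; rewrite !ler_norml => /andP[? ?] /andP[? ?].
have s1' : 0 < 1 - s by lra.
by rewrite ler_pdivlMr// ler_pdivrMr//; apply/andP; split; nra.
Qed.

Lemma ball_coord x y (e : R) : ball x e y -> `|y.1 - x.1| < e /\ `|y.2 - x.2| < e.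
Proof. by move=> [h1 h2]; split; rewrite distrC. Qed.

Lemma comb_fst n (l : 'I_n -> R) (z : 'I_n -> R * R) :
  (\sum_i l i *: z i).1 = \sum_i l i * (z i).1.
Proof. by elim/big_ind2 : _ => // u u' v v' <- <-. Qed.

Lemma comb_snd n (l : 'I_n -> R) (z : 'I_n -> R * R) :
  (\sum_i l i *: z i).2 = \sum_i l i * (z i).2.
Proof. by elim/big_ind2 : _ => // u u' v v' <- <-. Qed.

Lemma aff_hull_functional C (a b k : R) y :
  (forall q, C q -> a * q.1 + b * q.2 = k) -> aff_hull C y -> a * y.1 + b * y.2 = k.
Proof.
move=> h [n [l [z [l1 Cz ->]]]].
rewrite comb_fst comb_snd !mulr_sumr -big_split /= -[RHS]mul1r -l1 mulr_suml.
by apply: eq_bigr => i _; rewrite -(h _ (Cz i)); ring.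
Qed.

Lemma conv_hull_ge S (a b k : R) y :
  (forall q, S q -> k <= a * q.1 + b * q.2) -> conv_hull S y -> k <= a * y.1 + b * y.2.
Proof.
move=> h [n [l [z [l0 l1 Cz ->]]]].
rewrite comb_fst comb_snd !mulr_sumr -big_split /= -[leLHS]mul1r -l1 mulr_suml.
apply: ler_sum => i _; apply: (@le_trans _ _ (l i * (a * (z i).1 + b * (z i).2))).
  by rewrite ler_wpM2l ?h.
by rewrite le_eqVlt; apply/orP; left; apply/eqP; ring.
Qed.

Lemma sub_conv_hull S q : S q -> conv_hull S q.
Proof.
move=> Sq; exists 1%N, (fun=> 1), (fun=> q); split => //; first by rewrite big_ord1.
by rewrite big_ord1 scale1r.
Qed.

Lemma convex_conv_hull S : convex2 (conv_hull S).
Proof.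
move=> p q s /andP[s0 s1] [n [l [y [l0 l1 Sy ->]]]] [m [k [z [k0 k1 Sz ->]]]].
pose c (i : 'I_(n + m)) := match fintype.split i with inl j => (1 - s) * l j | inr j => s * k j end.
pose v (i : 'I_(n + m)) := match fintype.split i with inl j => y j | inr j => z j end.
have cl j : c (lshift m j) = (1 - s) * l j by rewrite /c (unsplitK (inl j)).
have cr j : c (rshift n j) = s * k j by rewrite /c (unsplitK (inr j)).
have vl j : v (lshift m j) = y j by rewrite /v (unsplitK (inl j)).
have vr j : v (rshift n j) = z j by rewrite /v (unsplitK (inr j)).
exists (n + m)%N, c, v; split.
- by move=> i; rewrite /c; case: (fintype.split i) => j; rewrite mulr_ge0// subr_ge0.
- rewrite big_split_ord /=; under eq_bigr do rewrite cl.
  under [X in _ + X]eq_bigr do rewrite cr.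
  by rewrite -!mulr_sumr l1 k1; ring.
- by move=> i; rewrite /v; case: (fintype.split i).
have -> : \sum_i c i *: v i = (1 - s) *: (\sum_i l i *: y i) + s *: (\sum_i k i *: z i).
  rewrite big_split_ord !scaler_sumr; congr (_ + _); apply: eq_bigr => j _.
    by rewrite cl vl scalerA.
  by rewrite cr vr scalerA.
by [].
Qed.

Lemma closure_ge S (a b k : R) y :
  (forall q, S q -> k <= a * q.1 + b * q.2) -> closure S y -> k <= a * y.1 + b * y.2.
Proof.
move=> h cy; apply: ler_inf_eps => e e0.
have ab : 0 < `|a| + `|b| + 1 by rewrite ltr_wpDl// addr_ge0.
have d0 : 0 < e / (`|a| + `|b| + 1) by rewrite divr_gt0.
have [q [Sq]] := cy _ (nbhsx_ballx y _ d0).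
move=> /ball_coord[]; rewrite !ltr_pdivlMr// => q1 q2; have := h q Sq.
have : `|a * (q.1 - y.1) + b * (q.2 - y.2)| <= e.
  apply: le_trans (ler_normD _ _) _; rewrite !normrM.
  have := normr_ge0 a; have := normr_ge0 b; have := normr_ge0 (q.1 - y.1).
  have := normr_ge0 (q.2 - y.2); nra.
by rewrite ler_norml => /andP[_]; lra.
Qed.

Lemma aff_hull2 C p q (t : R) : C p -> C q ->
  aff_hull C ((1 - t) * p.1 + t * q.1, (1 - t) * p.2 + t * q.2).
Proof.
move=> Cp Cq; exists 2%N, (fun i => if i == ord0 then 1 - t else t),
  (fun i => if i == ord0 then p else q); split.
- by rewrite !big_ord_recl big_ord0 /=; ring.
- by move=> i; case: ifP.
by rewrite !big_ord_recl big_ord0 /= addr0.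
Qed.

(** From x one can move slightly away from q within C; the functional would drop below its minimum
    there if it were larger at q than at x. *)
Lemma rel_int_const C (a b : R) x : rel_int C x ->
  (forall q, C q -> a * x.1 + b * x.2 <= a * q.1 + b * q.2) ->
  forall q, C q -> a * q.1 + b * q.2 = a * x.1 + b * x.2.
Proof.
move=> [Cx [e e0 he]] h q Cq.
pose m := `|q.1 - x.1| + `|q.2 - x.2| + 1.
have m0 : 0 < m by rewrite ltr_wpDl// addr_ge0.
pose t := e / m; have t0 : 0 < t by rewrite divr_gt0.
have := he _ (aff_hull2 (- t) Cx Cq).
have bnd (u v : R) : `|v - u| < m -> `|u - ((1 - - t) * u + - t * v)| < e.
  move=> uv; rewrite (_ : _ - _ = t * (v - u)); last by ring.
  by rewrite normrM gtr0_norm// /t mulrAC ltr_pdivrMr// ltr_pM2l.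
have hb : ball x e ((1 - - t) * x.1 + - t * q.1, (1 - - t) * x.2 + - t * q.2).
  split; apply: bnd; rewrite /m.
    by have := normr_ge0 (q.2 - x.2); lra.
  by have := normr_ge0 (q.1 - x.1); lra.
move=> /(_ hb)/h /= H; apply/eqP; rewrite eq_le (h q Cq) andbT.
rewrite -subr_ge0 -(pmulr_rge0 _ t0); move: H; rewrite -subr_ge0.
by congr (0 <= _); ring.
Qed.

(** By contraposition: if every functional that is minimal at x on C is constant on C, then C
    reaches around x in every direction of its affine hull. *)
Lemma separation C x : convex2 C -> (exists c, C c) -> ~ rel_int C x ->
  exists a b : R, (forall q, C q -> a * x.1 + b * x.2 <= a * q.1 + b * q.2) /\
    exists2 q, C q & a * x.1 + b * x.2 < a * q.1 + b * q.2.
Proof.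
move=> cC [c0 Cc0] nx; apply: contrapT => nosep; apply: nx.
have sep0 a b : (forall q, C q -> a * x.1 + b * x.2 <= a * q.1 + b * q.2) ->
    forall q, C q -> a * q.1 + b * q.2 = a * x.1 + b * x.2.
  move=> h q Cq; apply/eqP; rewrite eq_le h// andbT leNgt; apply/negP => lt.
  by apply: nosep; exists a, b; split => //; exists q.
(* If C has no point other than x, its affine hull is that point. *)
have [all_x|] := pselect (forall c, C c -> c = x).
  split; first by rewrite -(all_x _ Cc0).
  exists 1 => // y /(aff_hull_functional (C := C)) H _.
  have h1 : y.1 = x.1.
    by have := H 1 0 x.1; rewrite mul1r mul0r addr0; apply => q /all_x ->; ring.
  have h2 : y.2 = x.2.
    by have := H 0 1 x.2; rewrite mul1r mul0r add0r; apply => q /all_x ->; ring.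
  suff -> : y = c0 by [].
  rewrite (all_x _ Cc0).
  by case: (y) (x) h1 h2 => ? ? [? ?] /= -> ->.
move=> /existsNP[c1 /not_implyP[Cc1 c1x]].
(* A and L are coordinates, up to scale, along and across the direction from x to c1, with origin x;
   V is the image of C in them. *)
pose d1 := c1.1 - x.1; pose d2 := c1.2 - x.2.
pose A q := d1 * (q.1 - x.1) + d2 * (q.2 - x.2).
pose L q := d1 * (q.2 - x.2) - d2 * (q.1 - x.1).
pose n := d1 ^+ 2 + d2 ^+ 2.
have n0 : 0 < n.
  rewrite lt_neqAle addr_ge0 ?sqr_ge0// andbT eq_sym; apply/eqP => /eqP.
  rewrite paddr_eq0 ?sqr_ge0// !sqrf_eq0 !subr_eq0 => /andP[/eqP e1 /eqP e2].
  by apply: c1x; case: (c1) (x) e1 e2 => ? ? [? ?] /= -> ->.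
have Ac1 : A c1 = n by rewrite /A /n -/d1 -/d2; ring.
have Lc1 : L c1 = 0 by rewrite /L -/d1 -/d2; ring.
pose V a l := exists q, [/\ C q, A q = a & L q = l].
have cV a l a' l' s : 0 <= s <= 1 -> V a l -> V a' l' ->
    V ((1 - s) * a + s * a') ((1 - s) * l + s * l').
  move=> s01 [q [Cq <- <-]] [q' [Cq' <- <-]]; eexists; split; first exact: (cC q q' s s01 Cq Cq').
    by rewrite /A /=; ring.
  by rewrite /L /=; ring.
have VC y : V (A y) (L y) -> C y.
  move=> [q [Cq Aq Lq]]; suff -> : y = q by [].
  have e1 : n * (q.1 - y.1) = 0.
    have -> : n * (q.1 - y.1) = d1 * (A q - A y) - d2 * (L q - L y) by rewrite /n /A /L; ring.
    by rewrite Aq Lq; ring.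
  have e2 : n * (q.2 - y.2) = 0.
    have -> : n * (q.2 - y.2) = d2 * (A q - A y) + d1 * (L q - L y) by rewrite /n /A /L; ring.
    by rewrite Aq Lq; ring.
  move/eqP: e1; rewrite mulf_eq0 gt_eqF//= subr_eq0 => /eqP e1.
  move/eqP: e2; rewrite mulf_eq0 gt_eqF//= subr_eq0 => /eqP e2.
  by case: (y) (q) e1 e2 => ? ? [? ?] /= -> ->.
have VA q : C q -> V (A q) (L q) by move=> Cq; exists q.
have Vn : V n 0 by rewrite -Ac1 -Lc1; exact: VA.
have sepAL k m : (forall q, C q -> 0 <= k * A q + m * L q) ->
    forall q, C q -> k * A q + m * L q = 0.
  move=> h q Cq; pose a := k * d1 - m * d2; pose b := k * d2 + m * d1.
  have E q' : k * A q' + m * L q' = (a * q'.1 + b * q'.2) - (a * x.1 + b * x.2).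
    by rewrite /A /L /a /b; ring.
  rewrite E (sep0 a b) ?subrr// => q' /h; rewrite E subr_ge0//.
have near_x (d : R) : 0 < d -> exists2 e : R, 0 < e & forall y, ball x e y ->
    `|A y| <= d /\ `|L y| <= d.
  move=> d0; have K0 : 0 < `|d1| + `|d2| + 1 by rewrite ltr_wpDl// addr_ge0.
  exists (d / (`|d1| + `|d2| + 1)); first by rewrite divr_gt0.
  move=> y /ball_coord[]; rewrite !ltr_pdivlMr// => y1 y2.
  have := normr_ge0 d1; have := normr_ge0 d2; have := normr_ge0 (y.1 - x.1).
  have := normr_ge0 (y.2 - x.2) => ? ? ? ?.
  split; apply: le_trans (ler_normD _ _) _; rewrite ?normrN !normrM; nra.
have AL0 : A x = 0 /\ L x = 0 by rewrite /A /L !subrr; split; ring.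
(* Otherwise C meets the axis L = 0 only where A >= 0, and some functional A + k L would be
   nonnegative on C although it is positive at c1. *)
have [m m0 Vm] : exists2 m, m < 0 & V m 0.
  apply: contrapT => nom.
  have l0a q : C q -> L q = 0 -> 0 <= A q.
    move=> Cq Lq; rewrite leNgt; apply/negP => a0; apply: nom; exists (A q) => //.
    by rewrite -Lq; exact: VA.
  have cross q q' : C q -> C q' -> 0 < L q -> L q' < 0 -> - A q / L q <= - A q' / L q'.
    move=> Cq Cq' lq lq'; pose s := L q / (L q - L q').
    have k0 : 0 < L q - L q' by lra.
    have s01 : 0 <= s <= 1.
      by apply/andP; split; [apply: divr_ge0; lra|rewrite ler_pdivrMr// mul1r; lra].
    have := cV _ _ _ _ s s01 (VA _ Cq) (VA _ Cq').
    have -> : (1 - s) * L q + s * L q' = 0 by rewrite /s; field; rewrite gt_eqF.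
    move=> [y [Cy Ay Ly]]; have := l0a y Cy Ly; rewrite Ay.
    have -> : (1 - s) * A q + s * A q' = (A q' * L q - A q * L q') / (L q - L q').
      by rewrite /s; field; rewrite gt_eqF.
    rewrite pmulr_lge0 ?invr_gt0// => h.
    have -> : - A q' / L q' = A q' / (- L q') by rewrite invrN mulrN mulNr.
    rewrite ler_pdivrMr// mulrAC ler_pdivlMr ?oppr_gt0//; lra.
  suff [k hk] : exists k, forall q, C q -> 0 <= 1 * A q + k * L q.
    by have := sepAL _ _ hk _ Cc1; rewrite Ac1 Lc1; lra.
  have [[p [Cp lp]]|nop] := pselect (exists p, C p /\ 0 < L p); last first.
    have neg q : C q -> 0 <= 0 * A q + (-1) * L q.
      by move=> Cq; rewrite mul0r add0r mulN1r oppr_ge0 leNgt; apply/negP => ?; apply: nop; exists q.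
    exists 0 => q Cq; have := sepAL _ _ neg q Cq => lq.
    by rewrite mul1r mul0r addr0 l0a//; lra.
  have [[p' [Cp' lp']]|nop'] := pselect (exists p, C p /\ L p < 0); last first.
    have pos q : C q -> 0 <= 0 * A q + 1 * L q.
      by move=> Cq; rewrite mul0r add0r mul1r leNgt; apply/negP => ?; apply: nop'; exists q.
    exists 0 => q Cq; have := sepAL _ _ pos q Cq => lq.
    by rewrite mul1r mul0r addr0 l0a//; lra.
  (* Points with L > 0 bound k from below, those with L < 0 from above. By [cross] the supremum of
     the lower bounds meets all upper ones. *)
  pose U : set R := [set t | exists q, [/\ C q, 0 < L q & t = - A q / L q]].
  have Up : U (- A p / L p) by exists p.
  have ubU q' : C q' -> L q' < 0 -> ubound U (- A q' / L q').
    by move=> Cq' lq' t [q [Cq lq ->]]; exact: cross.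
  exists (sup U) => q Cq; rewrite mul1r.
  have [lq|lq|lq] := ltrgtP (L q) 0.
  - have := ge_sup (ex_intro _ _ Up) (ubU q Cq lq).
    have -> : - A q / L q = A q / (- L q) by rewrite invrN mulrN mulNr.
    by rewrite ler_pdivlMr ?oppr_gt0//; lra.
  - have : - A q / L q <= sup U by apply: ub_le_sup; [exists (- A p' / L p'); exact: ubU|exists q].
    by rewrite ler_pdivrMr//; lra.
  - by rewrite lq mulr0 addr0 l0a.
(* Without a point above the axis, L vanishes on C, which lies on a line. [W] ignores its second
   argument, so that [half_strip] yields an interval. *)
have [[p [Cp lp]]|nop] := pselect (exists p, C p /\ 0 < L p); last first.
  have neg q : C q -> 0 <= 0 * A q + (-1) * L q.
    by move=> Cq; rewrite mul0r add0r mulN1r oppr_ge0 leNgt; apply/negP => ?; apply: nop; exists q.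
  have L0 q : C q -> L q = 0 by move=> Cq; have := sepAL _ _ neg q Cq; lra.
  have Lx q : L q = (- d2) * q.1 + d1 * q.2 - ((- d2) * x.1 + d1 * x.2) by rewrite /L; ring.
  pose W a (l : R) := V a 0.
  have cW a l a' l' s : 0 <= s <= 1 -> W a l -> W a' l' ->
      W ((1 - s) * a + s * a') ((1 - s) * l + s * l').
    by move=> s01 h h'; have := cV _ _ _ _ s s01 h h'; rewrite !mulr0 addr0.
  have [d d0 hd] := @half_strip W n m n 1 cW n0 m0 ltr01 Vn Vm Vn.
  have [e e0 he] := near_x d d0.
  split.
    apply: VC; rewrite AL0.1 AL0.2; apply: (hd 0 0); first by rewrite normr0 ltW.
    by rewrite lexx ltW.
  exists e => // y hy /he[ay _]; apply: VC.
  have -> : L y = 0.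
    rewrite Lx (aff_hull_functional (k := - d2 * x.1 + d1 * x.2) _ hy) ?subrr// => q Cq.
    by apply/eqP; rewrite -subr_eq0 -Lx L0.
  by apply: (hd _ 0) => //; rewrite lexx ltW.
have [[p' [Cp' lp']]|nop'] := pselect (exists p, C p /\ L p < 0); last first.
  have pos q : C q -> 0 <= 0 * A q + 1 * L q.
    by move=> Cq; rewrite mul0r add0r mul1r leNgt; apply/negP => ?; apply: nop'; exists q.
  by have := sepAL _ _ pos p Cp; lra.
(* The reflection of L brings the points below the axis under [half_strip]; the two half
   neighbourhoods cover a full one. *)
pose V' a l := V a (- l).
have cV' a l a' l' s : 0 <= s <= 1 -> V' a l -> V' a' l' ->
    V' ((1 - s) * a + s * a') ((1 - s) * l + s * l').
  by move=> s01 h h'; have := cV _ _ _ _ s s01 h h'; rewrite !mulrN -opprD.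
have V'n t : V t 0 -> V' t 0 by rewrite /V' oppr0.
have V'p : V' (A p') (- L p') by rewrite /V' opprK; exact: VA.
have lp'' : 0 < - L p' by rewrite oppr_gt0.
have [d d0 hd] := half_strip cV n0 m0 lp Vn Vm (VA _ Cp).
have [d' d'0 hd'] := half_strip cV' n0 m0 lp'' (V'n _ Vn) (V'n _ Vm) V'p.
have dd : 0 < Num.min d d' by rewrite lt_min d0.
have [e e0 he] := near_x _ dd.
have all y : ball x e y -> C y.
  move=> /he[]; rewrite !le_min => /andP[ad ad'] /andP[ld ld']; apply: VC.
  have [l0|l0] := leP 0 (L y).
    by apply: hd => //; rewrite l0 -(ger0_norm l0).
  have := hd' (A y) (- L y) ad'; rewrite /V' opprK; apply.
  by rewrite oppr_ge0 ltW//= -(ltr0_norm l0).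
by split; [apply: all; exact: ballxx|exists e => // y _; exact: all].
Qed.

End PlaneConvexity.

(** * The numerical range and its convexity *)

Section NumericalRange.
Context {R : realType}.
Variable alpha : R.
Hypothesis alpha_gt : -1 < alpha.
Local Notation D := (discr (1 : R)).
Local Notation L2f := (L2f alpha).
Local Notation ip := (ip alpha).
Local Notation nrm := (nrm alpha).
Local Notation sform := (sform alpha).
Implicit Types (f g h phi : plane R -> R[i]) (p q : plane R) (z : R[i]).

Lemma A2_L2f f : A2 alpha f -> L2f f.
Proof. by move=> [/(L2AE alpha_gt)]. Qed.

Lemma A2_comb (k m : R[i]) f g : A2 alpha f -> A2 alpha g ->
  A2 alpha (fun p => k * f p + m * g p).
Proof.
move=> Af Ag; have hf := A2_L2f Af; have hg := A2_L2f Ag; split.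
  by apply/(L2AE alpha_gt); apply: L2fD => //; exact: L2fZ.
have H v : cabs v < 1 -> exists l, cdiff (fun z => k * f (ofC z) + m * g (ofC z)) v l.
  move=> v1; have [l hl] := holomorphic_cdiff Af.2 v1.
  have [l' hl'] := holomorphic_cdiff Ag.2 v1.
  eexists; apply: cdiffD; [exact: cdiffM (cdiff_cst v k) hl|exact: cdiffM (cdiff_cst v m) hl'].
have := cdiff_holomorphic H; congr holomorphic_on.
by apply/funext => p; rewrite toCK.
Qed.

Lemma sformZ phi (k : R[i]) f : bdd phi -> L2f f ->
  sform phi (fun p => k * f p) (fun p => k * f p) = k * conjc k * sform phi f f.
Proof.
move=> bp hf; have hpf := L2f_bddM alpha_gt bp hf; have hk := L2fZ alpha_gt k hf.
rewrite /sform (@eq_ip _ _ _ (fun p => k * (phi p * f p)) (fun p => k * f p) (fun p => k * f p)) => [|p _|//].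
  by rewrite ipZl// ipZr// mulrA.
by rewrite mulrCA.
Qed.

Lemma A2Z (k : R[i]) f : A2 alpha f -> A2 alpha (fun p => k * f p).
Proof.
move=> Af; have := A2_comb k 0 Af Af; congr A2.
by apply/funext => p; rewrite mul0r addr0.
Qed.

Lemma A2_normalize phi f : bdd phi -> A2 alpha f -> 0 < nrm f -> exists g,
  [/\ A2 alpha g, nrm g = 1 & sform phi g g = sform phi f f / ((nrm f)%:C)%C].
Proof.
move=> bp Af n0; have hf := A2_L2f Af; pose k : R[i] := (((Num.sqrt (nrm f))^-1)%:C)%C.
have s0 : 0 < (Num.sqrt (nrm f))^-1 by rewrite invr_gt0 sqrtr_gt0.
exists (fun p => k * f p); split; first exact: A2Z.
  rewrite nrmZ// cabsR gtr0_norm// exprVn sqr_sqrtr ?(ltW n0)// mulVf//.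
  by rewrite gt_eqF.
rewrite sformZ// mulcJ cabsR gtr0_norm// exprVn sqr_sqrtr ?(ltW n0)// mulrC.
by rewrite fmorphV.
Qed.

(** The difference between phi f and its projection is orthogonal to f, which is in the Bergman
    space. *)
Lemma toeplitz_form phi f : bdd phi -> A2 alpha f ->
  ipA alpha (toeplitz alpha phi f) f = sform phi f f.
Proof.
move=> bp Af; have hf := A2_L2f Af; have hpf := L2f_bddM alpha_gt bp hf.
(* The branch with default value 0 is excluded by [projection_exists]. *)
rewrite /toeplitz /Palpha; case: pselect => [H|[]]; last exact: projection_exists.
have [Ah /(_ f Af)] := projT2 (cid H); set h := projT1 _ in Ah *.
have hh := A2_L2f Ah; rewrite !ipAE => E.
by apply/eqP; rewrite eq_sym -subr_eq0 -ipBl//; apply/eqP.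
Qed.

Lemma numrangeE phi : bdd phi -> numrange alpha phi =
  [set v | exists f, [/\ A2 alpha f, nrm f = 1 & v = sform phi f f]].
Proof.
move=> bp; apply/seteqP; split => v [f [Af nf ->]]; exists f; split => //.
- by move: nf; rewrite ipAE ip_nrm => /(congr1 (@complex.Re R)).
- exact: toeplitz_form.
- by rewrite ipAE ip_nrm nf.
- by rewrite toeplitz_form.
Qed.

Lemma symbol_numrange phi p : bdd phi -> berezin_fix alpha phi -> D p ->
  numrange alpha phi (phi p).
Proof.
move=> bp Bp Dp; have z1 := toC_lt1 Dp; rewrite numrangeE//.
have n0 := nrm_kern_gt0 alpha_gt z1.
have [g [Ag ng gE]] := A2_normalize bp (A2_kern alpha_gt z1) n0.
exists g; split => //; rewrite gE Bp// mulfK//.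
by rewrite -cabs_gt0 cabsR normr_gt0 gt_eqF.
Qed.

(** With e = e1 + i e2 the imaginary part is e1 (Im x + Im y) - e2 (Re x - Re y), which vanishes for
    e parallel to z, or for any e if z = 0. *)
Lemma unimodular_real (x y : R[i]) : exists e : R[i], cabs e = 1 /\
  complex.Im (conjc e * x + e * y) = 0.
Proof.
pose z := Complex (complex.Re x - complex.Re y) (complex.Im x + complex.Im y).
have [z0|z0] := eqVneq z 0.
  exists 1; split; first by rewrite (cabsR 1) normr1.
  have := congr1 (@complex.Im R) z0; rewrite /= !ReImE /=; lra.
have c0 : 0 < cabs z by rewrite cabs_gt0.
exists (((cabs z)^-1)%:C%C * z); split.
  by rewrite cabsM cabsR gtr0_norm ?invr_gt0// mulVf// gt_eqF.
by rewrite conjcM conjc_real !ReImE /=; ring.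
Qed.

(** The difference of the two sides is -l at s = 0 and 1 - l at s = 1. Here k and n are the cross
    terms of the form and of the squared norm, so that their quotient takes the value l. *)
Lemma quadratic_ivt (k n l : R) : 0 <= l <= 1 -> exists s, 0 <= s <= 1 /\
  s ^+ 2 + s * (1 - s) * k = l * ((1 - s) ^+ 2 + s ^+ 2 + s * (1 - s) * n).
Proof.
move=> /andP[l0 l1].
pose P : {poly R} := 'X ^+ 2 + 'X * (1 - 'X) * k%:P -
  l%:P * ((1 - 'X) ^+ 2 + 'X ^+ 2 + 'X * (1 - 'X) * n%:P).
have E s : P.[s] = s ^+ 2 + s * (1 - s) * k - l * ((1 - s) ^+ 2 + s ^+ 2 + s * (1 - s) * n).
  by rewrite /P !(hornerE, horner_exp).
have [|s s01 /eqP] := @poly_ivt _ P 0 1 ler01.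
  by rewrite !E; apply/andP; split; rewrite !expr2; lra.
by rewrite E => /eqP; rewrite subr_eq0 => /eqP ?; exists s.
Qed.

(* The Toeplitz-Hausdorff theorem: after an affine change of [phi] the two
   given values are 0 and 1, and multiplying [g] by a unimodular constant makes
   the form real along the segment from [f] to [g]. *)
Lemma numrange_segment phi f g (l : R) : bdd phi -> A2 alpha f -> A2 alpha g ->
  nrm f = 1 -> nrm g = 1 -> 0 <= l <= 1 -> exists h, [/\ A2 alpha h, nrm h = 1 &
    sform phi h h = ((1 - l)%:C)%C * sform phi f f + (l%:C)%C * sform phi g g].
Proof.
move=> bp Af Ag nf ng l01; set a := sform phi f f; set b := sform phi g g.
have [ab|ab] := eqVneq a b.
  exists f; split => //; rewrite -ab -mulrDl -rmorphD /= subrK.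
  by rewrite -/a rmorph1 mul1r.
have d0 : b - a != 0 by rewrite subr_eq0 eq_sym.
have hf := A2_L2f Af; have hg := A2_L2f Ag.
pose phi' p := (b - a)^-1 * phi p + (- a / (b - a)).
have bp' : bdd phi' by exact: bdd_affine.
have S' f' g' : L2f f' -> L2f g' ->
    sform phi' f' g' = (b - a)^-1 * (sform phi f' g' - a * ip f' g').
  by move=> hf' hg'; rewrite /phi' sform_affine//; ring.
have S'f : sform phi' f f = 0 by rewrite S'// ip_nrm nf rmorph1 mulr1 subrr mulr0.
have S'g : sform phi' g g = 1 by rewrite S'// ip_nrm ng rmorph1 mulr1 mulVf.
have [e [e1 eI]] := unimodular_real (sform phi' f g) (sform phi' g f).
pose k := complex.Re (conjc e * sform phi' f g + e * sform phi' g f).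
have kE : conjc e * sform phi' f g + e * sform phi' g f = (k%:C)%C.
  by apply: complexP => //=.
pose n := complex.Re (conjc e * ip f g + e * ip g f).
have nE : conjc e * ip f g + e * ip g f = (n%:C)%C.
  apply: complexP => //; rewrite (ipC alpha_gt hf hg) !ReImE /=; ring.
have [s [s01 hs]] := quadratic_ivt k n l01.
pose h p := ((1 - s)%:C)%C * f p + ((s%:C)%C * e) * g p.
have Ah : A2 alpha h by exact: A2_comb.
have hh := A2_L2f Ah.
have ee : e * conjc e = 1 by rewrite mulcJ e1 expr1n.
have b1 : bdd (fun=> 1 : R[i]) by split; [exact: cmeas_cst|exists (cabs 1)].
have ip1 f' g' : sform (fun=> 1) f' g' = ip f' g'.
  by apply: eq_ip => // p _; rewrite mul1r.
have form (r u v x y : R[i]) : r = conjc e * x + e * y ->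
  ((1 - s)%:C)%C * conjc ((1 - s)%:C)%C * u + (s%:C)%C * e * conjc ((s%:C)%C * e) * v +
    (((1 - s)%:C)%C * conjc ((s%:C)%C * e) * x + (s%:C)%C * e * conjc ((1 - s)%:C)%C * y) =
  (((1 - s) ^+ 2)%:C)%C * u + ((s ^+ 2)%:C)%C * v + ((s * (1 - s))%:C)%C * r.
  move=> ->; rewrite conjcM !conjc_real (_ : (s%:C)%C * e * _ = ((s ^+ 2)%:C)%C * (e * conjc e)).
    by rewrite ee mulr1 !rmorphM; ring.
  by rewrite expr2 rmorphM; ring.
have Nh : nrm h = (1 - s) ^+ 2 + s ^+ 2 + s * (1 - s) * n.
  have : ip h h = (((1 - s) ^+ 2 + s ^+ 2 + s * (1 - s) * n)%:C)%C.
    rewrite -ip1 sform_comb// !ip1 (form _ _ _ _ _ (esym nE)) !ip_nrm nf ng.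
    by rewrite rmorph1 !mulr1 -rmorphM -!rmorphD.
  by rewrite ip_nrm => /(congr1 (@complex.Re R)).
have Sh : sform phi' h h = ((s ^+ 2 + s * (1 - s) * k)%:C)%C.
  rewrite sform_comb// (form _ _ _ _ _ (esym kE)) S'f S'g mulr0 add0r mulr1.
  by rewrite -rmorphM -rmorphD.
(* If h vanished, f and g would be proportional with factors of equal modulus, so the form would
   take the same value at both, against a != b. *)
have N0 : 0 < nrm h.
  rewrite lt_neqAle (nrm_ge0 alpha_gt) andbT eq_sym; apply/eqP => h0.
  have fg p : D p -> ((1 - s)%:C)%C * f p = - ((s%:C)%C * e) * g p.
    move=> Dp; apply/eqP; rewrite -subr_eq0 mulNr opprK.
    by apply/eqP; exact: (nrm_eq0 alpha_gt Ah h0 Dp).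
  have eqS psi : bdd psi ->
      (((1 - s) ^+ 2)%:C)%C * sform psi f f = ((s ^+ 2)%:C)%C * sform psi g g.
    move=> bpsi; have := sformZ ((1 - s)%:C)%C bpsi hf.
    rewrite mulcJ cabsR real_normK ?num_real// => <-.
    have := sformZ (- ((s%:C)%C * e)) bpsi hg.
    rewrite mulcJ cabsN cabsM e1 mulr1 cabsR real_normK ?num_real// => <-.
    by apply: eq_ip => p /set_mem Dp; rewrite fg.
  have ss : (1 - s) ^+ 2 = s ^+ 2.
    have := eqS _ b1; rewrite !ip1 !ip_nrm nf ng rmorph1 !mulr1.
    by move=> /(congr1 (@complex.Re R)).
  have := eqS _ bp; rewrite -/a -/b ss => /mulfI H.
  move: ab; rewrite H ?eqxx// -cabs_gt0 cabsR normr_gt0 expf_eq0 /=.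
  by apply/eqP => s0; move: ss; rewrite s0 !expr2; lra.
have [u [Au nu uE]] := A2_normalize bp Ah N0.
exists u; split => //; rewrite uE.
have nh0 : ((nrm h)%:C)%C != 0 :> R[i] by rewrite -cabs_gt0 cabsR normr_gt0 gt_eqF.
have : sform phi h h = (a + (l%:C)%C * (b - a)) * ((nrm h)%:C)%C.
  have := Sh; rewrite S'// ip_nrm hs -Nh rmorphM => H.
  have -> : sform phi h h = (b - a) * ((b - a)^-1 * (sform phi h h - a * ((nrm h)%:C)%C)) + a * ((nrm h)%:C)%C.
    by rewrite mulVKf// subrK.
  by rewrite H; ring.
move=> ->; rewrite mulfK// rmorphB rmorph1; ring.
Qed.

Lemma convex_numrange phi : bdd phi -> convex2 (ofC @` numrange alpha phi).
Proof.
move=> bp p q s s01; rewrite numrangeE// => -[_ [f [Af nf ->]] <-] [_ [g [Ag ng ->]] <-].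
have [h [Ah nh hE]] := numrange_segment bp Af Ag nf ng s01.
exists (sform phi h h); first by exists h.
by rewrite hE /ofC !ReD !ImD !ReZ !ImZ.
Qed.

Lemma affine_functional (a b : R) (z : R[i]) (m : R) :
  complex.Re (Complex a (- b) * z + ((- m)%:C)%C) = a * (ofC z).1 + b * (ofC z).2 - m.
Proof. by rewrite ReD ReM /=; ring. Qed.

(** * The two inclusions *)

Section Symbol.
Variable phi : plane R -> R[i].
Hypothesis phi_bounded : LinfA phi.
Hypothesis phi_harmonic : harmonic_on disc phi.
Local Notation S := (ofC @` (phi @` disc)).
Local Notation K := (conv_hull (closure S)).

Let bp := bdd_symbol phi_bounded phi_harmonic.
Let Bp := berezin_symbol alpha_gt phi_bounded phi_harmonic.

Lemma symbol_hull p : D p -> K (ofC (phi p)).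
Proof.
move=> Dp; apply: sub_conv_hull; apply: subset_closure.
by exists (phi p) => //; exists p.
Qed.

(** Half-planes are closed and convex, so an inequality on the values of phi passes to the closure
    and to its hull. *)
Lemma hull_ge (a b k : R) : (forall p, D p -> k <= a * (ofC (phi p)).1 + b * (ofC (phi p)).2) ->
  forall y, K y -> k <= a * y.1 + b * y.2.
Proof.
move=> h y; apply: conv_hull_ge => q; apply: closure_ge => _ [_ [p Dp <-] <-].
exact: h.
Qed.

Lemma numrange_rel_int v : numrange alpha phi v -> rel_int K (ofC v).
Proof.
rewrite numrangeE// => -[f [Af nf vE]]; apply: contrapT => nv.
have [|a [b [hK [q Kq lt]]]] := separation (@convex_conv_hull _ _) _ nv.
  by exists (ofC (phi (0, 0))); apply: symbol_hull; exact: disc0.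
(* Multiplication by k = a - i b turns the real functional into a real part, so that it becomes the
   real part of an affine change of the symbol. *)
pose m := a * (ofC v).1 + b * (ofC v).2; pose k := Complex a (- b).
pose psi p := k * phi p + ((- m)%:C)%C.
have psiE p : complex.Re (psi p) = a * (ofC (phi p)).1 + b * (ofC (phi p)).2 - m.
  exact: affine_functional.
have pos p : D p -> 0 <= complex.Re (psi p).
  by move=> Dp; rewrite psiE subr_ge0 hK//; exact: symbol_hull.
have S0 : complex.Re (sform psi f f) = 0.
  have hf := A2_L2f Af.
  by rewrite /psi sform_affine// ip_nrm nf rmorph1 mulr1 -vE affine_functional subrr.
have cp p : D p -> contD psi p.
  by move=> Dp; apply: contD_affine; exact: contD_symbol.
have Z := strong_minimum alpha_gt (bdd_affine k _ bp) cp (berezin_affine alpha_gt k _ bp Bp) pos Af nf S0.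
(* The functional is now constant on the values of phi; the opposite inequality extends to K and
   contradicts the strict one at q. *)
have := @hull_ge (- a) (- b) (- m) _ q Kq.
have H p : D p -> - m <= - a * (ofC (phi p)).1 + - b * (ofC (phi p)).2.
  by move=> Dp; have := Z p Dp; rewrite psiE; lra.
by move=> /(_ H); move: lt; rewrite -/m; lra.
Qed.

Lemma rel_int_numrange x : rel_int K x -> (ofC @` numrange alpha phi) x.
Proof.
move=> rx; apply: contrapT => nx.
have W p : D p -> numrange alpha phi (phi p).
  by move=> Dp; exact: symbol_numrange.
have nr : ~ rel_int (ofC @` numrange alpha phi) x by move=> [].
have [|a [b [hW [_ [v Wv <-] lt]]]] := separation (convex_numrange bp) _ nr.
  by exists (ofC (phi (0, 0))), (phi (0, 0)) => //; apply: W; exact: disc0.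
have hK y : K y -> a * x.1 + b * x.2 <= a * y.1 + b * y.2.
  by apply: hull_ge => p Dp; apply: hW; exists (phi p) => //; exact: W.
(* The point of W with a larger value lies in K by the other inclusion, whereas a functional minimal
   at x is constant on K. *)
have [Kv _] := numrange_rel_int Wv.
by move: lt; rewrite (rel_int_const rx hK Kv) ltxx.
Qed.

End Symbol.
End NumericalRange.

Unset Implicit Arguments.

Theorem theorem3p6 (R : realType) (alpha : R) (phi : R * R -> R[i]) :
  -1 < alpha ->
  LinfA phi ->
  harmonic_on disc phi ->
  nonconstant_on disc phi ->
  ofC @` numrange alpha phi =
  rel_int (conv_hull (closure (ofC @` (phi @` disc)))).
Proof.
move=> alpha_gt bphi hphi _; apply/seteqP; split => [_ [v Wv <-]|x].
  exact: (numrange_rel_int alpha_gt bphi hphi).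
exact: (rel_int_numrange alpha_gt bphi hphi).
Qed.
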